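(* For every $r\in[0,\infty)$, each critical point of $\mathcal{F}_r$ is nondegenerate, i.e. the kernel of its Hessian has dimension exactly one.
   Context: Let $S^1=\mathbb{R}/\mathbb{Z}$, let $\|\cdot\|$ denote the $L^2$-norm on $S^1$, and for $k=1,2$ let $H^k_*(S^1,\mathbb{R})=H^k(S^1,\mathbb{R})\setminus\{0\}$ (Sobolev spaces $W^{k,2}$). For $r\in[0,\infty)$ define $$\mathcal{F}_r:H^1_*(S^1,\mathbb{R})\to\mathbb{R},\qquad \mathcal{F}_r(z)=2\|z\|^2\|z'\|^2+\frac{2}{\|z\|^2}+r\frac{\|z\|^2}{\|z^2\|^2}.$$ For $z\in H^2_*(S^1,\mathbb{R})$ its $L^2$-gradient is $$\nabla\mathcal{F}_r(z)=-4\|z\|^2(z''+bz+2az^3),\quad b=\frac{1}{\|z\|^6}-\frac{\|z'\|^2}{\|z\|^2}-\frac{r}{2\|z\|^2\|z^2\|^2},\quad a=\frac{r}{2\|z^2\|^4}.$$ Critical points of $\mathcal{F}_r$ are smooth and are exactly the solutions of $z''=-bz-2az^3$ with these $a,b$. The Hessian of $\mathcal{F}_r$ at a critical point $z$ is the derivative at $z$ of $\nabla\mathcal{F}_r:H^2_*(S^1,\mathbb{R})\to L^2(S^1,\mathbb{R})$. Since $\mathcal{F}_r$ is invariant under time shift $z\mapsto z(\cdot+\sigma)$, $z'$ lies in the kernel of the Hessian at a critical point $z$. A critical point is called nondegenerate if the kernel of its Hessian has dimension precisely one. *)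

(* Defs.v *)
From HB Require Import structures.
From mathcomp Require Import all_boot all_order all_algebra.
From mathcomp Require Import all_classical all_reals all_analysis.
Set Implicit Arguments.
Unset Strict Implicit.
Unset Printing Implicit Defensive.
Import Order.TTheory GRing.Theory Num.Theory.
Import numFieldNormedType.Exports.
Local Open Scope ring_scope.
Local Open Scope classical_set_scope.

(* A function on S^1 = R/Z is a 1-periodic function R -> R,                   *)
(* integrated over [0, 1].  Elements of L^2 and of the Sobolev spaces are      *)
(* represented by functions and identified when they agree almost everywhere. *)

Section Circle.
Variable R : realType.
Local Notation mu := (@lebesgue_measure R).

Definition L2 : set (R -> R) :=
  [set f : R -> R | [/\ periodic f 1, measurable_fun [set: R] f &
    mu.-integrable `[0, 1] (fun x => (f x ^+ 2)%:E)]].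

Definition L2norm (f : R -> R) : R :=
  Num.sqrt (\int[mu]_(x in `[0, 1]) (f x ^+ 2)).

Definition test_function (phi : R -> R) : Prop :=
  [/\ periodic phi 1, (forall x, derivable phi x 1) & continuous (derive1 phi)].

(* Integration by parts against C^1 test functions on the circle; as S^1 has  *)
(* no boundary, the test functions are not required to vanish anywhere.       *)
(* Smooth test functions give the same weak derivative, by density.           *)
Definition weak_derivative (f g : R -> R) : Prop :=
  forall phi, test_function phi ->
    \int[mu]_(x in `[0, 1]) (f x * derive1 phi x) =
    - \int[mu]_(x in `[0, 1]) (g x * phi x).

(* A representative of the weak derivative f', which is unique up to almost   *)
(* everywhere equality; the value is only meaningful for f in H^1.            *)
Definition wderiv (f : R -> R) : R -> R :=
  xget (cst 0) [set g : R -> R | L2 g /\ weak_derivative f g].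

(* H^k(S^1) = W^{k,2}(S^1) *)
Fixpoint sobolev (k : nat) (f : R -> R) : Prop :=
  match k with
  | 0%N => L2 f
  | k'.+1 => L2 f /\ exists g, sobolev k' g /\ weak_derivative f g
  end.

Definition sobolev_norm (k : nat) (f : R -> R) : R :=
  Num.sqrt (\sum_(j < k.+1) L2norm (iter j wderiv f) ^+ 2).

(* H^k_*(S^1) = H^k(S^1) minus the zero class *)
Definition sobolev_star (k : nat) (f : R -> R) : Prop :=
  sobolev k f /\ ~ (f = cst 0 %[ae mu]).

(* A is the Frechet derivative at z of G : H^k_* -> Y, where Y is the set Y   *)
(* with (semi)norm nY.  Since elements of Y may be representatives modulo     *)
(* the null space of nY, linearity of A is only required modulo that space.   *)
Definition is_frechet_derivative (k : nat) (V : lmodType R) (Y : set V)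
    (nY : V -> R) (G : (R -> R) -> V) (z : R -> R) (A : (R -> R) -> V) : Prop :=
  [/\ sobolev_star k z,
      (forall v, sobolev k v -> Y (A v)),
      (forall (c : R) (v w : R -> R), sobolev k v -> sobolev k w ->
         nY (A (c *: v + w) - (c *: A v + A w)) = 0),
      (exists C : R, forall v, sobolev k v -> nY (A v) <= C * sobolev_norm k v) &
      forall eps : R, 0 < eps -> exists2 delta : R, 0 < delta &
        forall v, sobolev k v -> sobolev_star k (z + v) ->
          sobolev_norm k v <= delta ->
          nY (G (z + v) - G z - A v) <= eps * sobolev_norm k v].

(* K has dimension n as a space of classes modulo a.e. equality *)
Definition has_dimension (K : set (R -> R)) (n : nat) : Prop :=
  exists e : 'I_n -> R -> R,
    [/\ (forall i, K (e i)),
        (forall c : 'I_n -> R, \sum_(i < n) c i *: e i = cst 0 %[ae mu] ->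
           forall i, c i = 0) &
        (forall v, K v ->
           exists c : 'I_n -> R, v = \sum_(i < n) c i *: e i %[ae mu])].

Section Functional.
Variable r : R.

Definition functional (z : R -> R) : R :=
  2 * L2norm z ^+ 2 * L2norm (wderiv z) ^+ 2 + 2 / L2norm z ^+ 2
  + r * (L2norm z ^+ 2 / L2norm (fun x => z x ^+ 2) ^+ 2).

Definition coef_b (z : R -> R) : R :=
  1 / L2norm z ^+ 6 - L2norm (wderiv z) ^+ 2 / L2norm z ^+ 2
  - r / (2 * L2norm z ^+ 2 * L2norm (fun x => z x ^+ 2) ^+ 2).

Definition coef_a (z : R -> R) : R :=
  r / (2 * L2norm (fun x => z x ^+ 2) ^+ 4).

Definition gradient (z : R -> R) : R -> R := fun x =>
  - 4 * L2norm z ^+ 2 *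
    (wderiv (wderiv z) x + coef_b z * z x + 2 * coef_a z * z x ^+ 3).

Definition critical_point (z : R -> R) : Prop :=
  @is_frechet_derivative 1 R^o [set: R^o] (fun y => `|y|)
    functional z (fun=> 0).

Definition is_hessian (z : R -> R) (A : (R -> R) -> R -> R) : Prop :=
  @is_frechet_derivative 2 (R -> R) L2 L2norm gradient z A.

Definition hessian_kernel (A : (R -> R) -> R -> R) : set (R -> R) :=
  [set v : R -> R | sobolev 2 v /\ A v = cst 0 %[ae mu]].

(* The Hessian exists and is unique up to a.e. equality of its values, so the *)
(* existential quantifier picks it out.                                       *)
Definition is_nondegenerate (z : R -> R) : Prop :=
  exists A, is_hessian z A /\ has_dimension (hessian_kernel A) 1.

End Functional.
End Circle.

(* Main.v *)
From HB Require Import structures.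
Require Import Defs.
From mathcomp Require Import all_boot all_order all_algebra.
From mathcomp Require Import all_classical all_reals all_analysis.
From mathcomp Require Import measurable_realfun.
From mathcomp Require Import ring lra.
Set Implicit Arguments.
Unset Strict Implicit.
Unset Printing Implicit Defensive.
Import Order.TTheory GRing.Theory Num.Theory.
Import numFieldNormedType.Exports.
Local Open Scope ring_scope.
Local Open Scope classical_set_scope.

(** A critical point z solves the Duffing equation z'' = - (b z + 2 a z^3) with
a >= 0 and energy z'^2 + b z^2 + a z^4 = 1 / N^2, where N = ||z||^2.  Hence z
has a zero, its zeros are simple and equally spaced, and z is odd about each of
them and changes sign under a translation by the gap t between two of them.

Regularity of weak solutions turns an element of the kernel of the Hessian into
a periodic solution v of the linearized equation, whose right-hand side involves
<z, v> and <z^3, v>.  Subtracting a multiple of z' makes v odd about the zeros of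
z.  The part of v which is invariant under the translation by t solves the
homogeneous equation and vanishes at two consecutive zeros of z, which are not
conjugate.  For the antiperiodic part, observe that in terms of q = z^2 and of
the time theta with theta' = z^2 / N, the functional is
int q_theta^2 / 2 + int 2 / q + r / mean(q), which is strictly convex as long as
q > 0.  Accordingly the induced variation of q obeys a maximum principle between
two zeros of z and must vanish, and then so does v. *)

(** * Calculus on R *)

(** The Hessian is not a differential operator: varying the coefficients [a] and [b] adds terms in
    <z, v> and <z^3, v>, so an element of the kernel solves an inhomogeneous equation, to which
    comparison arguments for Jacobi fields do not apply directly. In the variable q the only
    nonlocal term left is the variation of the mean of q, a single constant [mu], and it enters with
    a favourable sign. The substitution degenerates at the zeros of z, where q = 0. This is why v is
    first made odd and antiperiodic: then v and the variation of theta both vanish at two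
    consecutive zeros of z, and the variation of q tends to 0 there in spite of the division by z.
    The maximum principle is then applied strictly between these zeros. Consecutive zeros are not
    conjugate because a > 0. For r = 0 the equation is linear and z itself is a Jacobi field that
    vanishes at all of them; that case is settled separately, by pairing the equation with z. *)

Section derivatives.
Variable R : realType.
Implicit Types (f g h : R -> R) (x y : R).

Definition has_deriv f g := forall x, is_derive x 1 f (g x).

Lemma deriv_val f x (df df' : R) : is_derive x 1 f df -> df = df' -> is_derive x 1 f df'.
Proof. by move=> h <-. Qed.

Lemma deriv_cst (c : R) x : is_derive x 1 (fun=> c) 0.
Proof. exact: is_derive_cst. Qed.

Lemma deriv_id x : is_derive x 1 (fun y => y) 1.
Proof. exact: is_derive_id. Qed.

Lemma deriv_add f g x (df dg : R) : is_derive x 1 f df -> is_derive x 1 g dg ->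
  is_derive x 1 (fun y => f y + g y) (df + dg).
Proof. by move=> hf hg; exact: is_deriveD. Qed.

Lemma deriv_opp f x (df : R) : is_derive x 1 f df ->
  is_derive x 1 (fun y => - f y) (- df).
Proof. by move=> hf; exact: is_deriveN. Qed.

Lemma deriv_sub f g x (df dg : R) : is_derive x 1 f df -> is_derive x 1 g dg ->
  is_derive x 1 (fun y => f y - g y) (df - dg).
Proof. by move=> hf hg; exact: is_deriveB. Qed.

Lemma deriv_mul f g x (df dg : R) : is_derive x 1 f df -> is_derive x 1 g dg ->
  is_derive x 1 (fun y => f y * g y) (df * g x + f x * dg).
Proof.
move=> hf hg; apply: is_derive_eq; rewrite /GRing.scale/=; ring.
Qed.

Lemma deriv_scale (c : R) f x (df : R) : is_derive x 1 f df ->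
  is_derive x 1 (fun y => c * f y) (c * df).
Proof.
move=> hf; have := deriv_mul (deriv_cst c x) hf; rewrite mul0r add0r; exact.
Qed.

Lemma deriv_pow f n x (df : R) : is_derive x 1 f df ->
  is_derive x 1 (fun y => f y ^+ n.+1) (n.+1%:R * f x ^+ n * df).
Proof.
move=> hf; elim: n => [|n IH].
  by rewrite expr0 !mul1r.
under eq_fun do rewrite exprS.
apply: deriv_val (deriv_mul hf IH) _; rewrite -[n.+2%:R]natr1 exprS; ring.
Qed.

Lemma deriv_inv f x (df : R) : f x != 0 -> is_derive x 1 f df ->
  is_derive x 1 (fun y => (f y)^-1) (- df / f x ^+ 2).
Proof.
move=> fx hf; apply: deriv_val (is_deriveV fx hf) _.
by rewrite /GRing.scale/=; field.
Qed.

Lemma deriv_div f g x (df dg : R) : g x != 0 ->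
  is_derive x 1 f df -> is_derive x 1 g dg ->
  is_derive x 1 (fun y => f y / g y) ((df * g x - f x * dg) / g x ^+ 2).
Proof.
by move=> gx hf hg; apply: deriv_val (deriv_mul hf (deriv_inv gx hg)) _; field.
Qed.

Lemma deriv_comp f g x (df dg : R) : is_derive x 1 g dg -> is_derive (g x) 1 f df ->
  is_derive x 1 (fun y => f (g y)) (df * dg).
Proof.
by move=> hg hf; exact: is_derive1_comp.
Qed.

Lemma deriv_cont f x (df : R) : is_derive x 1 f df -> {for x, continuous f}.
Proof. by case=> h _; apply/differentiable_continuous/derivable1_diffP. Qed.

Lemma deriv_unique f x (df df' : R) : is_derive x 1 f df -> is_derive x 1 f df' -> df = df'.
Proof. by move=> [_ <-] [_ <-]. Qed.

End derivatives.

(** * Mean value arguments and uniqueness for second-order equations *)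

Section mean_values.
Variable R : realType.
Implicit Types (f g h : R -> R) (x y : R).

Lemma cont_within f (A : set R) : (forall x, A x -> {for x, continuous f}) ->
  {within A, continuous f}.
Proof.
move=> h; apply: continuous_in_subspaceT => x xA; apply: h; exact: set_mem.
Qed.

Lemma mean_value f g a b : a < b ->
  (forall x, a <= x <= b -> is_derive x 1 f (g x)) ->
  exists2 c, a < c < b & f b - f a = g c * (b - a).
Proof.
move=> ab h; have [c] := @MVT R f g a b ab (fun x xab => h x (subset_itv_oo_cc xab))
  (@cont_within f `[a, b] (fun x xab => deriv_cont (h x xab))).
by rewrite in_itv/= => ? ?; exists c.
Qed.

Lemma deriv_gt0_lt f g a b : a < b ->
  (forall x, a <= x <= b -> is_derive x 1 f (g x)) ->
  (forall x, a < x < b -> 0 < g x) -> f a < f b.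
Proof.
move=> ab h h0; have [c cab e] := mean_value ab h.
by rewrite -subr_gt0 e mulr_gt0 ?subr_gt0 ?h0.
Qed.

Lemma deriv_ge0_le f g a b : a <= b ->
  (forall x, a <= x <= b -> is_derive x 1 f (g x)) ->
  (forall x, a < x < b -> 0 <= g x) -> f a <= f b.
Proof.
rewrite le_eqVlt => /orP[/eqP->//|ab] h h0; have [c cab e] := mean_value ab h.
by rewrite -subr_ge0 e mulr_ge0 ?subr_ge0 ?h0// ltW.
Qed.

Lemma deriv0_const f : has_deriv f (fun=> 0) -> forall x y, f x = f y.
Proof.
move=> h x y; exact: is_derive_0_is_cst.
Qed.

Lemma has_deriv_cont f g : has_deriv f g -> continuous f.
Proof. by move=> h x; exact: deriv_cont (h x). Qed.

Lemma deriv_interior_max f g a b c : a < c < b ->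
  (forall x, a < x < b -> is_derive x 1 f (g x)) ->
  (forall x, a < x < b -> f x <= f c) -> g c = 0.
Proof.
move=> cab h hmax; apply: (@deriv_unique _ f c); first exact: h.
apply: (@derive1_at_max _ f a b c) => //.
- by move: cab => /andP[ac cb]; rewrite ltW// (lt_trans ac).
- by move=> x; rewrite in_itv/= => /h[].
Qed.

Lemma expR_lin_deriv (c : R) x :
  is_derive x 1 (fun y => expR (c * y)) (c * expR (c * x)).
Proof.
have := deriv_comp (deriv_scale c (deriv_id x)) (is_derive_expR (c * x)).
by move/deriv_val; apply; rewrite mulr1 mulrC.
Qed.

(** Gronwall's argument for g = u^2 + u'^2: since |g'| <= C g with C = 1 + |K|, the function g e^(C
    x) is nondecreasing and g e^(- C x) is nonincreasing. The first handles the points before [x0],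
    the second those after it. *)
Lemma ode2_unique u u1 u2 (K x0 : R) : has_deriv u u1 -> has_deriv u1 u2 ->
  (forall x, `|u2 x| <= K * `|u x|) -> u x0 = 0 -> u1 x0 = 0 ->
  forall x, u x = 0.
Proof.
move=> hu hu1 hK ux0 u1x0.
pose g y := u y ^+ 2 + u1 y ^+ 2.
pose g1 y := 2 * (u y * u1 y) + 2 * (u1 y * u2 y).
pose C := 1 + `|K|.
have hg : has_deriv g g1.
  move=> y; apply: deriv_val (deriv_add (deriv_pow 1 (hu y)) (deriv_pow 1 (hu1 y))) _.
  rewrite /g1; ring.
have g1_le y : `|g1 y| <= C * g y.
  have h2 : `|u2 y| <= `|K| * `|u y|.
    by apply: le_trans (hK y) _; rewrite ler_wpM2r// ler_norm.
  have hn : `|g1 y| <= 2 * (`|u y| * `|u1 y|) + 2 * (`|u1 y| * (`|K| * `|u y|)).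
    apply: le_trans (ler_normD _ _) _; rewrite !normrM ger0_norm//.
    by rewrite lerD2l// ler_wpM2l// ler_wpM2l.
  apply: le_trans hn _; rewrite /g /C -(real_normK (num_real (u y))) -(real_normK (num_real (u1 y))).
  have := normr_ge0 K; move: (`|u y|) (`|u1 y|) (`|K|) => p q k k0.
  have h1 : 0 <= (p - q) ^+ 2 by exact: sqr_ge0.
  have := mulr_ge0 k0 h1; rewrite !sqrrB; rewrite sqrrB in h1; lra.
have g0 y : 0 <= g y by rewrite addr_ge0// sqr_ge0.
have gx0 : g x0 = 0 by rewrite /g ux0 u1x0; ring.
suff gle x : g x <= 0.
  move=> x; have := gle x; rewrite /g => h; apply/eqP; rewrite -sqrf_eq0; apply/eqP.
  by have := sqr_ge0 (u x); have := sqr_ge0 (u1 x); lra.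
have [xx0|xx0] := leP x x0.
  have : g x * expR (C * x) <= g x0 * expR (C * x0).
    apply: (@deriv_ge0_le (fun y => g y * expR (C * y))
      (fun y => (C * g y + g1 y) * expR (C * y)) _ _ xx0).
      move=> y _; apply: deriv_val (deriv_mul (hg y) (expR_lin_deriv C y)) _; ring.
    move=> y _; rewrite mulr_ge0// ?expR_ge0//.
    by have := g1_le y; rewrite ler_norml => /andP[]; lra.
  by rewrite gx0 mul0r pmulr_lle0 ?expR_gt0.
have : - g x0 * expR (- C * x0) <= - g x * expR (- C * x).
  apply: (@deriv_ge0_le (fun y => - g y * expR (- C * y))
    (fun y => (C * g y - g1 y) * expR (- C * y)) _ _ (ltW xx0)).
    move=> y _; apply: deriv_val (deriv_mul (deriv_opp (hg y)) (expR_lin_deriv (- C) y)) _; ring.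
  move=> y _; rewrite mulr_ge0// ?expR_ge0//.
  by have := g1_le y; rewrite ler_norml => /andP[]; lra.
by rewrite gx0 oppr0 mul0r pmulr_lge0 ?expR_gt0// oppr_ge0.
Qed.

End mean_values.

(** * Local behaviour of continuous functions, and periodicity *)

Section periodic_functions.
Variable R : realType.
Implicit Types (f g h : R -> R) (x y : R).

Lemma cont_eps f x : {for x, continuous f} -> forall e, 0 < e ->
  exists2 d, 0 < d & forall y, `|y - x| < d -> `|f y - f x| < e.
Proof.
move=> /cvgrPdist_lt h e e0; have := h e e0.
case/nbhs_ballP => d /= d0 hd; exists d => // y yx.
by rewrite distrC; apply: hd; rewrite /ball/= distrC.
Qed.

Lemma cont_pos f x : {for x, continuous f} -> 0 < f x ->
  exists2 d, 0 < d & forall y, `|y - x| < d -> 0 < f y.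
Proof.
move=> hf fx; have [d d0 hd] := cont_eps hf fx; exists d => // y /hd.
by rewrite ltr_norml => /andP[+ _]; lra.
Qed.

Lemma cont_eq_right f g x t : 0 < t -> {for x, continuous f} -> {for x, continuous g} ->
  (forall y, x < y < x + t -> f y = g y) -> f x = g x.
Proof.
move=> t0 cf cg h; apply/eqP/negPn/negP => fgx.
have cfg : {for x, continuous (fun y => `|f y - g y|)}.
  by apply: cvg_norm; exact: cvgB.
have : 0 < `|f x - g x| by rewrite normr_gt0 subr_eq0.
case/(cont_pos cfg) => d d0 hd.
pose s := Num.min d t / 2.
have s0 : 0 < s by rewrite divr_gt0// lt_min d0 t0.
have sm : s < Num.min d t by rewrite ltr_pdivrMr// mulr_natr mulr2n ltrDr lt_min d0 t0.
move: (sm); rewrite lt_min => /andP[sd st].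
have := hd (x + s); rewrite addrAC subrr add0r gtr0_norm// => /(_ sd).
by rewrite h ?ltrDl ?s0 ?ltrD2l ?st// subrr normr0 ltxx.
Qed.

Lemma cont_eq_left f g x t : 0 < t -> {for x, continuous f} -> {for x, continuous g} ->
  (forall y, x - t < y < x -> f y = g y) -> f x = g x.
Proof.
move=> t0 cf cg h.
have cN : {for - x, continuous (fun y : R => - y)} by exact: opp_continuous.
have cf' : {for - x, continuous (fun y => f (- y))}.
  by apply: (@continuous_comp _ _ _ (fun y : R => - y)) => //; rewrite /= opprK.
have cg' : {for - x, continuous (fun y => g (- y))}.
  by apply: (@continuous_comp _ _ _ (fun y : R => - y)) => //; rewrite /= opprK.
have := cont_eq_right t0 cf' cg'; rewrite opprK; apply => y /andP[h1 h2].
by apply: h; apply/andP; split; lra.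
Qed.

(** Covers periodic and antiperiodic functions at once. Only |c| = 1 is recorded, which is enough to
    carry zeros of f from one interval of length T to all of them. *)
Lemma shiftz f (T : R) (s : R) : (forall x, f (x + T) = s * f x) -> s * s = 1 ->
  forall (n : int) x, exists2 c : R, `|c| = 1 & f (x + n%:~R * T) = c * f x.
Proof.
move=> h ss; have s1 : `|s| = 1.
  apply/eqP; rewrite -(@eqrXn2 _ 2)// ?normr_ge0// expr1n real_normK ?num_real//.
  by rewrite expr2 ss.
have hn (n : nat) x : exists2 c : R, `|c| = 1 & f (x + n%:R * T) = c * f x.
  elim: n x => [|n IH] x; first by exists 1; rewrite ?normr1// mul0r addr0 mul1r.
  have [c c1 e] := IH x; exists (s * c); first by rewrite normrM s1 c1 mulr1.
  by rewrite -mulrA -e -h; congr f; rewrite -natr1; ring.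
case=> n x; first by have := hn n x.
have [c c1 e] := hn n.+1 (x - n.+1%:R * T); exists (c^-1).
  by rewrite normfV c1 invr1.
have c0 : c != 0 by rewrite -normr_gt0 c1.
rewrite NegzE; move: e; rewrite subrK => ->; rewrite mulKf//.
by congr f; rewrite rmorphN/= mulNr.
Qed.

Lemma shift_periodic f (T : R) : periodic f T ->
  forall (n : int) x, f (x + n%:~R * T) = f x.
Proof.
move=> h; have hn (n : nat) x : f (x + n%:R * T) = f x.
  elim: n x => [|n IH] x; first by rewrite mul0r addr0.
  by rewrite -[RHS]IH -[RHS]h; congr f; rewrite -natr1; ring.
case=> n x; first exact: hn.
by rewrite NegzE -[LHS](hn n.+1); congr f; rewrite rmorphN/= mulNr; exact: subrK.
Qed.

Lemma shift_reduce (T x0 x : R) : 0 < T ->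
  exists n : int, x0 <= x + n%:~R * T < x0 + T.
Proof.
move=> T0; exists (- Num.floor ((x - x0) / T)).
have /andP[h1 h2] := Num.Theory.floor_itv ((x - x0) / T).
move: h1 h2; rewrite ler_pdivlMr// ltr_pdivrMr// rmorphN intrD1 /= => h1 h2.
by apply/andP; split; lra.
Qed.

Lemma periodic_cont_bounded f (T : R) : 0 < T -> periodic f T -> continuous f ->
  exists2 M, 0 <= M & forall x, `|f x| <= M.
Proof.
move=> T0 pf cf.
have [|c _ hc] := @EVT_max R (fun x => `|f x|) 0 T (ltW T0).
  apply: cont_within => x _; apply: (continuous_comp (cf x)).
  exact: norm_continuous.
exists `|f c| => // x.
have [n /andP[h1 h2]] := shift_reduce 0 x T0.
rewrite -(shift_periodic pf n); apply: hc.
by rewrite in_itv/= h1 ltW//; move: h2; rewrite add0r.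
Qed.

(** The Archimedean property. It excludes a linear drift of a bounded function under repeated
    translation, so that the gap t between zeros never has to be compared with the period 1. *)
Lemma bounded_muln (d M : R) : (forall n : nat, `|n%:R * d| <= M) -> d = 0.
Proof.
move=> h; apply/eqP/negPn/negP => d0.
have d1 : 0 < `|d| by rewrite normr_gt0.
have M0 : 0 <= M by apply: le_trans (h 0%N); exact: normr_ge0.
have [n /=] : exists n : nat, M / `|d| < n%:R.
  exists (Num.truncn (M / `|d|)).+1.
  by have /andP[] := Num.Theory.truncn_itv (divr_ge0 M0 (ltW d1)).
rewrite ltr_pdivrMr// ltNge => /negP; apply.
by have := h n; rewrite normrM ger0_norm.
Qed.

Lemma periodic_deriv f g (T : R) : has_deriv f g -> periodic f T -> periodic g T.
Proof.
move=> h pf x; have := deriv_comp (deriv_add (deriv_id x) (deriv_cst T x)) (h (x + T)).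
rewrite addr0 mulr1 => h1.
have e : (fun y => f (y + T)) = f by apply/funext => y; exact: pf.
by rewrite e in h1; exact: deriv_unique h1 (h x).
Qed.

(** A one-sided rule of l'Hopital: by the mean value theorem, applied separately above and below,
    the quotient is f'(c) / g'(d), where |f'(c)| < e |g'(x0)| / 2 and |g'(d)| > |g'(x0)| / 2. *)
Lemma quot_small f f1 g g1 x0 : has_deriv f f1 -> has_deriv g g1 ->
  continuous f1 -> continuous g1 -> f x0 = 0 -> g x0 = 0 ->
  f1 x0 = 0 -> g1 x0 != 0 -> forall e, 0 < e ->
  exists2 d, 0 < d & forall s, 0 < s < d -> `|f (x0 + s) / g (x0 + s)| <= e.
Proof.
move=> hf hg cf cg f0 g0 f10 g10 e e0.
have G0 : 0 < `|g1 x0| by rewrite normr_gt0.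
have [|d1 d10 h1] := @cont_eps f1 x0 (cf x0) (e * `|g1 x0| / 2).
  by rewrite divr_gt0// mulr_gt0.
have [|d2 d20 h2] := @cont_eps g1 x0 (cg x0) (`|g1 x0| / 2).
  by rewrite divr_gt0.
exists (Num.min d1 d2); first by rewrite lt_min d10 d20.
move=> s /andP[s0]; rewrite lt_min => /andP[sd1 sd2].
have xs : x0 < x0 + s by rewrite ltrDl.
have [c /andP[c1 c2]] := mean_value xs (fun x _ => hf x).
have [d /andP[d1' d2']] := mean_value xs (fun x _ => hg x).
rewrite f0 g0 !subr0 addrAC subrr add0r => -> ->.
have hc : `|f1 c| < e * `|g1 x0| / 2.
  have := h1 c; rewrite f10 subr0; apply.
  by rewrite gtr0_norm ?subr_gt0//; lra.
have hd : `|g1 d - g1 x0| < `|g1 x0| / 2.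
  by apply: h2; rewrite gtr0_norm ?subr_gt0//; lra.
have hd' : `|g1 x0| / 2 < `|g1 d|.
  have := ler_distD (g1 d) (g1 x0) 0; rewrite !subr0 => h.
  by move: hd; rewrite distrC; lra.
rewrite normrM normfV !normrM (gtr0_norm s0) ler_pdivrMr; last first.
  by rewrite mulr_gt0//; apply: lt_trans hd'; rewrite divr_gt0.
rewrite mulrA ler_wpM2r ?(ltW s0)//.
apply: (le_trans (ltW hc)); rewrite -mulrA ler_wpM2l ?(ltW e0)//; exact: ltW.
Qed.

Lemma deriv_pos_near f f1 x0 : has_deriv f f1 -> continuous f1 -> f x0 = 0 ->
  0 < f1 x0 -> exists2 d, 0 < d & forall s, 0 < s < d ->
   0 < f (x0 + s) /\ f (x0 - s) < 0.
Proof.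
move=> hf cf f0 f10; have [d d0 hd] := cont_pos (cf x0) f10.
exists d => // s /andP[s0 sd]; split.
  rewrite -f0; apply: (@deriv_gt0_lt _ f f1); first by rewrite ltrDl.
    by move=> *; exact: hf.
  by move=> y /andP[y1 y2]; apply: hd; rewrite gtr0_norm ?subr_gt0//; lra.
rewrite -[ltRHS]f0; apply: (@deriv_gt0_lt _ f f1); first by rewrite gtrBl.
  by move=> *; exact: hf.
by move=> y /andP[y1 y2]; apply: hd; rewrite ltr0_norm ?subr_lt0//; lra.
Qed.

End periodic_functions.

(** The cubic is Lipschitz only on bounded sets, whence the bound M: in the difference of the two
    equations the factor p^2 + p q + q^2 is at most 3 M^2, and [ode2_unique] applies with the
    constant |b| + 6 a M^2. *)
Lemma duffing_unique (R : realType) (a b M x0 : R) (p p1 q q1 : R -> R) : 0 <= a ->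
  has_deriv p p1 -> has_deriv p1 (fun x => - (b * p x + 2 * a * p x ^+ 3)) ->
  has_deriv q q1 -> has_deriv q1 (fun x => - (b * q x + 2 * a * q x ^+ 3)) ->
  (forall x, `|p x| <= M) -> (forall x, `|q x| <= M) ->
  p x0 = q x0 -> p1 x0 = q1 x0 -> forall x, p x = q x.
Proof.
move=> a0 hp hp1 hq hq1 pM qM e e1 x; apply/eqP; rewrite -subr_eq0; apply/eqP.
apply: (@ode2_unique R (fun x => p x - q x) (fun x => p1 x - q1 x)
  (fun x => - (b * p x + 2 * a * p x ^+ 3) - - (b * q x + 2 * a * q x ^+ 3))
  (`|b| + 6 * a * M ^+ 2) x0).
- by move=> y; exact: deriv_sub.
- by move=> y; exact: deriv_sub.
- move=> y; have := qM y; have := pM y; move: (p y) (q y) => s t sM tM.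
  have -> : - (b * s + 2 * a * s ^+ 3) - - (b * t + 2 * a * t ^+ 3) =
    - (b + 2 * a * (s ^+ 2 + s * t + t ^+ 2)) * (s - t) by ring.
  rewrite normrM normrN ler_wpM2r//.
  apply: le_trans (ler_normD _ _) _; rewrite lerD2l normrM ger0_norm ?mulr_ge0//.
  have -> : 6 * a * M ^+ 2 = 2 * a * (3 * M ^+ 2) by ring.
  rewrite ler_wpM2l ?mulr_ge0//.
  apply: le_trans (ler_normD _ _) _; rewrite normrX.
  apply: le_trans (lerD (ler_normD _ _) (lexx _)) _; rewrite normrX normrM.
  have M0 : 0 <= M by apply: le_trans sM.
  have h1 : `|s| ^+ 2 <= M ^+ 2 by rewrite lerXn2r// nnegrE.
  have h2 : `|t| ^+ 2 <= M ^+ 2 by rewrite lerXn2r// nnegrE.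
  have h3 : `|s| * `|t| <= M ^+ 2 by rewrite expr2 ler_pM.
  lra.
- by rewrite e subrr.
- by rewrite e1 subrr.
Qed.

(** A common form for translations, s = 1, and reflections, s = -1; hence the factors [1 *] and
    [-1 *] in the arguments of functions further on. *)
Lemma deriv_affine (R : realType) (s c x : R) : is_derive x 1 (fun y => c + s * y) s.
Proof. by apply: deriv_val (deriv_add (deriv_cst c x) (deriv_scale s (deriv_id x))) _; rewrite mulr1 add0r. Qed.

(** * The Duffing equation and its linearization *)

Section duffing.
Variables (R : realType) (a b E : R) (z z1 : R -> R).
Hypothesis (a0 : 0 <= a) (E0 : 0 < E).
Hypothesis hz : has_deriv z z1.
Hypothesis hz1 : has_deriv z1 (fun x => - (b * z x + 2 * a * z x ^+ 3)).
Hypothesis hE : forall x, z1 x ^+ 2 + b * z x ^+ 2 + a * z x ^+ 4 = E.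
Hypothesis pz : periodic z 1.

Let cz : continuous z := has_deriv_cont hz.
Let pz1 : periodic z1 1 := periodic_deriv hz pz.

Lemma duffing_zero_deriv x : z x = 0 -> z1 x ^+ 2 = E.
Proof. by move=> zx; have := hE x; rewrite zx !expr0n/= !mulr0 !addr0. Qed.

Lemma duffing_zero_deriv_neq0 x : z x = 0 -> z1 x != 0.
Proof.
by move/duffing_zero_deriv => h; rewrite -sqrf_eq0 h gt_eqF.
Qed.

(* Where z has no zero, (z'/z)' = - (E + a z^4) / z^2 < 0. *)
Lemma duffing_zero_exists : exists x, z x = 0.
Proof.
apply: contrapT => nz.
have z0 x : z x != 0 by apply/eqP => zx; apply: nz; exists x.
pose f x := - (z1 x / z x).
have hf (x : R) : is_derive x 1 f ((E + a * z x ^+ 4) / z x ^+ 2).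
  apply: deriv_val (deriv_opp (deriv_div (z0 x) (hz1 x) (hz x))) _.
  by rewrite -(hE x); field; exact: z0.
have : f 0 < f 1.
  apply: deriv_gt0_lt ltr01 (fun x _ => hf x) _ => x _.
  rewrite divr_gt0 ?exprn_even_gt0 ?z0//.
  by rewrite ltr_wpDr// mulr_ge0// exprn_even_ge0.
by rewrite /f -[1 in ltRHS]add0r pz pz1 ltxx.
Qed.

(** Both sides, as functions of s, solve the same Duffing equation, which is invariant under time
    reversal and under a change of sign, and they have the same value and derivative at s = 0. *)
Lemma duffing_odd y s : z y = 0 -> z (y - s) = - z (y + s).
Proof.
move=> zy; have [M M0 hM] := periodic_cont_bounded ltr01 pz cz.
have := @duffing_unique R a b M 0 (fun s => z (y + -1 * s)) (fun s => - z1 (y + -1 * s))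
  (fun s => - z (y + 1 * s)) (fun s => - z1 (y + 1 * s)) a0.
move=> H; suff : z (y + -1 * s) = - z (y + 1 * s) by rewrite mulN1r mul1r.
move: s; apply: H.
- by move=> x; apply: deriv_val (deriv_comp (deriv_affine _ y x) (hz _)) _; rewrite mulrN1.
- by move=> x; apply: deriv_val (deriv_opp (deriv_comp (deriv_affine _ y x) (hz1 _))) _; ring.
- by move=> x; apply: deriv_val (deriv_opp (deriv_comp (deriv_affine _ y x) (hz _))) _; rewrite mulr1.
- by move=> x; apply: deriv_val (deriv_opp (deriv_comp (deriv_affine _ y x) (hz1 _))) _; ring.
- by move=> x; exact: hM.
- by move=> x; rewrite normrN; exact: hM.
- by rewrite !mulr0 addr0 zy oppr0.
- by rewrite !mulr0.
Qed.

(** Take t as the infimum of the s > 0 with z (x0 + s) = 0. The period 1 is such an s, and t > 0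
    because the zero at [x0] is simple. The factor z'(x0) normalizes the sign, so that the product f
    is increasing at [x0]. *)
Lemma duffing_next_zero x0 : z x0 = 0 ->
  exists2 t, 0 < t & z (x0 + t) = 0 /\ forall s, 0 < s < t -> 0 < z1 x0 * z (x0 + s).
Proof.
move=> zx0; pose f x := z1 x0 * z x.
have hf : has_deriv f (fun x => z1 x0 * z1 x) by move=> x; exact: deriv_scale.
have cf := has_deriv_cont hf.
have cf1 : continuous (fun x => z1 x0 * z1 x).
  by apply: has_deriv_cont => x; exact: deriv_scale.
have f0 : f x0 = 0 by rewrite /f zx0 mulr0.
have f1 : 0 < z1 x0 * z1 x0 by rewrite -expr2 duffing_zero_deriv.
have [d d0 hd] := deriv_pos_near hf cf1 f0 f1.
have f_eq0 x : f x = 0 -> z x = 0.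
  by move/eqP; rewrite mulf_eq0 (negbTE (duffing_zero_deriv_neq0 zx0)) => /eqP.
pose S := [set s : R | 0 < s /\ f (x0 + s) = 0].
have S1 : S 1 by split => //; rewrite /f pz zx0 mulr0.
have Sd s : S s -> d <= s.
  move=> [s0 fs]; rewrite leNgt; apply/negP => sd.
  by have [] := hd s; rewrite ?s0 ?sd// fs ltxx.
have Sinf : has_inf S by split; [exists 1|exists d => s; exact: Sd].
pose t := inf S.
have dt : d <= t by apply: lb_le_inf; [exists 1|move=> s; exact: Sd].
have t0 : 0 < t by exact: lt_le_trans dt.
have ft : f (x0 + t) = 0.
  apply/eqP/negPn/negP => ft.
  have cfn : {for x0 + t, continuous (fun y => `|f y|)}.
    by apply: (continuous_comp (cf _)); exact: norm_continuous.
  have [|d' d'0 h'] := cont_pos cfn; first by rewrite normr_gt0.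
  have [s Ss st] := inf_adherent d'0 Sinf.
  have ts : t <= s by apply: ge_inf => //; case: Sinf.
  have := h' (x0 + s); case: Ss => s0 ->; rewrite normr0 ltxx.
  have -> : x0 + s - (x0 + t) = s - t by ring.
  rewrite ger0_norm ?subr_ge0//.
  have st' : s - t < d' by rewrite ltrBlDl.
  by move/(_ st').
exists t => //; split; first exact: f_eq0.
move=> s /andP[s0 st]; rewrite -/(f _) ltNge; apply/negP => fs.
(* f is positive at x0 + s', which is close to [x0]; were it nonpositive at x0 + s, the intermediate
   value theorem would give a zero before x0 + t. *)
pose s' := Num.min s (d / 2).
have d20 : 0 < d / 2 by rewrite divr_gt0.
have s'0 : 0 < s' by rewrite lt_min s0 d20.
have s's : s' <= s by rewrite ge_min lexx.
have s'd : s' < d.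
  by rewrite gt_min; apply/orP; right; rewrite ltr_pdivrMr// mulr_natr mulr2n ltrDl.
have [|fs' _] := hd s'; first by rewrite s'0.
have [|||c cin fc] := @IVT R f (x0 + s') (x0 + s) 0.
- by rewrite lerD2l.
- by apply: cont_within => x _; exact: cf.
- by rewrite ge_min fs orbT/= le_max (ltW fs').
move: cin; rewrite /= in_itv/= => /andP[c1 c2].
have : t <= c - x0.
  apply: ge_inf; first by case: Sinf.
  by split; [lra|rewrite addrC subrK].
lra.
Qed.

(** The energy gives z'(x0 + t)^2 = z'(x0)^2. Equal signs are impossible, since z would then have
    the wrong sign just before x0 + t; so z (. + t) and - z have the same data at [x0] and agree by
    uniqueness. *)
Lemma duffing_antiperiodic x0 t : z x0 = 0 -> 0 < t -> z (x0 + t) = 0 ->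
  (forall s, 0 < s < t -> 0 < z1 x0 * z (x0 + s)) ->
  forall x, z (x + t) = - z x.
Proof.
move=> zx0 t0 zt hs.
have z1t : z1 (x0 + t) = - z1 x0.
  have : z1 (x0 + t) ^+ 2 = z1 x0 ^+ 2 by rewrite !duffing_zero_deriv.
  move/eqP; rewrite eqf_sqr => /orP[/eqP e|/eqP//].
  have hf : has_deriv (fun x => z1 x0 * z x) (fun x => z1 x0 * z1 x) by move=> x; exact: deriv_scale.
  have cf1 : continuous (fun x => z1 x0 * z1 x).
    by apply: has_deriv_cont => x; exact: deriv_scale.
  have [||d d0 hd] := @deriv_pos_near _ _ _ (x0 + t) hf cf1.
  - by rewrite zt mulr0.
  - by rewrite e -expr2 duffing_zero_deriv.
  pose s := Num.min t d / 2.
  have s0 : 0 < s by rewrite divr_gt0// lt_min d0 t0.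
  have : s < Num.min t d by rewrite ltr_pdivrMr// mulr_natr mulr2n ltrDr lt_min d0 t0.
  rewrite lt_min => /andP[st sd].
  have [|_] := hd s; first by rewrite s0 sd.
  have := hs (t - s); rewrite addrA subr_gt0 st/= gtrBl s0 => /(_ isT); lra.
have [M M0 hM] := periodic_cont_bounded ltr01 pz cz.
move=> x.
have step y : z (x0 + t + 1 * y) = - z (x0 + 1 * y).
  move: y; apply: (@duffing_unique R a b M 0 _ (fun y => z1 (x0 + t + 1 * y))
    (fun y => - z (x0 + 1 * y)) (fun y => - z1 (x0 + 1 * y)) a0).
  - by move=> y; apply: deriv_val (deriv_comp (deriv_affine _ _ y) (hz _)) _; rewrite mulr1.
  - by move=> y; apply: deriv_val (deriv_comp (deriv_affine _ _ y) (hz1 _)) _; rewrite mulr1.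
  - by move=> y; apply: deriv_val (deriv_opp (deriv_comp (deriv_affine _ _ y) (hz _))) _; rewrite mulr1.
  - by move=> y; apply: deriv_val (deriv_opp (deriv_comp (deriv_affine _ _ y) (hz1 _))) _; ring.
  - by move=> y; exact: hM.
  - by move=> y; rewrite normrN; exact: hM.
  - by rewrite !mulr0 !addr0 zt zx0 oppr0.
  - by rewrite !mulr0 !addr0.
have := step (x - x0); rewrite mul1r; have -> : x0 + t + (x - x0) = x + t by ring.
by rewrite [x0 + (x - x0)]addrC subrK.
Qed.

End duffing.

(** * Jacobi fields and the reflections at the zeros of z *)

Section linearization.
Variables (R : realType) (a b E : R) (z z1 : R -> R).
Hypothesis (a0 : 0 <= a) (E0 : 0 < E).
Hypothesis hz : has_deriv z z1.
Hypothesis hz1 : has_deriv z1 (fun x => - (b * z x + 2 * a * z x ^+ 3)).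
Hypothesis hE : forall x, z1 x ^+ 2 + b * z x ^+ 2 + a * z x ^+ 4 = E.
Hypothesis pz : periodic z 1.

Let cz : continuous z := has_deriv_cont hz.

Lemma jacobi_unique u u1 y : has_deriv u u1 ->
  has_deriv u1 (fun x => - ((b + 6 * a * z x ^+ 2) * u x)) ->
  u y = 0 -> u1 y = 0 -> forall x, u x = 0.
Proof.
move=> hu hu1 uy u1y; have [M M0 hM] := periodic_cont_bounded ltr01 pz cz.
apply: (ode2_unique hu hu1 (K := `|b| + 6 * a * M ^+ 2) _ uy u1y) => x.
rewrite normrN normrM ler_wpM2r//; apply: le_trans (ler_normD _ _) _.
rewrite lerD2l normrM ger0_norm ?mulr_ge0// ler_wpM2l ?mulr_ge0//.
by rewrite normrX lerXn2r ?nnegrE.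
Qed.

Lemma jacobi_z1 : has_deriv (fun x => - (b * z x + 2 * a * z x ^+ 3))
  (fun x => - ((b + 6 * a * z x ^+ 2) * z1 x)).
Proof.
move=> x; apply: deriv_val (deriv_opp (deriv_add (deriv_scale b (hz x)) (deriv_scale (2 * a) (deriv_pow 2 (hz x))))) _.
ring.
Qed.

(** z' is a Jacobi field whose derivative z'' vanishes at a zero y of z, whereas z'(y) does not
    vanish. Hence it spans the Jacobi fields with zero derivative at y. *)
Lemma jacobi_even u u1 y : z y = 0 -> has_deriv u u1 ->
  has_deriv u1 (fun x => - ((b + 6 * a * z x ^+ 2) * u x)) -> u1 y = 0 ->
  forall x, u x = u y / z1 y * z1 x.
Proof.
move=> zy hu hu1 u1y x; apply/eqP; rewrite -subr_eq0; apply/eqP; move: x.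
have z1y := duffing_zero_deriv_neq0 E0 hE zy.
apply: (@jacobi_unique (fun x => u x - u y / z1 y * z1 x)
  (fun x => u1 x - u y / z1 y * - (b * z x + 2 * a * z x ^+ 3)) y).
- by move=> x; exact: deriv_sub (hu x) (deriv_scale _ (hz1 x)).
- move=> x; apply: deriv_val (deriv_sub (hu1 x) (deriv_scale _ (jacobi_z1 x))) _; ring.
- by rewrite divfK// subrr.
- by rewrite u1y zy expr0n/= !mulr0 addr0 oppr0 mulr0 subrr.
Qed.

Variables (P q : R) (v v1 : R -> R).
Hypothesis hv : has_deriv v v1.
Hypothesis hv1 : has_deriv v1
  (fun x => - ((b + 6 * a * z x ^+ 2) * v x) + P * z x + q * z x ^+ 3).
Hypothesis pv : periodic v 1.

(** The potential b + 6 a z^2 is even about y, while the inhomogeneity P z + q z^3 is odd and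
    cancels in the sum. The sum is therefore a Jacobi field even about y, and [jacobi_even]
    identifies it. *)
Lemma jacobi_reflect y : z y = 0 ->
  forall x, v x + v (2 * y - x) = 2 * v y / z1 y * z1 x.
Proof.
move=> zy x.
have zr x' : z (2 * y + -1 * x') = - z x'.
  have := duffing_odd a0 hz hz1 pz (x' - y) zy.
  have -> : y - (x' - y) = 2 * y + -1 * x' by ring.
  by have -> : y + (x' - y) = x' by ring.
have := @jacobi_even (fun x => v x + v (2 * y + -1 * x))
  (fun x => v1 x - v1 (2 * y + -1 * x)) y zy.
have -> : 2 * y + -1 * y = y by ring.
rewrite subrr => H; have -> : 2 * y - x = 2 * y + -1 * x by ring.
rewrite H//; first by congr (_ / _ * _); ring.
  move=> s; apply: deriv_val (deriv_add (hv s) (deriv_comp (deriv_affine (-1) (2 * y) s) (hv _))) _.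
  by rewrite mulrN1.
move=> s; apply: deriv_val (deriv_sub (hv1 s) (deriv_comp (deriv_affine (-1) (2 * y) s) (hv1 _))) _.
rewrite zr; ring.
Qed.

End linearization.

(** * Translation by the gap t, and absence of conjugate points *)

Section conjugate_points.
Variables (R : realType) (a b E : R) (z z1 : R -> R).
Hypothesis (a0 : 0 <= a) (E0 : 0 < E).
Hypothesis hz : has_deriv z z1.
Hypothesis hz1 : has_deriv z1 (fun x => - (b * z x + 2 * a * z x ^+ 3)).
Hypothesis hE : forall x, z1 x ^+ 2 + b * z x ^+ 2 + a * z x ^+ 4 = E.
Hypothesis pz : periodic z 1.
Variables (x0 t : R).
Hypothesis (zx0 : z x0 = 0) (t0 : 0 < t).
Hypothesis hs : forall s, 0 < s < t -> 0 < z1 x0 * z (x0 + s).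
Hypothesis anti : forall x, z (x + t) = - z x.


Lemma anti_deriv (f f1 : R -> R) : has_deriv f f1 ->
  (forall x, f (x + t) = - f x) -> forall x, f1 (x + t) = - f1 x.
Proof.
move=> hf hN x; have h1 := deriv_comp (deriv_add (deriv_id x) (deriv_cst t x)) (hf (x + t)).
have h2 := deriv_opp (hf x); rewrite (_ : (fun y => - f y) = fun y => f (y + t)) in h2.
  by rewrite (deriv_unique h2 h1) addr0 mulr1.
by apply/funext => y; rewrite hN.
Qed.

Let anti1 x : z1 (x + t) = - z1 x. Proof. exact: anti_deriv. Qed.
Let zt : z (x0 + t) = 0. Proof. by rewrite anti zx0 oppr0. Qed.

(** The reflections at x0 and at x0 + t compose to the translation by 2 t, so v (x + 2 t) = v x + c
    z'(x) with c proportional to v (x0 + t). Iterating at [x0] gives the values n c z'(x0), which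
    are bounded only if c = 0. *)
Lemma jacobi_reduce P q v v1 : has_deriv v v1 ->
  has_deriv v1 (fun x => - ((b + 6 * a * z x ^+ 2) * v x) + P * z x + q * z x ^+ 3) ->
  periodic v 1 -> v x0 = 0 ->
  v (x0 + t) = 0 /\ forall x, v (x + t + t) = v x.
Proof.
move=> hv hv1 pv vx0.
have r1 := jacobi_reflect a0 E0 hz hz1 hE pz hv hv1 zx0.
have r2 := jacobi_reflect a0 E0 hz hz1 hE pz hv hv1 zt.
rewrite vx0 mulr0 mul0r in r1.
set c := 2 * v (x0 + t) / z1 (x0 + t) in r2.
have st x : v (x + t + t) = v x + c * z1 x.
  have := r2 (x + t + t); rewrite !anti1 opprK => <-.
  have := r1 x; rewrite mul0r.
  have -> : 2 * (x0 + t) - (x + t + t) = 2 * x0 - x by ring.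
  lra.
have z1x0 := duffing_zero_deriv_neq0 E0 hE zx0.
have c0 : c = 0.
  have [M M0 hM] := periodic_cont_bounded ltr01 pv (has_deriv_cont hv).
  have stn n : v (x0 + n%:R * (t + t)) = n%:R * (c * z1 x0) /\
      z1 (x0 + n%:R * (t + t)) = z1 x0.
    elim: n => [|n [IH1 IH2]]; first by rewrite !mul0r addr0 vx0.
    have -> : x0 + n.+1%:R * (t + t) = x0 + n%:R * (t + t) + t + t.
      by rewrite -natr1; ring.
    by rewrite st IH1 !anti1 opprK IH2 -natr1; split=> //; ring.
  have : c * z1 x0 = 0.
    apply: (@bounded_muln _ _ M) => n.
    by have [<- _] := stn n; exact: hM.
  by move/eqP; rewrite mulf_eq0 (negbTE z1x0) orbF => /eqP.
split; last by move=> x; rewrite st c0 mul0r addr0.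
move: c0; rewrite /c => /eqP; rewrite mulf_eq0 invr_eq0 anti1 oppr_eq0 (negbTE z1x0) orbF.
by rewrite mulf_eq0 pnatr_eq0/= => /eqP.
Qed.

Lemma anti_zero (f : R -> R) : (forall x, f (x + t) = - f x) ->
  (forall x, x0 <= x < x0 + t -> f x = 0) -> forall x, f x = 0.
Proof.
move=> hN h x; have [n hn] := shift_reduce x0 x t0.
have [|| k k1 e] := @shiftz _ f t (-1) _ _ n x.
- by move=> y; rewrite mulN1r.
- by rewrite mulrNN mulr1.
move: e; rewrite h// => /esym/eqP; rewrite mulf_eq0 => /orP[|/eqP//].
by rewrite -normr_eq0 k1 oner_eq0.
Qed.

(* If u vanishes at two consecutive zeros of z then, by the constancy of the  *)
(* Wronskian of z' and u, it has the sign of z in between, so that the         *)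
(* Wronskian of z and u, whose derivative is -4 a z^3 u, is monotone; but it   *)
(* vanishes at both ends.                                                      *)
Lemma jacobi_no_conjugate u u1 : 0 < a -> has_deriv u u1 ->
  has_deriv u1 (fun x => - ((b + 6 * a * z x ^+ 2) * u x)) ->
  u x0 = 0 -> u (x0 + t) = 0 -> forall x, u x = 0.
Proof.
move=> a_gt0 hu hu1 ux0 ut.
have [u1x0|u1x0] := eqVneq (u1 x0) 0.
  exact: (jacobi_unique a0 hz pz hu hu1 ux0 u1x0).
exfalso.
have z1x0 := duffing_zero_deriv_neq0 E0 hE zx0.
pose C := z1 x0 * u1 x0.
have C0 : C != 0 by rewrite mulf_neq0.
have wronsk x : z1 x * u1 x - (- (b * z x + 2 * a * z x ^+ 3)) * u x = C.
  have -> : C = z1 x0 * u1 x0 - (- (b * z x0 + 2 * a * z x0 ^+ 3)) * u x0.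
    by rewrite ux0 /C; ring.
  apply: (@deriv0_const R (fun x => z1 x * u1 x - (- (b * z x + 2 * a * z x ^+ 3)) * u x)) => {}x.
  apply: deriv_val (deriv_sub (deriv_mul (hz1 x) (hu1 x)) (deriv_mul (@jacobi_z1 R a b z z1 hz x) (hu x))) _; ring.
have zn0 x : x0 < x < x0 + t -> z x != 0.
  move=> /andP[h1 h2]; have := hs (s := x - x0).
  rewrite [x0 + (x - x0)]addrC subrK subr_gt0 h1 ltrBlDl h2 => /(_ isT).
  by apply: contraTneq => ->; rewrite mulr0 ltxx.
have zdecr x y : x0 < x -> x < y -> y < x0 + t -> z1 y / z y < z1 x / z x.
  move=> xx xy yt; rewrite -ltrN2.
  apply: (@deriv_gt0_lt _ (fun x => - (z1 x / z x)) (fun x => (E + a * z x ^+ 4) / z x ^+ 2)) => //.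
    move=> s /andP[s1 s2]; have zs : z s != 0.
      by apply: zn0; rewrite (lt_le_trans xx s1) (le_lt_trans s2 yt).
    apply: deriv_val (deriv_opp (deriv_div zs (hz1 s) (hz s))) _.
    by rewrite -(hE s); field.
  move=> s /andP[s1 s2]; rewrite divr_gt0 ?exprn_even_gt0 ?zn0 ?(lt_trans xx s1) ?(lt_trans s2 yt)//.
  by rewrite ltr_wpDr// mulr_ge0// exprn_even_ge0.
have xt : x0 < x0 + t by rewrite ltrDl.
(* As z'/z decreases, z z' is positive before m and negative after it. The quotient u / z' may be
   singular at m, so each side is treated separately, starting from the end at which u vanishes. *)
have [m /andP[m0 mt] z1m] : exists2 m, x0 < m < x0 + t & z1 m = 0.
  have [m hm e] := mean_value xt (fun x _ => hz x); exists m => //.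
  move: e; rewrite zt zx0 subrr addrAC subrr add0r => /esym/eqP.
  by rewrite mulf_eq0 (gt_eqF t0) orbF => /eqP.
have zz1l x : x0 < x < m -> 0 < z1 x * z x.
  move=> /andP[h1 h2]; have := zdecr x m h1 h2 mt; rewrite z1m mul0r.
  have zx : z x != 0 by apply: zn0; rewrite h1 (lt_trans h2 mt).
  have -> : z1 x * z x = z1 x / z x * z x ^+ 2 by field.
  by move=> h; rewrite mulr_gt0 ?exprn_even_gt0.
have zz1r x : m < x < x0 + t -> z1 x * z x < 0.
  move=> /andP[h1 h2]; have := zdecr m x m0 h1 h2; rewrite z1m mul0r.
  have zx : z x != 0 by apply: zn0; rewrite h2 (lt_trans m0 h1).
  have -> : z1 x * z x = z1 x / z x * z x ^+ 2 by field.
  by move=> h; rewrite pmulr_llt0 ?exprn_even_gt0.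
(* The derivative of u / z' is the Wronskian C divided by z'^2; multiplying by C makes it a square,
   whatever the sign of C. *)
have dquot x : z1 x != 0 -> is_derive (x : R) 1 (fun x => C * (u x / z1 x)) (C ^+ 2 / z1 x ^+ 2).
  move=> z1x; apply: deriv_val (deriv_scale C (deriv_div z1x (hu x) (hz1 x))) _.
  by rewrite [in RHS]expr2 -{2}(wronsk x); field.
have z1xt : z1 (x0 + t) != 0 by rewrite anti1 oppr_eq0.
have posl x : x0 < x < m -> 0 < C * u x * z x.
  move=> hx; have /andP[h1 h2] := hx; have hzz := zz1l x hx.
  have z1x : z1 x != 0 by apply: contraTneq hzz => ->; rewrite mul0r ltxx.
  have : C * (u x0 / z1 x0) < C * (u x / z1 x).
    apply: (@deriv_gt0_lt _ (fun x => C * (u x / z1 x)) (fun x => C ^+ 2 / z1 x ^+ 2)) => //.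
      move=> y /andP[]; rewrite le_eqVlt => /orP[/eqP <- _|y1 y2]; apply: dquot => //.
      have : 0 < z1 y * z y by apply: zz1l; rewrite y1 (le_lt_trans y2 h2).
      by apply: contraTneq => ->; rewrite mul0r ltxx.
    move=> y /andP[y1 y2]; rewrite divr_gt0 ?exprn_even_gt0//.
    have : 0 < z1 y * z y by apply: zz1l; rewrite y1 (lt_trans y2 h2).
    by apply: contraTneq => ->; rewrite mul0r ltxx.
  rewrite ux0 mul0r mulr0 => h.
  have -> : C * u x * z x = C * (u x / z1 x) * (z1 x * z x) by field.
  exact: mulr_gt0.
have posr x : m < x < x0 + t -> 0 < C * u x * z x.
  move=> hx; have /andP[h1 h2] := hx; have hzz := zz1r x hx.
  have z1x : z1 x != 0 by apply: contraTneq hzz => ->; rewrite mul0r ltxx.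
  have : C * (u x / z1 x) < C * (u (x0 + t) / z1 (x0 + t)).
    apply: (@deriv_gt0_lt _ (fun x => C * (u x / z1 x)) (fun x => C ^+ 2 / z1 x ^+ 2)) => //.
      move=> y /andP[y1]; rewrite le_eqVlt => /orP[/eqP ->|y2]; apply: dquot => //.
      have : z1 y * z y < 0 by apply: zz1r; rewrite y2 (lt_le_trans h1 y1).
      by apply: contraTneq => ->; rewrite mul0r ltxx.
    move=> y /andP[y1 y2]; rewrite divr_gt0 ?exprn_even_gt0//.
    have : z1 y * z y < 0 by apply: zz1r; rewrite y2 (lt_trans h1 y1).
    by apply: contraTneq => ->; rewrite mul0r ltxx.
  rewrite ut mul0r mulr0 => h.
  have -> : C * u x * z x = C * (u x / z1 x) * (z1 x * z x) by field.
  by rewrite nmulr_rgt0.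
pose W x := - C * (z x * u1 x - z1 x * u x).
have dW : has_deriv W (fun x => 4 * a * z x ^+ 2 * (C * u x * z x)).
  move=> x; apply: deriv_val (deriv_scale (- C) (deriv_sub (deriv_mul (hz x) (hu1 x)) (deriv_mul (hz1 x) (hu x)))) _.
  ring.
have a4 : 0 < 4 * a by rewrite mulr_gt0.
have W1 : W x0 < W m.
  apply: (@deriv_gt0_lt _ W _ _ _ m0 (fun x _ => dW x)) => x xm.
  rewrite mulr_gt0 ?posl// mulr_gt0// exprn_even_gt0//= zn0//.
  by case/andP: xm => -> /lt_trans ->.
have W2 : W m < W (x0 + t).
  apply: (@deriv_gt0_lt _ W _ _ _ mt (fun x _ => dW x)) => x xm.
  rewrite mulr_gt0 ?posr// mulr_gt0// exprn_even_gt0//= zn0//.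
  by case/andP: xm => /(lt_trans m0) -> ->.
have := lt_trans W1 W2; rewrite /W zx0 ux0 zt ut !mul0r !mulr0 subrr mulr0 ltxx.
by [].
Qed.

End conjugate_points.

Lemma quot_small_left (R : realType) (f f1 g g1 : R -> R) x0 : has_deriv f f1 -> has_deriv g g1 ->
  continuous f1 -> continuous g1 -> f x0 = 0 -> g x0 = 0 ->
  f1 x0 = 0 -> g1 x0 != 0 -> forall e : R, 0 < e ->
  exists2 d, 0 < d & forall s, 0 < s < d -> `|f (x0 - s) / g (x0 - s)| <= e.
Proof.
move=> hf hg cf cg f0 g0 f10 g10 e e0.
have crev (p : R -> R) : continuous p -> continuous (fun y : R => - p (0 + -1 * y)).
  move=> cp y; apply: cvgN; apply: (@continuous_comp _ _ _ (fun y : R => 0 + -1 * y)) => //.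
    exact: deriv_cont (deriv_affine (-1) 0 y).
  exact: cp.
have drev : forall u w : R -> R, has_deriv u w ->
    has_deriv (fun y => u (0 + -1 * y)) (fun y => - w (0 + -1 * y)).
  by move=> u w hu s; apply: deriv_val (deriv_comp (deriv_affine _ _ _) (hu _)) _; rewrite mulrN1.
have [] := @quot_small R _ _ _ _ (- x0) (drev _ _ hf) (drev _ _ hg) (crev _ cf) (crev _ cg) _ _ _ _ e e0.
- by rewrite mulN1r opprK add0r.
- by rewrite mulN1r opprK add0r.
- by rewrite mulN1r opprK add0r f10 oppr0.
- by rewrite mulN1r opprK add0r oppr_eq0.
move=> d d0 hd; exists d => // s /hd.
by have -> : 0 + -1 * (- x0 + s) = x0 - s by ring.
Qed.

(** * The maximum principle for the variation of q *)

Section maximum_principle.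
Variables (R : realType) (a b E : R) (z z1 : R -> R).
Hypothesis (a0 : 0 <= a) (E0 : 0 < E).
Hypothesis hz : has_deriv z z1.
Hypothesis hz1 : has_deriv z1 (fun x => - (b * z x + 2 * a * z x ^+ 3)).
Hypothesis hE : forall x, z1 x ^+ 2 + b * z x ^+ 2 + a * z x ^+ 4 = E.
Hypothesis pz : periodic z 1.
Variables (x0 t : R).
Hypothesis (zx0 : z x0 = 0) (t0 : 0 < t).
Hypothesis hs : forall s, 0 < s < t -> 0 < z1 x0 * z (x0 + s).
Hypothesis anti : forall x, z (x + t) = - z x.

Let cz : continuous z := has_deriv_cont hz.
Let cz1 : continuous z1 := has_deriv_cont hz1.
Let pz1 : periodic z1 1 := periodic_deriv hz pz.
Let zt : z (x0 + t) = 0. Proof. by rewrite anti zx0 oppr0. Qed.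

Let zn0 x : x0 < x < x0 + t -> z x != 0.
Proof.
move=> /andP[h1 h2]; have := hs (s := x - x0).
rewrite [x0 + (x - x0)]addrC subrK subr_gt0 h1 ltrBlDl h2 => /(_ isT).
by apply: contraTneq => ->; rewrite mulr0 ltxx.
Qed.

(* The variation of q = z^2 at fixed theta, where theta' = z^2 / N: at fixed x   *)
(* it is 2 z v, while theta varies by 2 sg / N with sg' = z v - sb z^2.         *)
Definition delta_q (sg v : R -> R) x := 2 * (z x * v x) - 4 * z1 x * (sg x / z x).

(** These stand for: - P and - q / 2, the variations of b and a; [sb], half the relative variation
    of N; [mu], which is N / 2 times the variation of the mean of q; and k = 8 a / Q. The hypotheses
    involving v are homogeneous in (P, q, sb, mu, v, v1, sg), so that they can be used for v and for
    - v alike. *)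
Variables (P q sb mu k : R) (v v1 sg : R -> R).
Hypothesis k0 : 0 <= k.
Hypothesis hv : has_deriv v v1.
Hypothesis hv1 : has_deriv v1
  (fun x => - ((b + 6 * a * z x ^+ 2) * v x) + P * z x + q * z x ^+ 3).
Hypothesis antiv : forall x, v (x + t) = - v x.
Hypothesis vx0 : v x0 = 0.
Hypothesis hsg : has_deriv sg (fun x => z x * v x - sb * z x ^+ 2).
Hypothesis psg : periodic sg 1.
Hypothesis sgx0 : sg x0 = 0.
Hypothesis he : forall x, z1 x * v1 x + b * (z x * v x) + 2 * a * z x ^+ 3 * v x
  - (P / 2 * z x ^+ 2 + q / 4 * z x ^+ 4) = - 2 * sb * E.
Hypothesis hk : q - 8 * a * sb = k * mu.

Let cv : continuous v := has_deriv_cont hv.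

(** z and v both change sign under the translation by t, so sg' is t-periodic and sg (x + t) - sg x
    is constant. A nonzero constant would contradict the boundedness of the periodic function sg. *)
Lemma sg_periodic x : sg (x + t) = sg x.
Proof.
have hd : has_deriv (fun x => sg (x + t) - sg x) (fun=> 0).
  move=> y; apply: deriv_val (deriv_sub (deriv_comp (deriv_add (deriv_id y) (deriv_cst t y)) (hsg _)) (hsg y)) _.
  rewrite anti antiv; ring.
have hc y : sg (y + t) = sg y + sg (x0 + t).
  by have := deriv0_const hd y x0; rewrite sgx0; lra.
have [M M0 hM] := periodic_cont_bounded ltr01 psg (has_deriv_cont hsg).
rewrite hc (@bounded_muln _ (sg (x0 + t)) M) ?addr0// => n.
suff <- : sg (x0 + n%:R * t) = n%:R * sg (x0 + t) by exact: hM.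
elim: n => [|n IH]; first by rewrite !mul0r addr0.
have -> : x0 + n.+1%:R * t = x0 + n%:R * t + t by rewrite -natr1; ring.
by rewrite hc IH -natr1; ring.
Qed.

(** Zero boundary values for [delta_q]: at both zeros of z the function sg vanishes together with
    sg' = z v - sb z^2, whereas z' does not vanish, so sg / z tends to 0 there. *)
Lemma delta_q_small e : 0 < e -> exists2 d, 0 < d & forall s, 0 < s < d ->
  `|delta_q sg v (x0 + s)| <= e /\ `|delta_q sg v (x0 + t - s)| <= e.
Proof.
move=> e0; have [M M0 hM] := periodic_cont_bounded ltr01 pz1 cz1.
have czv : continuous (fun x => z x * v x) by move=> x; apply: cvgM; [exact: cz|exact: cv].
have csg1 : continuous (fun x => z x * v x - sb * z x ^+ 2).
  have h y := deriv_sub (deriv_mul (hz y) (hv y)) (deriv_scale sb (deriv_pow 1 (hz y))).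
  by move=> y; exact: deriv_cont (h y).
(* These choices give 2 |z v| <= e / 2 and 4 |z'| |sg / z| <= 4 M e / (8 (M + 1)) <= e / 2. *)
have e1 : 0 < e / 4 by rewrite divr_gt0.
have e2 : 0 < e / (8 * (M + 1)) by rewrite divr_gt0// mulr_gt0// ltr_wpDl.
have sgt : sg (x0 + t) = 0 by rewrite sg_periodic.
have vt : v (x0 + t) = 0 by rewrite antiv vx0 oppr0.
have z1x0 := duffing_zero_deriv_neq0 E0 hE zx0.
have z1t := duffing_zero_deriv_neq0 E0 hE zt.
have [d1 d10 h1] := cont_eps (czv x0) e1.
have [d2 d20 h2] := cont_eps (czv (x0 + t)) e1.
have [|d3 d30 h3] := quot_small hsg hz csg1 cz1 sgx0 zx0 _ z1x0 e2.
  by rewrite zx0; ring.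
have [|d4 d40 h4] := quot_small_left hsg hz csg1 cz1 sgt zt _ z1t e2.
  by rewrite zt; ring.
exists (Num.min (Num.min d1 d2) (Num.min d3 d4)).
  by rewrite !lt_min d10 d20 d30.
move=> s /andP[s0]; rewrite !lt_min => /andP[/andP[sd1 sd2] /andP[sd3 sd4]].
have fin x : `|z x * v x| < e / 4 -> `|sg x / z x| <= e / (8 * (M + 1)) ->
    `|delta_q sg v x| <= e.
  move=> A B; apply: le_trans (ler_normB _ _) _.
  rewrite normrM ger0_norm// !normrM (ger0_norm (_ : 0 <= 4)) -?normrM//.
  have : `|z1 x| * `|sg x / z x| <= M * (e / (8 * (M + 1))) by rewrite ler_pM.
  have : M * (e / (8 * (M + 1))) <= e / 8.
    rewrite (_ : M * _ = e / 8 * (M / (M + 1))).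
      rewrite ler_piMr ?divr_ge0 ?(ltW e0)// ler_pdivrMr ?mul1r ?lerDl//.
      by rewrite ltr_wpDl.
    by field; rewrite gt_eqF// ltr_wpDl.
  move: A; rewrite -!mulrA; lra.
split; apply: fin.
- have := h1 (x0 + s); rewrite zx0 mul0r subr0; apply.
  by rewrite addrAC subrr add0r gtr0_norm.
- by apply: h3; rewrite s0.
- have := h2 (x0 + t - s); rewrite zt mul0r subr0; apply.
  by rewrite addrAC subrr add0r normrN gtr0_norm.
- by apply: h4; rewrite s0.
Qed.

(* The derivative of delta_q in the time s with s' = z^2. *)
Definition delta_q1 x := 2 * (z x * v1 x - z1 x * v x) / z x ^+ 2 + 4 * sb * (z1 x / z x)
   + 4 * sg x * (E / z x ^+ 4 + a).

Lemma delta_q_deriv x : z x != 0 -> is_derive x 1 (delta_q sg v) (z x ^+ 2 * delta_q1 x).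
Proof.
move=> zx.
apply: deriv_val (deriv_sub (deriv_scale 2 (deriv_mul (hz x) (hv x)))
  (deriv_mul (deriv_scale 4 (hz1 x)) (deriv_div zx (hsg x) (hz x)))) _.
rewrite /delta_q1 -(hE x); field; exact: zx.
Qed.

(** In the time s with s' = z^2 this reads w'' = (4 E / q^3) w + k mu for w = [delta_q], the
    linearized Euler-Lagrange equation of the convex functional. The coefficient of w comes from the
    second derivative of 2 / q, and k mu from that of r divided by the mean. *)
Lemma delta_q1_deriv x : z x != 0 ->
  is_derive x 1 delta_q1 (4 * E / z x ^+ 4 * delta_q sg v x + k * mu * z x ^+ 2).
Proof.
move=> zx.
have z2 : z x ^+ 2 != 0 by rewrite expf_neq0.
have z4 : z x ^+ 4 != 0 by rewrite expf_neq0.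
have e1 : z1 x * v1 x = - 2 * sb * E - b * (z x * v x) - 2 * a * z x ^+ 3 * v x
  + (P / 2 * z x ^+ 2 + q / 4 * z x ^+ 4) by have := he x; lra.
have e2 : z1 x ^+ 2 = E - b * z x ^+ 2 - a * z x ^+ 4 by have := hE x; lra.
apply: deriv_val (deriv_add (deriv_add (@deriv_div _ _ (fun y => z y ^+ 2) _ _ _ z2 (deriv_scale 2 (deriv_sub (deriv_mul (hz x) (hv1 x)) (deriv_mul (hz1 x) (hv x))))
   (deriv_pow 1 (hz x))) (deriv_scale (4 * sb) (deriv_div zx (hz1 x) (hz x))))
  (deriv_mul (deriv_scale 4 (hsg x)) (deriv_add (@deriv_div _ _ (fun y => z y ^+ 4) _ _ _ z4 (deriv_cst E x) (deriv_pow 3 (hz x))) (deriv_cst a x)))) _.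
have hk' : q = k * mu + 8 * a * sb by have := hk; lra.
rewrite hk' in e1 *.
apply/eqP; rewrite -subr_eq0; apply/eqP.
(* The identity holds modulo the linearized energy relation A = 0 and the energy relation B = 0.
   Their multipliers are the coefficients with which z' v' and z'^2 enter the difference of the two
   sides. *)
pose A := z1 x * v1 x - (- 2 * sb * E - b * (z x * v x) - 2 * a * z x ^+ 3 * v x
  + (P / 2 * z x ^+ 2 + (k * mu + 8 * a * sb) / 4 * z x ^+ 4)).
pose B := z1 x ^+ 2 - (E - b * z x ^+ 2 - a * z x ^+ 4).
transitivity (- 4 / z x ^+ 2 * A + (4 * v x / z x ^+ 3 - 4 * sb / z x ^+ 2) * B).
  by rewrite /A /B /delta_q; field.
by rewrite /A /B e1 e2 !subrr !mulr0 addr0.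
Qed.

(** A positive value forces a positive interior maximum c, since the boundary values are 0. There
    [delta_q1] vanishes, and it increases as long as [delta_q] is positive; hence [delta_q]
    increases to the right of c, a contradiction. *)
Lemma delta_q_le0 : 0 <= mu -> forall x, x0 < x < x0 + t -> delta_q sg v x <= 0.
Proof.
move=> mu0 x xt; rewrite leNgt; apply/negP => wx.
have [|d d0 hd] := @delta_q_small (delta_q sg v x / 2); first by rewrite divr_gt0.
have wx2 : delta_q sg v x / 2 < delta_q sg v x by rewrite ltr_pdivrMr// mulr_natr mulr2n ltrDl.
have /andP[xl xr] := xt.
(* At the ends of [x0 + s, x0 + t - s] the function is at most half its value at x, so its maximum
   over this interval is attained in the interior. *)
pose s := Num.min d (Num.min (x - x0) (x0 + t - x)) / 2.
have mpos : 0 < Num.min d (Num.min (x - x0) (x0 + t - x)).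
  by rewrite !lt_min d0 !subr_gt0 xl.
have s0 : 0 < s by rewrite divr_gt0.
have : s < Num.min d (Num.min (x - x0) (x0 + t - x)).
  by rewrite ltr_pdivrMr// mulr_natr mulr2n ltrDl.
rewrite !lt_min => /andP[sd /andP[sl sr]].
have [|hl hr] := hd s; first by rewrite s0.
have inn y : x0 + s <= y <= x0 + t - s -> x0 < y < x0 + t.
  by move=> /andP[y1 y2]; apply/andP; split; lra.
have [||c hc cmax] := @EVT_max R (delta_q sg v) (x0 + s) (x0 + t - s).
- lra.
- by apply: cont_within => y /=; rewrite in_itv/= => /inn/zn0/delta_q_deriv; exact: deriv_cont.
move: hc; rewrite in_itv/= => hc.
have wc : delta_q sg v x <= delta_q sg v c by apply: cmax; rewrite in_itv/=; apply/andP; split; lra.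
have {hc} /andP[c1 c2] : x0 + s < c < x0 + t - s.
  have /andP[+ +] := hc; rewrite !le_eqVlt => /orP[/eqP e|->].
    by move: hl; rewrite e ler_norml => /andP[_]; lra.
  by case/orP => [/eqP e|->//]; move: hr; rewrite -e ler_norml => /andP[_]; lra.
have ct : x0 < c < x0 + t by apply: inn; rewrite !ltW.
have pc : delta_q1 c = 0.
  have : z c ^+ 2 * delta_q1 c = 0.
    apply: (@deriv_interior_max R (delta_q sg v) (fun x => z x ^+ 2 * delta_q1 x) (x0 + s) (x0 + t - s)).
    - by rewrite c1 c2.
    - by move=> y /andP[y1 y2]; apply/delta_q_deriv/zn0/inn; rewrite !ltW.
    - by move=> y /andP[y1 y2]; apply: cmax; rewrite in_itv/= !ltW.
  by move/eqP; rewrite mulf_eq0 expf_eq0/= (negbTE (zn0 ct)) => /eqP.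
have [|d' d'0 hd'] := cont_pos (deriv_cont (delta_q_deriv (zn0 ct))); first exact: lt_le_trans wx wc.
(* On [c, c + h] the function stays positive, and c + h is still in the interval on which c is the
   maximum. *)
pose h := Num.min d' (x0 + t - s - c) / 2.
have m2 : 0 < Num.min d' (x0 + t - s - c) by rewrite lt_min d'0 subr_gt0.
have h0 : 0 < h by rewrite divr_gt0.
have : h < Num.min d' (x0 + t - s - c).
  by rewrite ltr_pdivrMr// mulr_natr mulr2n ltrDl.
rewrite lt_min => /andP[hd1 hd2].
have zy y : c <= y <= c + h -> z y != 0.
  by move=> /andP[y1 y2]; apply/zn0/inn; apply/andP; split; lra.
have delta_q1_gt0 y : c < y <= c + h -> 0 < delta_q1 y.
  move=> /andP[y1 y2]; rewrite -pc.
  apply: (@deriv_gt0_lt R delta_q1 (fun x => 4 * E / z x ^+ 4 * delta_q sg v x + k * mu * z x ^+ 2)) => //.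
    by move=> y' /andP[y1' y2']; apply/delta_q1_deriv/zy; rewrite y1' (le_trans y2').
  move=> y' /andP[y1' y2']; have zy' : z y' != 0.
    by apply: zy; rewrite (ltW y1') (ltW (lt_le_trans y2' y2)).
  have kz : 0 <= k * mu * z y' ^+ 2 by rewrite mulr_ge0 ?exprn_even_ge0// mulr_ge0.
  apply: ltr_pwDl => //.
  apply: mulr_gt0; last by apply: hd'; rewrite gtr0_norm ?subr_gt0//; lra.
  by rewrite divr_gt0 ?exprn_even_gt0// mulr_gt0.
have : delta_q sg v c < delta_q sg v (c + h).
  apply: (@deriv_gt0_lt R (delta_q sg v) (fun x => z x ^+ 2 * delta_q1 x)); first by rewrite ltrDl.
    by move=> y hy; apply/delta_q_deriv/zy.
  move=> y /andP[y1 y2]; rewrite mulr_gt0 ?delta_q1_gt0 ?exprn_even_gt0 ?y1 ?zy ?ltW//.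
rewrite ltNge => /negP; apply; apply: cmax; rewrite in_itv/=; apply/andP; split; lra.
Qed.

Variable tau : R -> R.
Hypothesis htau : has_deriv tau (fun x => 2 * z x ^+ 3 * v x - sb * z x ^+ 4 - mu).
Hypothesis ptau : periodic tau 1.

(* The integral of z^2 delta_q over a period is 2 mu. *)
Lemma mu_le0 : (forall x, x0 < x < x0 + t -> delta_q sg v x <= 0) -> mu <= 0.
Proof.
move=> hw.
(* This is z^2 [delta_q] with its denominator cleared, so that it is meaningful at the zeros of z
   too. *)
pose g x := z x ^+ 2 * (2 * (z x * v x)) - 4 * z1 x * (sg x * z x).
have g_le0 x : g x <= 0.
  have gt y : g (y + t) = g y.
    rewrite /g sg_periodic anti antiv (anti_deriv hz anti); ring.
  have [n /andP[n1 n2]] := shift_reduce x0 x t0.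
  rewrite -(shift_periodic gt n); move: n1 n2; set y := x + _ => n1 n2.
  have [e|yx0] := eqVneq y x0; first by rewrite /g e zx0 sgx0 expr0n/= !mul0r mulr0 subrr.
  have yr : x0 < y < x0 + t by rewrite lt_neqAle eq_sym yx0 n1.
  have -> : g y = z y ^+ 2 * delta_q sg v y by rewrite /g /delta_q; field; exact: zn0.
  by rewrite mulr_ge0_le0 ?exprn_even_ge0 ?hw.
(* A primitive of - g. Its first two terms are periodic, so its increment over a period is - 2
   mu. *)
pose h x := 2 * z x ^+ 2 * sg x - 2 * tau x - 2 * mu * x.
have hh (x : R) : is_derive x 1 h (- g x).
  apply: deriv_val (deriv_sub (deriv_sub (deriv_mul (deriv_scale 2 (deriv_pow 1 (hz x))) (hsg x)) (deriv_scale 2 (htau x)))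
    (deriv_scale (2 * mu) (deriv_id x))) _; rewrite /g; ring.
have : h 0 <= h 1.
  by apply: (deriv_ge0_le ler01 (fun x _ => hh x)) => x _; rewrite oppr_ge0.
have p1 (f : R -> R) : periodic f 1 -> f 1 = f 0 by move=> pf; rewrite -[RHS]pf add0r.
rewrite /h (p1 _ pz) (p1 _ psg) (p1 _ ptau); lra.
Qed.

(* sg = z^2 (C - sb (x - x0)) where delta_q = 0, as (sg / z^2)' = - sb. *)
Lemma delta_q_eq0 : (forall x, x0 < x < x0 + t -> delta_q sg v x = 0) -> forall x, v x = 0.
Proof.
move=> hw.
have xt : x0 < x0 + t by rewrite ltrDl.
have vE x : x0 < x < x0 + t -> v x = 2 * z1 x * (sg x / z x ^+ 2).
  move=> hx; have zx := zn0 hx; have := hw x hx; rewrite /delta_q => e.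
  apply: (@mulfI _ (2 * z x)); first by rewrite mulf_neq0.
  transitivity (2 * (z x * v x)); first by ring.
  by move/eqP: e; rewrite subr_eq0 => /eqP ->; field.
pose f x := sg x / z x ^+ 2 + sb * x.
have hf x : x0 < x < x0 + t -> is_derive (x : R) 1 f 0.
  move=> hx; have zx := zn0 hx; have z2 : z x ^+ 2 != 0 by rewrite expf_neq0.
  apply: deriv_val (deriv_add (@deriv_div _ _ (fun y => z y ^+ 2) _ _ _ z2 (hsg x) (deriv_pow 1 (hz x))) (deriv_scale sb (deriv_id x))) _.
  by rewrite (vE x hx); field.
pose m := x0 + t / 2.
have mt : x0 < m < x0 + t by rewrite /m; apply/andP; split; have := t0; lra.
have fc x : x0 < x < x0 + t -> f x = f m.
  move=> /andP[h1 h2]; have /andP[h3 h4] := mt.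
  have [e|e|->//] := ltgtP x m.
    have [|c _] := @mean_value R f (fun=> 0) _ _ e.
      by move=> y /andP[y1 y2]; apply: hf; rewrite (lt_le_trans h1 y1) (le_lt_trans y2 h4).
    by rewrite mul0r => /eqP; rewrite subr_eq0 => /eqP.
  have [|c _] := @mean_value R f (fun=> 0) _ _ e.
    by move=> y /andP[y1 y2]; apply: hf; rewrite (lt_le_trans h3 y1) (le_lt_trans y2 h2).
  by rewrite mul0r => /eqP; rewrite subr_eq0 => /eqP.
have vl x : x0 < x < x0 + t -> v x = 2 * z1 x * (f m - sb * x).
  by move=> hx; rewrite vE// -(fc _ hx) /f addrK.
have cr : continuous (fun x => 2 * z1 x * (f m - sb * x)).
  have h y := deriv_mul (deriv_scale 2 (hz1 y)) (deriv_sub (deriv_cst (f m) y) (deriv_scale sb (deriv_id y))).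
  by move=> y; exact: deriv_cont (h y).
have z1x0 := duffing_zero_deriv_neq0 E0 hE zx0.
have z1t := duffing_zero_deriv_neq0 E0 hE zt.
(* Between the two zeros v is 2 z' times an affine function. By continuity the formula extends to
   the ends, where v vanishes and z' does not; so the affine function has two zeros and is 0. *)
have e1 : f m - sb * x0 = 0.
  have := cont_eq_right t0 (@cv x0) (cr x0) vl; rewrite vx0 => /esym/eqP.
  by rewrite !mulf_eq0 pnatr_eq0 (negbTE z1x0) => /eqP.
have e2 : f m - sb * (x0 + t) = 0.
  have := cont_eq_left t0 (@cv (x0 + t)) (cr (x0 + t)); rewrite addrK => /(_ vl).
  rewrite antiv vx0 oppr0 => /esym/eqP.
  by rewrite !mulf_eq0 pnatr_eq0 (negbTE z1t) => /eqP.
have sb0 : sb = 0.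
  have : sb * t = 0.
    have -> : sb * t = (f m - sb * x0) - (f m - sb * (x0 + t)) by ring.
    by rewrite e1 e2 subrr.
  by move/eqP; rewrite mulf_eq0 (gt_eqF t0) orbF => /eqP.
apply: (anti_zero (x0 := x0) t0 antiv) => x /andP[x1 x2].
have [->//|xx0] := eqVneq x x0.
rewrite vl; last by rewrite lt_neqAle eq_sym xx0 x1.
have fm : f m = 0 by move: e1; rewrite sb0 mul0r subr0.
by rewrite fm sb0 mul0r subrr mulr0.
Qed.

End maximum_principle.

(** * Integration on the circle *)

Section translation.
Variable R : realType.
Local Notation mu := (@lebesgue_measure R).

Lemma measurable_shift (c : R) :
  @measurable_fun _ _ (measurableTypeR R) (measurableTypeR R) setT (fun x : R => x + c).
Proof. by apply: measurable_realfun.measurable_funD. Qed.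

Lemma lebesgue_shift (c : R) (A : set R) : measurable A ->
  mu ((fun x : R => x + c) @^-1` A) = mu A.
Proof.
move=> mA; apply/esym.
apply: (@lebesgue_measure_unique R
  (measure_function_pushforward__canonical__measure_function_Measure
     (lebesgue_measure : measure (measurableTypeR R) R) (measurable_shift c))) => //.
move=> _ [[a b] _ <-] /=; rewrite /pushforward.
have -> : (fun x : R => x + c) @^-1` `]a, b] = `]a - c, b - c].
  apply/seteqP; split => x /=; rewrite !in_itv/= => /andP[h1 h2];
    apply/andP; split; lra.
rewrite !lebesgue_measure_itv/= !lte_fin ltrD2r; case: ifP => // _.
by rewrite -!EFinD; congr EFin; ring.
Qed.

Lemma ae_shift (c : R) (P : R -> Prop) : {ae mu, forall x, P x} ->
  {ae mu, forall x, P (x + c)}.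
Proof.
move=> [N [mN N0 PN]]; exists ((fun x : R => x + c) @^-1` N); split.
- by rewrite -[X in measurable X]setTI; exact: measurable_shift.
- by rewrite -N0; exact: lebesgue_shift.
- by move=> x /= Px; exact: PN.
Qed.

(** A countable union of null sets is null, so almost every x has the property that each of its
    integer translates lying in [0, 1] satisfies P, and there is at least one such translate. *)
Lemma ae_periodic_all (P : R -> Prop) : (forall x, P (x + 1) <-> P x) ->
  {ae mu, forall x, 0 <= x <= 1 -> P x} -> {ae mu, forall x, P x}.
Proof.
move=> hP h01.
have hPn (n : nat) x : P (x + n%:R) <-> P x.
  elim: n x => [|n IH] x; first by rewrite addr0.
  by rewrite -natr1 addrA hP.
have h1 : {ae mu, forall x, forall n : nat, 0 <= x + n%:R <= 1 -> P (x + n%:R)}.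
  by apply: ae_foralln => n; exact: (ae_shift n%:R h01).
have h2 : {ae mu, forall x, forall n : nat, 0 <= x - n%:R <= 1 -> P (x - n%:R)}.
  by apply: ae_foralln => n; exact: (ae_shift (- n%:R) h01).
apply: (@filterS2 _ _ (ae_filter_ringOfSetsType mu) _ _ _ _ h1 h2) => x x1 x2.
have [n /andP[n1 n2]] := shift_reduce 0 x (ltr01 (R := R)).
rewrite mulr1 add0r in n1 n2.
case: n n1 n2 => n n1 n2.
  by apply/(hPn n); apply: x1; rewrite n1 ltW.
move: n1 n2; rewrite NegzE rmorphN/= => n1 n2.
have : P (x - n.+1%:R) by apply: x2; rewrite n1 ltW.
by rewrite -(hPn n.+1 (x - _)) subrK.
Qed.

Lemma ge0_integral_shift (c : R) (D : set R) (f : R -> \bar R) : measurable D ->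
  measurable_fun D f -> (forall y, D y -> 0 <= f y)%E ->
  (\int[mu]_(x in D) f x = \int[mu]_(x in (fun x : R => x + c)%R @^-1` D) f (x + c)%R)%E.
Proof.
move=> mD mf f0.
have f0' : {in D, forall y, (0 <= f y)%E} by move=> y; rewrite inE; exact: f0.
apply: etrans (ge0_integral_pushforward (measurable_shift c) lebesgue_measure mD mf f0').
apply: eq_measure_integral => [|mS A mA _]; first exact: measurable_shift.
by rewrite /= /pushforward lebesgue_shift.
Qed.

Lemma preimage_shift_itv (c a b : R) :
  (fun x : R => x + c) @^-1` `[a + c, b + c] = `[a, b].
Proof.
by apply/seteqP; split => x /=; rewrite !in_itv/= !lerD2r.
Qed.

Lemma integrable_shift (c a b : R) (f : R -> R) : measurable_fun [set: R] f ->
  mu.-integrable `[a, b] (EFin \o f) ->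
  mu.-integrable `[a - c, b - c] (fun x => (f (x + c))%:E).
Proof.
move=> mf /integrableP[_ hf]; apply/integrableP; split.
  apply/measurable_EFinP; apply: measurable_funTS.
  exact: (measurableT_comp mf (measurable_shift c)).
move: hf; rewrite (@ge0_integral_shift c)//=; last first.
  by do 2 apply: measurableT_comp => //; exact: measurable_funTS.
by rewrite -{1}(subrK c a) -{1}(subrK c b) preimage_shift_itv.
Qed.

Lemma Rintegral_shift (c a b : R) (f : R -> R) : measurable_fun [set: R] f ->
  mu.-integrable `[a, b] (EFin \o f) ->
  \int[mu]_(x in `[a, b]) f x = \int[mu]_(x in `[a - c, b - c]) f (x + c).
Proof.
move=> mf hf; rewrite /Rintegral; congr fine.
have e : (fun x : R => x + c) @^-1` `[a, b] = `[a - c, b - c].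
  by rewrite -{1}(subrK c a) -{1}(subrK c b) preimage_shift_itv.
rewrite -e.
have mf' : measurable_fun [set: measurableTypeR R] (EFin \o f) by exact/measurable_EFinP.
have := @integral_pushforward _ _ _ _ _ _ (measurable_shift c) lebesgue_measure `[a, b] (EFin \o f) mf'.
rewrite e => /(_ (integrable_shift c mf hf) (measurable_itv _)).
apply: etrans.
apply: eq_measure_integral => [|mS A mA _]; first exact: measurable_shift.
by rewrite /= /pushforward lebesgue_shift.
Qed.

End translation.

(** * Primitives of locally integrable functions *)

Section primitive.
Variable R : realType.
Local Notation mu := (@lebesgue_measure R).
Implicit Types (f g : R -> R) (a b c : R).

Definition locint f := measurable_fun [set: R] f /\
  forall a b, mu.-integrable `[a, b] (EFin \o f).

Lemma integrable_glue f a b c : measurable_fun [set: R] f -> a <= b -> b <= c ->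
  mu.-integrable `[a, b] (EFin \o f) -> mu.-integrable `[b, c] (EFin \o f) ->
  mu.-integrable `[a, c] (EFin \o f).
Proof.
move=> mf ab bc /integrableP[_ h1] h2; apply/integrableP; split.
  by apply/measurable_EFinP; exact: measurable_funTS.
have -> : `[a, c]%classic = `[a, b]%classic `|` `]b, c]%classic.
  by rewrite -itv_bndbnd_setU// bnd_simp.
rewrite ge0_integral_setU//=.
- rewrite lte_add_pinfty//.
  have /integrableP[_ //] : mu.-integrable `]b, c] (EFin \o f).
  by apply: integrableS h2 => //; exact: subset_itv_oc_cc.
- by do 2 apply: measurableT_comp => //; exact: measurable_funTS.
- apply/disj_setPS => x [/=]; rewrite !in_itv/= => /andP[_ h] /andP[+ _].
  by rewrite ltNge h.
Qed.

Lemma locint_periodic f : periodic f 1 -> measurable_fun [set: R] f ->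
  mu.-integrable `[0, 1] (EFin \o f) -> locint f.
Proof.
move=> pf mf hf; split=> // a b.
have h1 (n : nat) : mu.-integrable `[- n%:R, - n%:R + 1] (EFin \o f).
  have := integrable_shift n%:R mf hf; rewrite sub0r addrC.
  apply: eq_integrable => // x _ /=.
  by have := shift_periodic pf n x; rewrite mulr1 => <-.
have h2 (n : nat) : mu.-integrable `[n%:R, n%:R + 1] (EFin \o f).
  have := integrable_shift (- n%:R) mf hf; rewrite opprK add0r addrC.
  apply: eq_integrable => // x _ /=.
  by have := shift_periodic pf n (x - n%:R); rewrite mulr1 subrK => <-.
have h (n : nat) : mu.-integrable `[- n%:R, n%:R + 1] (EFin \o f).
  elim: n => [|n IH]; first by rewrite oppr0 add0r.
  apply: (@integrable_glue _ _ (n%:R + 1)) => //.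
  - by rewrite -natr1; have := ler0n R n; lra.
  - by rewrite -natr1 lerDl.
  - apply: (@integrable_glue _ _ (- n%:R)) => //.
    + by rewrite -natr1; lra.
    + by have := ler0n R n; lra.
    + have := h1 n.+1; have -> : - n.+1%:R + 1 = - n%:R :> R by rewrite -natr1; ring.
      exact.
  - by have := h2 n.+1; rewrite -natr1.
pose n := (Num.truncn (Num.max `|a| `|b|)).+1.
have nab : Num.max `|a| `|b| < n%:R.
  have m0 : 0 <= Num.max `|a| `|b| by rewrite le_max normr_ge0.
  by have /andP[] := Num.Theory.truncn_itv m0.
apply: integrableS (h n) => //.
move: nab; rewrite gt_max !ltr_norml => /andP[/andP[a1 a2] /andP[b1 b2]].
move=> x /=; rewrite !in_itv/= => /andP[x1 x2]; apply/andP; split; lra.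
Qed.

Lemma locint_cont f : continuous f -> locint f.
Proof.
move=> cf; split; first exact: continuous_measurable_fun.
move=> a b; apply: continuous_compact_integrable; first exact: segment_compact.
exact: continuous_subspaceT.
Qed.

Lemma locintD f g : locint f -> locint g -> locint (fun x => f x + g x).
Proof.
move=> [mf hf] [mg hg]; split; first exact: measurable_funD.
by move=> a b; apply: (integrableD _ (hf a b) (hg a b)).
Qed.

Lemma locintN f : locint f -> locint (fun x => - f x).
Proof.
move=> [mf hf]; split; first exact: measurableT_comp.
by move=> a b; exact: (integrableN (hf a b)).
Qed.

Lemma locintB f g : locint f -> locint g -> locint (fun x => f x - g x).
Proof. by move=> hf hg; apply: locintD => //; exact: locintN. Qed.

Lemma locintM f g (M : R) : locint f -> measurable_fun [set: R] g ->
  (forall x, `|g x| <= M) -> locint (fun x => f x * g x).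
Proof.
move=> [mf hf] mg hM; split; first exact: measurable_funM.
move=> a b; have M0 : 0 <= M by exact: le_trans (hM 0).
apply: (le_integrable _ _ _ (integrableZl _ M (hf a b))) => //.
- by apply/measurable_EFinP; apply: measurable_funTS; exact: measurable_funM.
- move=> x _ /=; rewrite lee_fin !normrM (ger0_norm M0) mulrC.
  by rewrite ler_wpM2r.
Qed.

Lemma locintZ f c : locint f -> locint (fun x => c * f x).
Proof.
move=> hf; under eq_fun do rewrite mulrC.
by apply: (locintM (M := `|c|)).
Qed.

Lemma locint_norm f : locint f -> locint (fun x => `|f x|).
Proof.
move=> [mf hf]; split; first exact: measurableT_comp.
by move=> a b; exact: integrable_norm.
Qed.

Definition prim f x :=
  if 0 <= x then \int[mu]_(t in `[0, x]) f t else - \int[mu]_(t in `[x, 0]) f t.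

Lemma locint_split f a b c : locint f -> a <= b -> b <= c ->
  \int[mu]_(t in `[a, c]) f t = \int[mu]_(t in `[a, b]) f t + \int[mu]_(t in `[b, c]) f t.
Proof.
move=> [mf hf] ab bc.
rewrite -(@Rintegral_itv_obnd_cbnd _ b (BRight c)); last first.
  by apply: integrableS (hf b c) => //; exact: subset_itv_oc_cc.
rewrite -(@Rintegral_itvB _ _ (BLeft a) (BRight c) b)//.
by rewrite addrC subrK.
Qed.

Lemma prim_sub f a b : locint f -> a <= b ->
  prim f b - prim f a = \int[mu]_(t in `[a, b]) f t.
Proof.
move=> hf ab; rewrite /prim; case: ifPn => b0; case: ifPn => a0.
- by rewrite (locint_split hf a0 ab); ring.
- by rewrite opprK addrC -locint_split// ltW// ltNge.
- by rewrite (le_trans a0 ab) in b0.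
- rewrite (locint_split hf ab (b := b) (c := 0)); first by ring.
  by rewrite ltW// ltNge.
Qed.

Lemma prim0 f : prim f 0 = 0.
Proof. by rewrite /prim lexx set_itv1 Rintegral_set1. Qed.

Lemma prim1 f : prim f 1 = \int[mu]_(t in `[0, 1]) f t.
Proof. by rewrite /prim ler01. Qed.

(** Near x the primitive equals a constant plus the integral from x - 1, to which the fundamental
    theorem applies; this base point avoids the case distinction of [prim] at 0. *)
Lemma prim_deriv f : continuous f -> has_deriv (prim f) f.
Proof.
move=> cf x; have lf := locint_cont cf; have [mf hf] := lf.
have x1 : x < x + 1 by rewrite ltrDl.
have xm : x - 1 < x by lra.
have [d1 d2] := continuous_FTC1_closed x1 (hf (x - 1) (x + 1)) xm (cf x).
apply: (@near_eq_is_derive _ _ _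
  (fun y => prim f (x - 1) + \int[mu]_(t in `[x - 1, y]) f t)).
  near=> y.
  rewrite -prim_sub//; first by ring.
  by apply: ltW; near: y; apply: lt_nbhsr; lra.
apply: deriv_val (deriv_add (deriv_cst _ _) (DeriveDef d1 erefl)) _.
by rewrite add0r -derive1E d2.
Unshelve. all: by end_near. Qed.

Lemma prim_continuous f : locint f -> continuous (prim f).
Proof.
move=> lf x; have [mf hf] := lf.
have x1 : x - 1 <= x + 1 by lra.
have := parameterized_integral_continuous x1 (hf (x - 1) (x + 1)).
rewrite /parameterized_integral => h.
have inx : x \in `](x - 1), (x + 1)[%R by rewrite in_itv/=; apply/andP; split; lra.
apply: (@within_continuous_continuous _ _ _ (x - 1) (x + 1) _ _ _ _ inx); first lra.
have cc : {within `[x - 1, x + 1], continuous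
    (fun y => prim f (x - 1) + \int[mu]_(t in `[x - 1, y]) f t)}.
  by move=> y; apply: cvgD; [exact: cvg_cst|exact: h].
apply: subspace_eq_continuous cc => y.
rewrite inE/= in_itv/= => /andP[y1 _].
have e : prim f (x - 1) + \int[mu]_(t in `[x - 1, y]) f t = prim f y.
  by rewrite -prim_sub//; ring.
exact: e.
Qed.

(** By periodicity of f, the integral over an interval of length 1 does not depend on the interval,
    and over [0, 1] it vanishes. *)
Lemma prim_periodic f : periodic f 1 -> locint f ->
  \int[mu]_(t in `[0, 1]) f t = 0 -> periodic (prim f) 1.
Proof.
move=> pf lf f0.
have step a b : a <= b -> prim f (b + 1) - prim f b = prim f (a + 1) - prim f a.
  move=> ab; have h1 := prim_sub lf ab.
  have ab1 : a + 1 <= b + 1 by rewrite lerD2r.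
  have h2 := prim_sub lf ab1; have [mf hf] := lf.
  have h3 := Rintegral_shift 1 mf (hf (a + 1) (b + 1)).
  have e : \int[mu]_(t in `[a, b]) f (t + 1) = \int[mu]_(t in `[a, b]) f t.
    by apply: eq_Rintegral => y _; exact: pf.
  by move: h2; rewrite h3 !addrK e -h1; lra.
have h0 : prim f (0 + 1) - prim f 0 = 0 by rewrite add0r prim0 prim1 subr0.
move=> x; have [x0|x0] := leP 0 x.
  by have := step _ _ x0; rewrite h0; lra.
by have := step _ _ (ltW x0); rewrite h0; lra.
Qed.

Lemma prim_bound f (a b : R) : locint f -> 0 <= a -> a <= b -> b <= 1 ->
  `|prim f b - prim f a| <= \int[mu]_(t in `[0, 1]) `|f t|.
Proof.
move=> lf a0 ab b1; rewrite prim_sub//; have [mf hf] := lf.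
apply: le_trans (le_normr_Rintegral _ (hf a b)) _ => //.
have lnf := locint_norm lf.
rewrite (locint_split lnf (le_trans a0 ab) b1) (locint_split lnf a0 ab).
rewrite -[leLHS]addr0 -[leLHS]add0r addrA.
by rewrite !lerD//; apply: Rintegral_ge0 => *; exact: normr_ge0.
Qed.

End primitive.

(** * The integral over a period, and integration by parts *)

Section circle_integral.
Variable R : realType.
Local Notation mu := (@lebesgue_measure R).
Local Notation I f := (\int[mu]_(x in `[0%R, 1%R]) f x).
Implicit Types (f g : R -> R) (a b c : R).

Lemma I_D f g : locint f -> locint g -> I (fun x => f x + g x) = I f + I g.
Proof. by move=> [_ hf] [_ hg]; rewrite RintegralD//. Qed.

Lemma I_Z f c : locint f -> I (fun x => c * f x) = c * I f.
Proof. by move=> [_ hf]; rewrite RintegralZl//. Qed.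

Lemma I_N f : locint f -> I (fun x => - f x) = - I f.
Proof.
by move=> hf; rewrite -mulN1r -I_Z//; apply: eq_Rintegral => x _; rewrite mulN1r.
Qed.

Lemma I_B f g : locint f -> locint g -> I (fun x => f x - g x) = I f - I g.
Proof. by move=> hf hg; rewrite I_D// ?I_N//; exact: locintN. Qed.

Lemma I_ext f g : f =1 g -> I f = I g.
Proof. by move=> fg; apply: eq_Rintegral => x _. Qed.

Lemma I_le f g : locint f -> locint g -> (forall x, f x <= g x) -> I f <= I g.
Proof. by move=> [_ hf] [_ hg] fg; apply: le_Rintegral. Qed.

Lemma I_ge0 f : (forall x, 0 <= f x) -> 0 <= I f.
Proof. by move=> h; apply: Rintegral_ge0. Qed.

Lemma I_norm f : locint f -> `|I f| <= I (fun x => `|f x|).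
Proof. by move=> [_ hf]; exact: le_normr_Rintegral. Qed.

Lemma I_cst c : I (fun=> c) = c.
Proof.
rewrite Rintegral_cst//; have := @lebesgue_measure_itv R `[0, 1]%R.
by rewrite /= lte_fin ltr01 oppr0 adde0 => e; rewrite [X in fine X]e mulr1.
Qed.

Lemma locint_cst c : locint (fun=> c : R).
Proof. by apply: locint_cont => x; exact: cvg_cst. Qed.

Lemma I_deriv F f : has_deriv F f -> continuous f -> I f = F 1 - F 0.
Proof.
move=> hF cf; have hP := prim_deriv cf.
have h0 : has_deriv (fun x => F x - prim f x) (fun=> 0).
  by move=> x; apply: deriv_val (deriv_sub (hF x) (hP x)) _; rewrite subrr.
have := deriv0_const h0 1 0; rewrite prim0 prim1; lra.
Qed.

Lemma I_ae f g : measurable_fun [set: R] f -> measurable_fun [set: R] g ->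
  f = g %[ae mu] -> I f = I g.
Proof.
move=> mf mg fg; rewrite /Rintegral; congr fine.
apply: ae_eq_integral => //; try by apply/measurable_EFinP; exact: measurable_funTS.
have h := ae_eq_comp EFin fg.
exact: ae_eq_subset (@subsetT _ _) h.
Qed.

Lemma deriv_mul_cont F f G g : has_deriv F f -> has_deriv G g -> continuous f ->
  continuous g -> I (fun x => F x * g x) = F 1 * G 1 - F 0 * G 0 - I (fun x => f x * G x).
Proof.
move=> hF hG cf cg.
have cF := has_deriv_cont hF; have cG := has_deriv_cont hG.
have cfG : continuous (fun x => f x * G x) by move=> x; apply: cvgM; [exact: cf|exact: cG].
have cFg : continuous (fun x => F x * g x) by move=> x; apply: cvgM; [exact: cF|exact: cg].
have := @I_deriv (fun x => F x * G x) (fun x => f x * G x + F x * g x).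
rewrite I_D; [|exact: locint_cont..] => <-; first by ring.
- by move=> x; exact: deriv_mul.
- by move=> x; apply: cvgD; [exact: cfG|exact: cFg].
Qed.

Lemma prim_approx f (e : R) : locint f -> 0 < e ->
  exists2 g, continuous g & I (fun x => `|f x - g x|) <= e.
Proof.
move=> lf e0; have [mf hf] := lf.
have [||//|g_ [cg ig]] := @approximation_continuous_integrable R `[0, 1] f.
- exact: measurable_itv.
- by have := @lebesgue_measure_itv R `[0, 1]%R; rewrite /= lte_fin ltr01 oppr0 adde0 => ->; exact: ltry.
move=> /fine_cvgP[] [N _ fing] /cvgrPdist_le /(_ _ e0)[M _ h].
exists (g_ (maxn N M)) => //.
have := h (maxn N M) (leq_maxr N M); rewrite sub0r normrN.
by move=> /(le_trans (ler_norm _)).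
Qed.

Lemma primB f g x : locint f -> locint g ->
  prim (fun y => f y - g y) x = prim f x - prim g x.
Proof.
move=> [_ hf] [_ hg]; rewrite /prim; case: ifP => _; first by rewrite RintegralB.
by rewrite RintegralB//; ring.
Qed.

Definition parts_defect (phi phi1 f : R -> R) : R :=
  I (fun x => prim f x * phi1 x) - prim f 1 * phi 1 + I (fun x => f x * phi x).

(** For continuous f this is the product rule. In general the defect is additive in f and bounded by
    3 M times the L^1 norm, one M for each of its three terms, so it vanishes by density of the
    continuous functions in L^1. *)
Lemma prim_parts f phi phi1 (M : R) : locint f -> has_deriv phi phi1 -> continuous phi1 ->
  (forall x, `|phi x| <= M) -> (forall x, `|phi1 x| <= M) ->
  I (fun x => prim f x * phi1 x) = prim f 1 * phi 1 - I (fun x => f x * phi x).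
Proof.
move=> lf hphi cphi1 hM hM1; have cphi := has_deriv_cont hphi.
have M0 : 0 <= M by exact: le_trans (hM 0).
suff : parts_defect phi phi1 f = 0 by rewrite /parts_defect; lra.
have mphi := continuous_measurable_fun cphi.
have mphi1 := continuous_measurable_fun cphi1.
have l1 g : locint g -> locint (fun x => prim g x * phi1 x).
  by move=> lg; apply: (locintM _ mphi1 hM1); apply/locint_cont/prim_continuous.
have l2 g : locint g -> locint (fun x => g x * phi x).
  by move=> lg; apply: (locintM lg mphi hM).
have Dle g : locint g -> `|parts_defect phi phi1 g| <= 3 * M * I (fun x => `|g x|).
  move=> lg; have lng := locint_norm lg.
  have h1 : `|I (fun x => prim g x * phi1 x)| <= M * I (fun x => `|g x|).
    apply: le_trans (I_norm (l1 _ lg)) _; rewrite -[leRHS]I_cst.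
    apply: le_Rintegral => //; first by case: (locint_norm (l1 _ lg)).
      by case: (locint_cst (M * I (fun x => `|g x|))).
    move=> x; rewrite /= in_itv/= => /andP[x0 x1]; rewrite normrM mulrC ler_pM//.
    by have := @prim_bound R g 0 x lg (lexx _) x0 x1; rewrite prim0 subr0.
  have h2 : `|prim g 1 * phi 1| <= M * I (fun x => `|g x|).
    rewrite normrM mulrC ler_pM//.
    by have := @prim_bound R g 0 1 lg (lexx _) ler01 (lexx _); rewrite prim0 subr0.
  have h3 : `|I (fun x => g x * phi x)| <= M * I (fun x => `|g x|).
    apply: le_trans (I_norm (l2 _ lg)) _; rewrite -I_Z//.
    apply: I_le; [exact: locint_norm (l2 _ lg)|exact: locintZ|] => x.
    by rewrite normrM mulrC ler_wpM2r.
  apply: le_trans (ler_normD _ _) _; apply: le_trans (lerD (ler_normB _ _) (lexx _)) _.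
  lra.
apply/eqP; rewrite -normr_le0 -[0](mulr0 (3 * M)).
apply/ler_addgt0Pl => e e0.
have e' : 0 < e / (3 * M + 1) by rewrite divr_gt0// ltr_wpDl ?mulr_ge0.
have [g cg hg] := prim_approx lf e'.
have lg := locint_cont cg.
have lfg : locint (fun x => f x - g x) by exact: locintB.
have Dg0 : parts_defect phi phi1 g = 0.
  by rewrite /parts_defect (deriv_mul_cont (prim_deriv cg) hphi cg cphi1) prim0; ring.
have -> : parts_defect phi phi1 f = parts_defect phi phi1 (fun x => f x - g x) + parts_defect phi phi1 g.
  rewrite /parts_defect; have -> : I (fun x => (f x - g x) * phi x) = I (fun x => f x * phi x) - I (fun x => g x * phi x).
    by rewrite -I_B; [apply: I_ext => x; ring|exact: l2..].
  have -> : I (fun x => prim (fun x => f x - g x) x * phi1 x) =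
      I (fun x => prim f x * phi1 x) - I (fun x => prim g x * phi1 x).
    by rewrite -I_B; [apply: I_ext => x; rewrite primB//; ring|exact: l1..].
  rewrite (primB 1 lf lg).
  move: (I (fun x => prim f x * phi1 x)) (I (fun x => prim g x * phi1 x)) => A B.
  move: (I (fun x => f x * phi x)) (I (fun x => g x * phi x)) => C D.
  by move: (prim f 1) (prim g 1) => p q; ring.
rewrite Dg0 addr0 mulr0 addr0; apply: le_trans (Dle _ lfg) _.
apply: le_trans (_ : 3 * M * (e / (3 * M + 1)) <= _); first by rewrite ler_wpM2l ?mulr_ge0.
rewrite mulrCA ler_piMr ?(ltW e0)// ler_pdivrMr ?mul1r ?lerDl//.
by rewrite ltr_wpDl ?mulr_ge0.
Qed.

End circle_integral.

(** * The lemma of du Bois-Reymond *)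

Section du_bois_reymond.
Variable R : realType.
Local Notation mu := (@lebesgue_measure R).
Local Notation I f := (\int[mu]_(x in `[0%R, 1%R]) f x).
Implicit Types (f g : R -> R) (a b c : R).

(** Almost everywhere differentiation of an integral with base point 0 gives information only at
    points x > 0; periodicity carries it to the whole line. *)
Lemma ae_pos_all (P : R -> Prop) : (forall x, P (x + 1) <-> P x) ->
  {ae mu, forall x, 0 < x -> P x} -> {ae mu, forall x, P x}.
Proof.
move=> hP h.
have hPn (n : nat) x : P (x + n%:R) <-> P x.
  elim: n x => [|n IH] x; first by rewrite addr0.
  by rewrite -natr1 addrA hP.
have h1 : {ae mu, forall x, forall n : nat, 0 < x + n%:R -> P (x + n%:R)}.
  by apply: ae_foralln => n; exact: (ae_shift n%:R h).
apply: (@filterS _ _ (ae_filter_ringOfSetsType mu) _ _ _ h1) => x hx.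
pose n := (Num.truncn `|x|).+1.
have /andP[_ xn] := Num.Theory.truncn_itv (normr_ge0 x).
apply/(hPn n); apply: hx; rewrite -ltrBlDr sub0r ltrNl.
by apply: le_lt_trans xn; rewrite -normrN ler_norm.
Qed.

Lemma ae_cont_eq f g : continuous f -> continuous g -> f = g %[ae mu] -> f = g.
Proof.
move=> cf cg fg; apply/funext => x; apply/eqP/negPn/negP => ne.
have cfg : {for x, continuous (fun y => `|f y - g y|)}.
  by apply: cvg_norm; apply: cvgB; [exact: cf|exact: cg].
have : 0 < `|f x - g x| by rewrite normr_gt0 subr_eq0.
case/(cont_pos cfg) => d d0 hd.
case: fg => N [mN N0 sN].
have sub : `[x, x + d / 2]%classic `<=` N.
  move=> y /=; rewrite in_itv/= => /andP[y1 y2]; apply: sN => /= h.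
  have yd : `|y - x| < d by rewrite ger0_norm ?subr_ge0//; lra.
  by have := hd y yd; rewrite h// subrr normr0 ltxx.
have mI : measurable (`[x, x + d / 2]%classic : set (measurableTypeR R)) by exact: measurable_itv.
pose J := `[x, x + d / 2]%classic : set (measurableTypeR R).
have : (mu J <= mu N)%E by apply: le_measure; rewrite ?inE.
rewrite [X in (_ <= X)%E -> _]N0.
have -> : mu J = (d / 2)%:E.
  have := @lebesgue_measure_itv R `[x, x + d / 2]%R.
  rewrite /= lte_fin ltrDl divr_gt0// => ->; rewrite -EFinD; congr EFin; ring.
by rewrite lee_fin leNgt divr_gt0.
Qed.

(** The primitive of f is nondecreasing and takes the value 0 at both ends of [0, 1], so it vanishes
    there, and so does its derivative in the interior; continuity gives the end points. *)
Lemma cont_I_eq0 f : continuous f -> (forall x, 0 <= f x) -> I f = 0 ->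
  forall x, 0 <= x <= 1 -> f x = 0.
Proof.
move=> cf f0 If.
have hP := prim_deriv cf.
have mono a b : a <= b -> prim f a <= prim f b.
  by move=> ab; apply: (@deriv_ge0_le R (prim f) f a b ab (fun x _ => hP x)).
have P0 x : 0 <= x <= 1 -> prim f x = 0.
  move=> /andP[x0 x1]; apply/eqP; rewrite eq_le.
  have := mono _ _ x0; have := mono _ _ x1; rewrite prim0 prim1 If => -> ->//.
have op x : 0 < x < 1 -> f x = 0.
  move=> hx; apply: (@deriv_interior_max R (prim f) f 0 1 x) => //.
  move=> y /andP[y0 y1]; case/andP: hx => x0 x1.
  by rewrite !P0 ?(ltW y0) ?(ltW y1) ?(ltW x0) ?(ltW x1).
have c0 : continuous (fun _ : R => 0 : R) by move=> y; exact: cvg_cst.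
move=> x /andP[]; rewrite le_eqVlt => /orP[/eqP <- _|x0].
  apply: (@cont_eq_right R f (fun=> 0) 0 1 ltr01 (cf 0) (c0 0)) => y.
  by rewrite add0r; exact: op.
rewrite le_eqVlt => /orP[/eqP ->|x1]; last by apply: op; rewrite x0.
apply: (@cont_eq_left R f (fun=> 0) 1 1 ltr01 (cf 1) (c0 1)) => y.
by rewrite subrr; exact: op.
Qed.

(** Lebesgue's differentiation theorem: f is almost everywhere the derivative of its primitive. *)
Lemma prim_eq0_ae f : periodic f 1 -> locint f -> (forall x, prim f x = 0) ->
  f = cst 0 %[ae mu].
Proof.
move=> pf [mf hf] P0.
have lf : locally_integrable [set: R] f.
  split => //; first exact: openT.
  move=> K _ cK; have [M [_ hM]] := compact_bounded cK.
  pose m := `|M| + 1.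
  have sub : K `<=` `[- m, m].
    move=> x Kx /=; rewrite in_itv/= -ler_norml; apply: hM => //.
    by rewrite /m; apply: le_lt_trans (ler_norm _) _; rewrite ltrDl.
  have /integrableP[_ h] := integrable_norm (hf (- m) m).
  apply: le_lt_trans h; under [leRHS]eq_integral do rewrite /= normr_id.
  apply: ge0_subset_integral => //.
  - by apply: closed_measurable; apply: compact_closed => //; exact: Rhausdorff.
  - by apply/measurable_EFinP; apply: measurableT_comp => //; exact: measurable_funTS.
have h := FTC1 (fun y => hf 0 y) lf.
apply: (@ae_pos_all (fun x => True -> f x = 0)); first by move=> x; rewrite pf.
apply: (@filterS _ _ (ae_filter_ringOfSetsType mu) _ _ _ h) => x hx x0 _.
have [|d <-] := hx; first by rewrite (@lte_fin R).
suff h0 : is_derive x 1 (fun y : R => \int[mu]_(t in `[0, y]) f t) 0.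
  by rewrite derive1E; case: h0.
apply: near_eq_is_derive (deriv_cst 0 x).
near=> y; have := P0 y; rewrite /prim ltW => [->//|].
by near: y; exact: lt_nbhsr.
Unshelve. all: by end_near. Qed.

Lemma prim_ae_eq0 f c : periodic f 1 -> locint f -> (fun x => c + prim f x) = cst 0 %[ae mu] ->
  f = cst 0 %[ae mu].
Proof.
move=> pf lf h; apply: prim_eq0_ae => // x.
have cP := prim_continuous lf.
have e : (fun x => c + prim f x) = cst 0.
  by apply: ae_cont_eq => //; [move=> y; apply: cvgD; [exact: cvg_cst|exact: cP]|move=> y; exact: cvg_cst].
have e0 : c + prim f 0 = 0 := congr1 (fun h => h 0) e.
have ex : c + prim f x = 0 := congr1 (fun h => h x) e.
by move: e0 ex; rewrite prim0; lra.
Qed.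

Lemma has_deriv_test f f1 : has_deriv f f1 -> continuous f1 -> periodic f 1 ->
  test_function f.
Proof.
move=> hf cf1 pf; split => //; first by move=> x; case: (hf x).
by rewrite (_ : (derive1 f) = f1)//; apply/funext => x; rewrite derive1E; case: (hf x).
Qed.

Lemma has_deriv1E f f1 : has_deriv f f1 -> (derive1 f) = f1.
Proof. by move=> hf; apply/funext => x; rewrite derive1E; case: (hf x). Qed.

Lemma test_has_deriv f : test_function f -> has_deriv f (derive1 f).
Proof. by move=> [_ df _] x; rewrite derive1E; exact: derivableP. Qed.

Lemma test_bounded f : test_function f -> exists2 M,
  (forall x, `|f x| <= M) & (forall x, `|(derive1 f) x| <= M).
Proof.
move=> tf; have hf := test_has_deriv tf; have [pf _ cf1] := tf.
have [M1 _ h1] := periodic_cont_bounded ltr01 pf (has_deriv_cont hf).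
have [M2 _ h2] := periodic_cont_bounded ltr01 (periodic_deriv hf pf) cf1.
by exists (Num.max M1 M2) => x; rewrite le_max ?h1 ?h2 ?orbT.
Qed.

(* If int k phi' = 0 for all test functions phi and int k = 0, then            *)
(* K = prim k is periodic and taking phi'' = K - int K gives                   *)
(* int (K - int K)^2 = 0.                                                      *)
Lemma weak_constant k : periodic k 1 -> locint k -> I k = 0 ->
  (forall phi, test_function phi -> I (fun x => k x * (derive1 phi) x) = 0) ->
  k = cst 0 %[ae mu].
Proof.
move=> pk lk Ik hk; apply: prim_eq0_ae => //.
have pK := prim_periodic pk lk Ik; have cK := prim_continuous lk.
pose m := I (prim k); pose L x := prim k x - m.
have cL : continuous L by move=> x; apply: cvgB; [exact: cK|exact: cvg_cst].
have lL := locint_cont cL.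
have pL : periodic L 1 by move=> x; rewrite /L pK.
have IL : I L = 0.
  by rewrite /L I_B ?I_cst ?subrr//; [exact: locint_cont|exact: locint_cst].
(* Removing the means m and n makes L and psi functions of mean 0, hence makes their primitives
   periodic; so prim psi is an admissible test function. *)
pose n := I (prim L); pose psi x := prim L x - n.
have hpsi : has_deriv psi L.
  by move=> x; apply: deriv_val (deriv_sub (prim_deriv cL x) (deriv_cst n x)) _; rewrite subr0.
have cpsi := has_deriv_cont hpsi.
have ppsi : periodic psi 1 by move=> x; rewrite /psi prim_periodic.
have Ipsi : I psi = 0.
  rewrite /psi I_B ?I_cst ?subrr//; last exact: locint_cst.
  exact: locint_cont (prim_continuous lL).
have hphi := prim_deriv cpsi.
have pphi : periodic (prim psi) 1 := prim_periodic ppsi (locint_cont cpsi) Ipsi.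
have := hk _ (has_deriv_test hphi cpsi pphi); rewrite (has_deriv1E hphi) => kpsi.
have [M1 _ h1] := periodic_cont_bounded ltr01 ppsi cpsi.
have [M2 _ h2] := periodic_cont_bounded ltr01 pL cL.
have e : I (fun x => prim k x * L x) = 0.
  apply: etrans (@prim_parts R k psi L (Num.max M1 M2) lk hpsi cL _ _) _.
  - by move=> x; rewrite le_max h1.
  - by move=> x; rewrite le_max h2 orbT.
  - by rewrite prim1 Ik mul0r sub0r; apply/eqP; rewrite oppr_eq0; apply/eqP; exact: kpsi.
have cL2 : continuous (fun x => L x ^+ 2).
  under eq_fun do rewrite expr2.
  by move=> x; apply: cvgM; exact: cL.
have IL2 : I (fun x => L x ^+ 2) = 0.
  have -> : I (fun x => L x ^+ 2) = I (fun x => prim k x * L x - m * L x).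
    by apply: I_ext => x; rewrite /L; ring.
  rewrite I_B ?I_Z// ?e ?IL ?mulr0 ?subr0//; last exact: locintZ.
  by apply: locint_cont => x; apply: cvgM; [exact: cK|exact: cL].
have L0 := cont_I_eq0 cL2 (fun x => sqr_ge0 _) IL2.
have L0' x : 0 <= x <= 1 -> prim k x = m.
  move=> hx; have := L0 x hx; move/eqP; rewrite sqrf_eq0 /L subr_eq0 => /eqP//.
have m0 : m = 0 by rewrite -(L0' 0) ?prim0// lexx ler01.
move=> x; have [j /andP[j1 j2]] := shift_reduce 0 x (ltr01 (R := R)).
rewrite -(shift_periodic pK j) L0' ?m0// j1 ltW//.
by move: j2; rewrite add0r.
Qed.

(** Testing against the constant 1 shows that g has mean 0, so prim g is periodic. Then f - prim g
    has weak derivative 0, and c is its mean, which makes [weak_constant] applicable to the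
    difference. *)
Lemma du_bois_reymond f g : periodic f 1 -> locint f -> periodic g 1 -> locint g ->
  weak_derivative f g -> I g = 0 /\ exists c, f = (fun x => c + prim g x) %[ae mu].
Proof.
move=> pf lf pg lg wfg.
have t1 : test_function (fun=> 1 : R).
  apply: (@has_deriv_test _ (fun=> 0)) => //; first by move=> x; exact: deriv_cst.
  by move=> x; exact: cvg_cst.
have Ig : I g = 0.
  have := wfg _ t1; rewrite (has_deriv1E (fun x => deriv_cst 1 x)).
  have -> : I (fun x => f x * 0) = 0.
    by rewrite -[RHS]I_cst; apply: I_ext => x; rewrite mulr0.
  have -> : I (fun x => g x * 1) = I g by apply: I_ext => x; rewrite mulr1.
  by move/eqP; rewrite eq_sym oppr_eq0 => /eqP.
split => //; pose c := I f - I (prim g); exists c.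
have lP := locint_cont (prim_continuous lg).
have lc := locint_cst c.
have lk : locint (fun x => f x - (c + prim g x)) by apply: locintB => //; exact: locintD.
have : (fun x => f x - (c + prim g x)) = cst 0 %[ae mu].
  apply: weak_constant => //.
  - by move=> x; rewrite pf prim_periodic.
  - by rewrite (I_B lf (locintD lc lP)) (I_D lc lP) I_cst /c; ring.
  move=> phi tphi; have hphi := test_has_deriv tphi; have [pphi _ cphi1] := tphi.
  have [M h1 h2] := test_bounded tphi.
  have mphi1 := continuous_measurable_fun cphi1.
  have e1 := prim_parts lg hphi cphi1 h1 h2.
  have e2 := wfg _ tphi.
  rewrite prim1 Ig mul0r sub0r in e1.
  have e3 : I (derive1 phi) = 0.
    by rewrite (I_deriv hphi cphi1) -{1}[1]add0r pphi subrr.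
  transitivity (I (fun x => f x * (derive1 phi) x - (c * (derive1 phi) x + prim g x * (derive1 phi) x))).
    by apply: I_ext => x; ring.
  have l1 := locint_cont cphi1.
  have l2 := locintZ c l1.
  have l3 := locintM lP mphi1 h2.
  have l4 := locintM lf mphi1 h2.
  by rewrite (I_B l4 (locintD l2 l3)) (I_D l2 l3) (I_Z _ l1) e1 e2 e3; ring.
apply: (@filterS _ _ (ae_filter_ringOfSetsType mu)) => x /= h _.
by apply/eqP; rewrite -subr_eq0; apply/eqP; exact: h.
Qed.

End du_bois_reymond.

(** * Square-integrable functions and Sobolev spaces *)

Section L2_theory.
Variable R : realType.
Local Notation mu := (@lebesgue_measure R).
Local Notation I f := (\int[mu]_(x in `[0%R, 1%R]) f x).
Implicit Types (f g : R -> R) (a b c : R).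

Lemma ae_lift2 (h : R -> R -> R -> R) f f' g g' : f = f' %[ae mu] -> g = g' %[ae mu] ->
  (fun x => h x (f x) (g x)) = (fun x => h x (f' x) (g' x)) %[ae mu].
Proof.
move=> hf hg; apply: (@filterS2 _ _ (ae_filter_ringOfSetsType mu) _ _ _ _ hf hg).
by move=> x /= h1 h2 _; rewrite h1// h2.
Qed.

Lemma ae_lift1 (h : R -> R -> R) f f' : f = f' %[ae mu] ->
  (fun x => h x (f x)) = (fun x => h x (f' x)) %[ae mu].
Proof. by move=> hf; exact: (ae_lift2 (fun x y _ => h x y) hf hf). Qed.

Lemma L2_locint_le f g : L2 f -> periodic g 1 -> measurable_fun [set: R] g ->
  (forall x, `|g x| <= 1 + f x ^+ 2) -> locint g.
Proof.
move=> [pf mf hf] pg mg gf; apply: locint_periodic => //.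
have h1 : mu.-integrable `[0, 1] (EFin \o (fun=> 1 : R)) by have [_] := locint_cst (1 : R); exact.
apply: (le_integrable _ _ _ (integrableD _ h1 hf)) => //.
  by apply/measurable_EFinP; exact: measurable_funTS.
move=> x _ /=; rewrite lee_fin [leRHS]ger0_norm//.
by rewrite addr_ge0// sqr_ge0.
Qed.

Lemma L2_sqr f : L2 f -> locint (fun x => f x ^+ 2).
Proof.
move=> lf; have [pf mf _] := lf; apply: (L2_locint_le lf).
- by move=> x; rewrite pf.
- exact: measurable_funX.
- by move=> x; rewrite ger0_norm ?sqr_ge0// lerDr.
Qed.

Lemma L2_locint f : L2 f -> locint f.
Proof.
move=> lf; have [pf mf _] := lf; apply: (L2_locint_le lf) => // x.
rewrite -(real_normK (num_real (f x))).
have := sqr_ge0 (`|f x| - 1); rewrite sqrrB1; have := sqr_ge0 `|f x|; lra.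
Qed.

Lemma L2P f : periodic f 1 -> measurable_fun [set: R] f ->
  locint (fun x => f x ^+ 2) -> L2 f.
Proof. by move=> pf mf [_ h]; split => //; exact: h. Qed.

Lemma locint_le f g : locint f -> measurable_fun [set: R] g ->
  (forall x, `|g x| <= f x) -> locint g.
Proof.
move=> [mf hf] mg gf; split => // a b.
apply: (le_integrable _ _ _ (hf a b)) => //.
  by apply/measurable_EFinP; exact: measurable_funTS.
by move=> x _ /=; rewrite lee_fin; apply: le_trans (gf x) (ler_norm _).
Qed.

Lemma L2_mul f g : L2 f -> L2 g -> locint (fun x => f x * g x).
Proof.
move=> lf lg; apply: (locint_le (locintD (L2_sqr lf) (L2_sqr lg))).
  by apply: measurable_funM; [case: lf|case: lg].
move=> x; rewrite normrM -[f x ^+ 2]real_normK ?num_real// -[g x ^+ 2]real_normK ?num_real//.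
have := sqr_ge0 (`|f x| - `|g x|); rewrite sqrrB; have := sqr_ge0 `|f x|; have := sqr_ge0 `|g x|; lra.
Qed.

Lemma L2_cont f : periodic f 1 -> continuous f -> L2 f.
Proof.
move=> pf cf; apply: L2P => //; first exact: continuous_measurable_fun.
apply: locint_cont; under eq_fun do rewrite expr2.
by move=> x; apply: cvgM; exact: cf.
Qed.

Lemma L2_add f g : L2 f -> L2 g -> L2 (fun x => f x + g x).
Proof.
move=> lf lg; have [pf mf _] := lf; have [pg mg _] := lg; apply: L2P.
- by move=> x; rewrite pf pg.
- exact: measurable_funD.
- have := locintD (locintD (L2_sqr lf) (L2_sqr lg)) (locintZ 2 (L2_mul lf lg)).
  by congr locint; apply/funext => x; ring.
Qed.

Lemma L2_scale c f : L2 f -> L2 (fun x => c * f x).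
Proof.
move=> lf; have [pf mf _] := lf; apply: L2P.
- by move=> x; rewrite pf.
- by apply: measurable_funM => //; exact: measurable_cst.
- have := locintZ (c ^+ 2) (L2_sqr lf).
  by congr locint; apply/funext => x; ring.
Qed.

Lemma L2_opp f : L2 f -> L2 (fun x => - f x).
Proof. by move=> /(L2_scale (-1)); congr L2; apply/funext => x; ring. Qed.

Lemma L2_sub f g : L2 f -> L2 g -> L2 (fun x => f x - g x).
Proof. by move=> lf lg; apply: L2_add => //; exact: L2_opp. Qed.

Lemma L2_bmul f g (M : R) : L2 f -> periodic g 1 -> measurable_fun [set: R] g ->
  (forall x, `|g x| <= M) -> L2 (fun x => g x * f x).
Proof.
move=> lf pg mg hM; have [pf mf _] := lf; apply: L2P.
- by move=> x; rewrite pf pg.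
- exact: measurable_funM.
- have : locint (fun x => f x ^+ 2 * g x ^+ 2).
    apply: (locintM (M := M ^+ 2) (L2_sqr lf)); first exact: measurable_funX.
    by move=> x; rewrite normrX lerXn2r ?nnegrE// (le_trans _ (hM 0)).
  by congr locint; apply/funext => x; ring.
Qed.

Lemma locint_ae f g : locint f -> measurable_fun [set: R] g -> f = g %[ae mu] -> locint g.
Proof.
move=> [mf hf] mg fg; split => // a b; have /integrableP[_ h] := hf a b.
apply/integrableP; split; first by apply/measurable_EFinP; exact: measurable_funTS.
apply: le_lt_trans h; rewrite le_eqVlt; apply/orP; left; apply/eqP.
apply: ae_eq_integral => //.
- by apply/measurable_EFinP; apply: measurableT_comp => //; exact: measurable_funTS.
- by apply/measurable_EFinP; apply: measurableT_comp => //; exact: measurable_funTS.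
- have h := ae_eq_comp (fun y : R => (`|y%:E|)%E) (ae_eq_sym fg).
  exact: ae_eq_subset (@subsetT _ _) h.
Qed.

Lemma L2_ae f g : L2 f -> periodic g 1 -> measurable_fun [set: R] g -> f = g %[ae mu] -> L2 g.
Proof.
move=> lf pg mg fg; apply: L2P => //; apply: (locint_ae (L2_sqr lf)).
  exact: measurable_funX.
exact: (ae_lift1 (fun _ y => y ^+ 2) fg).
Qed.

Lemma L2norm_ge0 f : 0 <= L2norm f.
Proof. exact: sqrtr_ge0. Qed.

Lemma L2norm_sqr f : L2norm f ^+ 2 = I (fun x => f x ^+ 2).
Proof. by rewrite sqr_sqrtr// I_ge0// => x; exact: sqr_ge0. Qed.

Lemma L2_CS f g : L2 f -> L2 g -> `|I (fun x => f x * g x)| <= L2norm f * L2norm g.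
Proof.
move=> lf lg; have lfg := L2_mul lf lg.
rewrite -(@ler_pXn2r _ 2) ?nnegrE ?mulr_ge0 ?L2norm_ge0 ?normr_ge0//.
rewrite exprMn !L2norm_sqr real_normK ?num_real//.
set A := I (fun x => f x ^+ 2); set C := I (fun x => g x ^+ 2).
set B := I (fun x => f x * g x).
(* The integral of (f + t g)^2; for C > 0 the minimizing t = - B / C gives the inequality. *)
have quad t : 0 <= A + 2 * t * B + t ^+ 2 * C.
  have : 0 <= I (fun x => (f x + t * g x) ^+ 2) by apply: I_ge0 => x; exact: sqr_ge0.
  have -> : I (fun x => (f x + t * g x) ^+ 2) =
      I (fun x => f x ^+ 2 + 2 * t * (f x * g x) + t ^+ 2 * g x ^+ 2).
    by apply: I_ext => x; ring.
  have lA := L2_sqr lf; have lC := L2_sqr lg.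
  by rewrite (I_D (locintD lA (locintZ _ lfg)) (locintZ _ lC)) (I_D lA (locintZ _ lfg)) !I_Z.
have C0 : 0 <= C by apply: I_ge0 => x; exact: sqr_ge0.
clearbody A B C.
move: C0; rewrite le_eqVlt => /orP[/eqP C0|C0].
  suff -> : B = 0 by rewrite expr0n/= -C0 mulr0.
  apply/eqP/negPn/negP => B0.
  (* For C = 0 the polynomial is affine in t, and with B nonzero this t gives it the value -1. *)
  have := quad (- (A + 1) / (2 * B)); rewrite -C0 mulr0 addr0.
  by rewrite (_ : 2 * _ * B = - (A + 1)); [lra|field].
have := quad (- B / C).
rewrite (_ : _ + _ = (A * C - B ^+ 2) / C); last by field; rewrite gt_eqF.
by rewrite pmulr_lge0 ?invr_gt0// subr_ge0.
Qed.

Lemma L2norm_ae f g : measurable_fun [set: R] f -> measurable_fun [set: R] g ->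
  f = g %[ae mu] -> L2norm f = L2norm g.
Proof.
move=> mf mg fg; rewrite /L2norm; congr Num.sqrt; apply: I_ae.
- exact: measurable_funX.
- exact: measurable_funX.
- exact: (ae_lift1 (fun _ y => y ^+ 2) fg).
Qed.

Lemma L2norm_triangle f g : L2 f -> L2 g ->
  L2norm (fun x => f x + g x) <= L2norm f + L2norm g.
Proof.
move=> lf lg; have lfg := L2_mul lf lg.
have lA := L2_sqr lf; have lC := L2_sqr lg.
rewrite -(@ler_pXn2r _ 2) ?nnegrE ?addr_ge0 ?L2norm_ge0//.
rewrite sqrrD !L2norm_sqr.
have -> : I (fun x => (f x + g x) ^+ 2) =
    I (fun x => f x ^+ 2 + 2 * (f x * g x) + g x ^+ 2).
  by apply: I_ext => x; ring.
rewrite (I_D (locintD lA (locintZ _ lfg)) lC) (I_D lA (locintZ _ lfg)) I_Z//.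
rewrite lerD2r lerD2l -[leRHS]mulr_natl ler_wpM2l//.
exact: le_trans (ler_norm _) (L2_CS lf lg).
Qed.

Lemma L2norm_scale c f : L2 f -> L2norm (fun x => c * f x) = `|c| * L2norm f.
Proof.
move=> lf; rewrite /L2norm -[`|c|]sqrtr_sqr -sqrtrM ?sqr_ge0//; congr Num.sqrt.
rewrite -I_Z; last exact: L2_sqr.
by apply: I_ext => x; ring.
Qed.

Lemma L2norm_eq0 f : L2 f -> L2norm f = 0 -> f = cst 0 %[ae mu].
Proof.
move=> lf f0; have [pf mf _] := lf.
have If : I (fun x => f x ^+ 2) = 0 by rewrite -L2norm_sqr f0 expr0n.
have [_ h] := L2_sqr lf.
have m2 : measurable_fun [set: R] (fun x => f x ^+ 2) by exact: measurable_funX.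
have : (\int[mu]_(x in `[0%R, 1%R]) `|(f x ^+ 2)%:E| = 0)%E.
  under eq_integral do rewrite /= ger0_norm ?sqr_ge0//.
  by rewrite -[RHS](congr1 EFin If) /Rintegral fineK//; apply: integrable_fin_num.
move/(ae_eq_integral_abs mu (measurable_itv _)) => H.
have {}H : ae_eq mu `[0, 1] (fun x => (f x ^+ 2)%:E) (cst 0%E).
  by apply: H; apply/measurable_EFinP; exact: measurable_funTS.
apply: (@ae_periodic_all _ (fun x => True -> f x = 0)); first by move=> x; rewrite pf.
apply: (@filterS _ _ (ae_filter_ringOfSetsType mu) _ _ _ H) => x hx x01 _.
have := hx; rewrite /= in_itv/= => /(_ x01) [] /eqP; rewrite sqrf_eq0 => /eqP//.
Qed.

Lemma L2_cst c : L2 (fun=> c : R).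
Proof. by apply: L2_cont => // x; exact: cvg_cst. Qed.

Lemma L2norm_cst c : L2norm (fun=> c : R) = `|c|.
Proof. by rewrite /L2norm I_cst sqrtr_sqr. Qed.

Lemma L2norm_cst0 f : L2 f -> f = cst 0 %[ae mu] -> L2norm f = 0.
Proof.
move=> [_ mf _] h; rewrite (L2norm_ae mf _ h)//.
by have := L2norm_cst 0; rewrite normr0.
Qed.

Lemma I_abs_le f : L2 f -> I (fun x => `|f x|) <= L2norm f.
Proof.
move=> lf; have [pf mf _] := lf.
have lnf : L2 (fun x => `|f x|).
  apply: L2P; first by move=> x; rewrite pf.
    exact: measurableT_comp.
  by have := L2_sqr lf; congr locint; apply/funext => x; rewrite real_normK ?num_real.
have := L2_CS lnf (L2_cst 1); rewrite L2norm_cst normr1 mulr1 => h.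
apply: le_trans (ler_norm _) _.
have -> : L2norm f = L2norm (fun x => `|f x|).
  by rewrite /L2norm; congr Num.sqrt; apply: I_ext => x; rewrite real_normK ?num_real.
by apply: le_trans h; rewrite le_eqVlt; apply/orP; left; apply/eqP; congr `|_|;
  apply: I_ext => x; rewrite mulr1.
Qed.

End L2_theory.

(** * Weak derivatives and the embedding of H^1 into continuous functions *)

Section sobolev_theory.
Variable R : realType.
Local Notation mu := (@lebesgue_measure R).
Local Notation I f := (\int[mu]_(x in `[0%R, 1%R]) f x).
Implicit Types (f g v w : R -> R) (a b c : R).

Lemma test_L2 phi : @test_function R phi -> L2 phi /\ L2 (derive1 phi).
Proof.
move=> tphi; have [pphi _ cphi1] := tphi; have hphi := test_has_deriv tphi.
split; first exact: L2_cont (has_deriv_cont hphi).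
by apply: L2_cont => //; exact: periodic_deriv hphi pphi.
Qed.

Lemma weak_derivative_ae f f' g g' : L2 f -> L2 f' -> L2 g -> L2 g' ->
  f = f' %[ae mu] -> g = g' %[ae mu] -> weak_derivative f g -> weak_derivative f' g'.
Proof.
move=> lf lf' lg lg' ff gg h phi tphi.
have [[_ m0 _] [_ m1 _]] := test_L2 tphi.
have [[_ mf _] [_ mf' _] [_ mg _] [_ mg' _]] := And4 lf lf' lg lg'.
have e1 : I (fun x => f x * derive1 phi x) = I (fun x => f' x * derive1 phi x).
  apply: I_ae; [exact: measurable_funM|exact: measurable_funM|].
  exact: (ae_lift1 (fun x y => y * derive1 phi x) ff).
have e2 : I (fun x => g x * phi x) = I (fun x => g' x * phi x).
  apply: I_ae; [exact: measurable_funM|exact: measurable_funM|].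
  exact: (ae_lift1 (fun x y => y * phi x) gg).
by rewrite -e1 -e2; exact: h.
Qed.

Lemma weak_derivative_lin c f g f' g' : L2 f -> L2 f' -> L2 g -> L2 g' ->
  weak_derivative f f' -> weak_derivative g g' ->
  weak_derivative (fun x => c * f x + g x) (fun x => c * f' x + g' x).
Proof.
move=> lf lf' lg lg' hf hg phi tphi; have [l0 l1] := test_L2 tphi.
have -> : I (fun x => (c * f x + g x) * derive1 phi x) =
    I (fun x => c * (f x * derive1 phi x) + g x * derive1 phi x).
  by apply: I_ext => x; ring.
have -> : I (fun x => (c * f' x + g' x) * phi x) =
    I (fun x => c * (f' x * phi x) + g' x * phi x).
  by apply: I_ext => x; ring.
rewrite (I_D (locintZ c (L2_mul lf l1)) (L2_mul lg l1)).
rewrite (I_D (locintZ c (L2_mul lf' l0)) (L2_mul lg' l0)).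
rewrite (I_Z c (L2_mul lf l1)) (I_Z c (L2_mul lf' l0)) hf// hg//; ring.
Qed.

(** By linearity g - g' is a weak derivative of the zero function, which is thus almost everywhere a
    constant plus the primitive of g - g'. *)
Lemma weak_derivative_unique f g g' : L2 f -> L2 g -> L2 g' ->
  weak_derivative f g -> weak_derivative f g' -> g = g' %[ae mu].
Proof.
move=> lf lg lg' hg hg'.
have h := weak_derivative_lin (-1) lf lg' lf lg hg' hg.
have lk : L2 (fun x => -1 * g' x + g x) by apply: L2_add => //; exact: L2_scale.
have l0 : L2 (fun x => -1 * f x + f x) by apply: L2_add => //; exact: L2_scale.
have [pk _ _] := lk; have [p0 _ _] := l0.
have [_ [c hc]] := du_bois_reymond p0 (L2_locint l0) pk (L2_locint lk) h.
have : (fun x => -1 * g' x + g x) = cst 0 %[ae mu].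
  apply: (@prim_ae_eq0 _ _ c pk (L2_locint lk)).
  apply: (@filterS _ _ (ae_filter_ringOfSetsType mu) _ _ _ hc) => x /= e _.
  by rewrite -e//; ring.
apply: (@filterS _ _ (ae_filter_ringOfSetsType mu)) => x /= e _.
by have := e Logic.I; lra.
Qed.

Lemma wderivP f g : L2 g -> weak_derivative f g ->
  L2 (wderiv f) /\ weak_derivative f (wderiv f).
Proof.
move=> lg wg; rewrite /wderiv; case: xgetP => [h _ [? ?]//|].
by move/(_ g) => /(_ (conj lg wg)).
Qed.

Lemma wderiv_eq_ae f g : L2 f -> L2 g -> weak_derivative f g -> wderiv f = g %[ae mu].
Proof.
move=> lf lg wg; have [l w] := wderivP lg wg; exact: weak_derivative_unique l lg w wg.
Qed.

(** The set from which [wderiv] chooses depends only on the class of f. The conclusion is therefore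
    an equality of functions, which permits rewriting inside a second [wderiv]. *)
Lemma wderiv_congr f f' : L2 f -> L2 f' -> f = f' %[ae mu] -> wderiv f = wderiv f'.
Proof.
move=> lf lf' ff; rewrite /wderiv; congr xget; apply/funext => g; apply/propext; split.
  move=> [lg wg]; split => //.
  exact: (weak_derivative_ae lf lf' lg lg ff (ae_eq_refl _ _ _) wg).
move=> [lg wg]; split => //.
exact: (weak_derivative_ae lf' lf lg lg (ae_eq_sym ff) (ae_eq_refl _ _ _) wg).
Qed.

Lemma has_deriv_weak f f1 : has_deriv f f1 -> continuous f1 -> periodic f 1 ->
  weak_derivative f f1.
Proof.
move=> hf cf1 pf phi tphi; have [pphi _ cphi1] := tphi; have hphi := test_has_deriv tphi.
rewrite (deriv_mul_cont hf hphi cf1 cphi1).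
by rewrite -{1 2}[1]add0r pf pphi subrr sub0r.
Qed.

Lemma sobolev1P f : sobolev 1 f ->
  [/\ L2 f, L2 (wderiv f) & weak_derivative f (wderiv f)].
Proof. by move=> [lf [g [lg wg]]]; have [? ?] := wderivP lg wg. Qed.

Lemma sobolev1I f g : L2 f -> L2 g -> weak_derivative f g -> sobolev 1 f.
Proof. by move=> lf lg w; split => //; exists g. Qed.

Lemma sobolev2P f : sobolev 2 f -> sobolev 1 f /\ sobolev 1 (wderiv f).
Proof.
move=> [lf [g [[lg [h [lh wgh]]] wfg]]]; split; first exact: sobolev1I wfg.
have [l w] := wderivP lg wfg.
apply: (@sobolev1I _ h) => //.
have e : g = wderiv f %[ae mu] by exact: weak_derivative_unique wfg w.
exact: (weak_derivative_ae lg l lh lh e (ae_eq_refl _ _ _) wgh).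
Qed.

Lemma sobolev2I f : sobolev 1 f -> sobolev 1 (wderiv f) -> sobolev 2 f.
Proof. by move=> hf h; have [lf l w] := sobolev1P hf; split => //; exists (wderiv f). Qed.

Lemma sobolev1_lin c v w : sobolev 1 v -> sobolev 1 w ->
  sobolev 1 (fun x => c * v x + w x) /\
  wderiv (fun x => c * v x + w x) = (fun x => c * wderiv v x + wderiv w x) %[ae mu].
Proof.
move=> /sobolev1P[lv lv' wv] /sobolev1P[lw lw' ww].
have h := weak_derivative_lin c lv lv' lw lw' wv ww.
have l : L2 (fun x => c * v x + w x) by apply: L2_add => //; exact: L2_scale.
have l' : L2 (fun x => c * wderiv v x + wderiv w x) by apply: L2_add => //; exact: L2_scale.
by split; [exact: sobolev1I h|exact: wderiv_eq_ae].
Qed.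

Lemma sobolev2_lin c v w : sobolev 2 v -> sobolev 2 w ->
  sobolev 2 (fun x => c * v x + w x) /\
  wderiv (wderiv (fun x => c * v x + w x)) =
    (fun x => c * wderiv (wderiv v) x + wderiv (wderiv w) x) %[ae mu].
Proof.
move=> /sobolev2P[sv sv'] /sobolev2P[sw sw'].
have [s1 e1] := sobolev1_lin c sv sw; have [s2 e2] := sobolev1_lin c sv' sw'.
have [_ l1 _] := sobolev1P s1; have [l2 _ _] := sobolev1P s2.
have e := wderiv_congr l1 l2 e1.
split; last by rewrite e.
apply: (sobolev2I s1); have [_ l3 w3] := sobolev1P s2.
apply: (sobolev1I l1 l3).
exact: (weak_derivative_ae l2 l1 l3 l3 (ae_eq_sym e1) (ae_eq_refl _ _ _) w3).
Qed.

Lemma sobolev_norm1 f : sobolev_norm 1 f = Num.sqrt (L2norm f ^+ 2 + L2norm (wderiv f) ^+ 2).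
Proof. by rewrite /sobolev_norm !big_ord_recr big_ord0 /= add0r. Qed.

Lemma sobolev_norm2 f : sobolev_norm 2 f =
  Num.sqrt (L2norm f ^+ 2 + L2norm (wderiv f) ^+ 2 + L2norm (wderiv (wderiv f)) ^+ 2).
Proof. by rewrite /sobolev_norm !big_ord_recr big_ord0 /= add0r. Qed.

Lemma sobolev_norm_ge0 k f : 0 <= sobolev_norm k f.
Proof. exact: sqrtr_ge0. Qed.

Lemma sobolev_norm12 f : sobolev_norm 1 f <= sobolev_norm 2 f.
Proof.
rewrite [leLHS]sobolev_norm1 [leRHS]sobolev_norm2; apply: ler_wsqrtr.
rewrite lerDl; exact: sqr_ge0.
Qed.

Lemma le_sqrt_sqr (x y : R) : 0 <= x -> x ^+ 2 <= y -> x <= Num.sqrt y.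
Proof. by move=> x0 xy; rewrite -(ger0_norm x0) -sqrtr_sqr ler_wsqrtr. Qed.

Lemma L2norm_le1 f : L2norm f <= sobolev_norm 1 f.
Proof.
rewrite [leRHS]sobolev_norm1; apply: le_sqrt_sqr; first exact: L2norm_ge0.
rewrite lerDl; exact: sqr_ge0.
Qed.

Lemma L2norm_wderiv_le1 f : L2norm (wderiv f) <= sobolev_norm 1 f.
Proof.
rewrite [leRHS]sobolev_norm1; apply: le_sqrt_sqr; first exact: L2norm_ge0.
rewrite lerDr; exact: sqr_ge0.
Qed.

Lemma L2norm_wderiv2_le2 f : L2norm (wderiv (wderiv f)) <= sobolev_norm 2 f.
Proof.
rewrite [leRHS]sobolev_norm2; apply: le_sqrt_sqr; first exact: L2norm_ge0.
rewrite lerDr addr_ge0 //; exact: sqr_ge0.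
Qed.

Lemma sobolev1_rep f : sobolev 1 f -> exists F : R -> R,
  [/\ continuous F, periodic F 1, f = F %[ae mu],
    (exists c, F = fun x => c + prim (wderiv f) x) &
    forall x, `|F x| <= 2 * sobolev_norm 1 f].
Proof.
move=> /sobolev1P[lf lg w]; have [pf _ _] := lf; have [pg mg _] := lg.
have [Ig [c e]] := du_bois_reymond pf (L2_locint lf) pg (L2_locint lg) w.
set g := wderiv f in lg w pg mg Ig e *.
have cP := prim_continuous (L2_locint lg).
have cF : continuous (fun x => c + prim g x).
  by move=> x; apply: cvgD; [exact: cvg_cst|exact: cP].
have pF : periodic (fun x => c + prim g x) 1.
  by move=> x; rewrite prim_periodic//; exact: L2_locint.
have lF := L2_cont pF cF.
exists (fun x => c + prim g x); split => //; first by exists c.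
have nF : L2norm (fun x => c + prim g x) = L2norm f.
  by apply/esym/L2norm_ae => //; [case: lf|case: lF].
have ng := I_abs_le lg.
have diff x y : 0 <= x <= 1 -> 0 <= y <= 1 -> `|prim g x - prim g y| <= L2norm g.
  move=> /andP[x0 x1] /andP[y0 y1]; have [xy|xy] := leP x y.
    by rewrite distrC; apply: le_trans ng; exact: prim_bound (L2_locint lg) x0 xy y1.
  by apply: le_trans ng; exact: prim_bound (L2_locint lg) y0 (ltW xy) x1.
have key x : 0 <= x <= 1 -> `|c + prim g x| <= L2norm f + L2norm g.
  move=> hx.
  have h1 : `|I (fun y => c + prim g y)| <= L2norm f.
    rewrite -nF; apply: le_trans (I_norm (L2_locint lF)) _; exact: I_abs_le.
  have h2 : `|I (fun y => (c + prim g x) - (c + prim g y))| <= L2norm g.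
    have lc := locint_cst (c + prim g x).
    apply: le_trans (I_norm (locintB lc (L2_locint lF))) _.
    rewrite -[leRHS]I_cst; apply: le_Rintegral => //.
    - by case: (locint_norm (locintB lc (L2_locint lF))).
    - by case: (locint_cst (L2norm g)).
    - move=> y; rewrite /= in_itv/= => hy.
      by rewrite opprD addrACA subrr add0r; exact: diff.
  have -> : c + prim g x = I (fun y => (c + prim g x) - (c + prim g y)) + I (fun y => c + prim g y).
    by rewrite (I_B (locint_cst _) (L2_locint lF)) I_cst subrK.
  apply: le_trans (ler_normD _ _) _; rewrite addrC; exact: lerD.
move=> x; have [n /andP[n1 n2]] := shift_reduce 0 x (ltr01 (R := R)).
rewrite -(shift_periodic pF n).
apply: le_trans (key _ _) _.
  by rewrite n1 ltW//; move: n2; rewrite add0r.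
by rewrite mulr_natl mulr2n lerD ?L2norm_le1 ?L2norm_wderiv_le1.
Qed.

End sobolev_theory.

Section continuity.
Variable R : realType.
Implicit Types f g : R -> R.

Lemma contD f g : continuous f -> continuous g -> continuous (fun x => f x + g x).
Proof. by move=> cf cg x; apply: cvgD; [exact: cf|exact: cg]. Qed.

Lemma contM f g : continuous f -> continuous g -> continuous (fun x => f x * g x).
Proof. by move=> cf cg x; apply: cvgM; [exact: cf|exact: cg]. Qed.

Lemma contC (c : R) : continuous (fun _ : R => c).
Proof. by move=> x; exact: cvg_cst. Qed.

Lemma contN f : continuous f -> continuous (fun x => - f x).
Proof. by move=> cf x; apply: cvgN; exact: cf. Qed.

Lemma contX f n : continuous f -> continuous (fun x => f x ^+ n).
Proof.
move=> cf; elim: n => [|n IH]; first exact: (@contC 1).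
by under eq_fun do rewrite exprS; exact: contM.
Qed.

Lemma contZ (c : R) f : continuous f -> continuous (fun x => c * f x).
Proof. by move=> cf; apply: contM => //; exact: contC. Qed.

End continuity.

(** * The kernel of the linearized operator *)

Section kernel.
Variables (R : realType) (r : R) (z z1 : R -> R).
Local Notation mu := (@lebesgue_measure R).
Local Notation I f := (\int[mu]_(x in `[0%R, 1%R]) f x).
Local Notation N := (I (fun x => z x ^+ 2)).
Local Notation D := (I (fun x => z1 x ^+ 2)).
Local Notation Q := (I (fun x => z x ^+ 4)).
Variables (a b : R).
Hypothesis r0 : 0 <= r.
Hypothesis (N0 : 0 < N) (Q0 : 0 < Q).
Hypothesis bE : b = 1 / N ^+ 3 - D / N - r / (2 * N * Q).
Hypothesis aE : a = r / (2 * Q ^+ 2).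
Hypothesis hz : has_deriv z z1.
Hypothesis hz1 : has_deriv z1 (fun x => - (b * z x + 2 * a * z x ^+ 3)).
Hypothesis pz : periodic z 1.

Let cz : continuous z := has_deriv_cont hz.
Let cz1 : continuous z1 := has_deriv_cont hz1.
Let pz1 : periodic z1 1 := periodic_deriv hz pz.
Let Nn : N != 0. Proof. by rewrite gt_eqF. Qed.
Let Qn : Q != 0. Proof. by rewrite gt_eqF. Qed.

Let a0 : 0 <= a.
Proof. by rewrite aE divr_ge0// mulr_ge0// sqr_ge0. Qed.

Lemma I_parts_periodic (f f1 g g1 : R -> R) : has_deriv f f1 -> has_deriv g g1 ->
  continuous f1 -> continuous g1 -> periodic f 1 -> periodic g 1 ->
  I (fun x => f x * g1 x) = - I (fun x => f1 x * g x).
Proof.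
move=> hf hg cf1 cg1 pf pg; rewrite (deriv_mul_cont hf hg cf1 cg1).
have e (h : R -> R) : periodic h 1 -> h 1 = h 0 by move=> ph; rewrite -[RHS]ph add0r.
by rewrite (e _ pf) (e _ pg) subrr sub0r.
Qed.

Let cz2 : continuous (fun x => - (b * z x + 2 * a * z x ^+ 3)).
Proof. by apply/contN/contD; apply: contZ => //; exact: contX. Qed.

(** The Duffing equation paired with z. *)
Lemma kinetic_identity : D = b * N + 2 * a * Q.
Proof.
have l2 : locint (fun x => z x ^+ 2) by apply/locint_cont/contX.
have l4 : locint (fun x => z x ^+ 4) by apply/locint_cont/contX.
have -> : D = I (fun x => z1 x * z1 x) by apply: I_ext => x; rewrite expr2.
rewrite -[LHS]opprK -(I_parts_periodic hz hz1)// -I_N; last exact/locint_cont/contM.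
rewrite -(I_Z b l2) -(I_Z (2 * a) l4) -(I_D (locintZ b l2) (locintZ _ l4)).
by apply: I_ext => x; ring.
Qed.

(** The left-hand side is conserved, so it equals its mean D + b N + a Q; by the formulas for a and
    b the terms with D and with r cancel. *)
Lemma energy x : z1 x ^+ 2 + b * z x ^+ 2 + a * z x ^+ 4 = 1 / N ^+ 2.
Proof.
pose e x := z1 x ^+ 2 + b * z x ^+ 2 + a * z x ^+ 4.
have he : has_deriv e (fun=> 0).
  move=> y; apply: deriv_val (deriv_add (deriv_add (deriv_pow 1 (hz1 y)) (deriv_scale b (deriv_pow 1 (hz y))))
    (deriv_scale a (deriv_pow 3 (hz y)))) _; ring.
have ec y : e y = e x by exact: deriv0_const he y x.
have l1 : locint (fun x => z1 x ^+ 2) by apply/locint_cont/contX.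
have l2 : locint (fun x => z x ^+ 2) by apply/locint_cont/contX.
have l4 : locint (fun x => z x ^+ 4) by apply/locint_cont/contX.
rewrite -/(e x) -[LHS]I_cst -(I_ext ec).
rewrite (I_D (locintD l1 (locintZ b l2)) (locintZ a l4)) (I_D l1 (locintZ b l2)) !I_Z//.
by rewrite bE aE; field; rewrite Nn Qn.
Qed.

Let E0 : 0 < 1 / N ^+ 2.
Proof. by rewrite divr_gt0// exprn_gt0. Qed.

Lemma linearized_energy_const (p q : R) v v1 : has_deriv v v1 ->
  has_deriv v1 (fun x => - ((b + 6 * a * z x ^+ 2) * v x) + p * z x + q * z x ^+ 3) ->
  forall x y, z1 x * v1 x + b * (z x * v x) + 2 * a * (z x ^+ 3 * v x)
    - (p / 2 * z x ^+ 2 + q / 4 * z x ^+ 4) =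
    z1 y * v1 y + b * (z y * v y) + 2 * a * (z y ^+ 3 * v y)
    - (p / 2 * z y ^+ 2 + q / 4 * z y ^+ 4).
Proof.
move=> hv hv1; apply: (@deriv0_const R (fun x => z1 x * v1 x + b * (z x * v x) + 2 * a * (z x ^+ 3 * v x)
    - (p / 2 * z x ^+ 2 + q / 4 * z x ^+ 4))) => y.
apply: deriv_val (deriv_sub (deriv_add (deriv_add (deriv_mul (hz1 y) (hv1 y)) (deriv_scale b (deriv_mul (hz y) (hv y))))
    (deriv_scale (2 * a) (deriv_mul (deriv_pow 2 (hz y)) (hv y))))
    (deriv_add (deriv_scale (p / 2) (deriv_pow 1 (hz y))) (deriv_scale (q / 4) (deriv_pow 3 (hz y))))) _.
by field.
Qed.

Lemma mixed_kinetic v v1 : has_deriv v v1 -> continuous v1 -> periodic v 1 ->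
  I (fun x => z1 x * v1 x) =
    b * I (fun x => z x * v x) + 2 * a * I (fun x => z x ^+ 3 * v x).
Proof.
move=> hv cv1 pv; have cv := has_deriv_cont hv.
have la : locint (fun x => z x * v x) by apply/locint_cont/contM.
have lb : locint (fun x => z x ^+ 3 * v x) by apply/locint_cont/contM => //; exact: contX.
rewrite -[LHS]opprK -(_ : I (fun x => - (b * z x + 2 * a * z x ^+ 3) * v x) = - I (fun x => z1 x * v1 x)); last first.
  by rewrite (I_parts_periodic hz1 hv) ?opprK.
rewrite -I_N; last by apply/locint_cont/contM.
rewrite -(I_Z b la) -(I_Z (2 * a) lb) -(I_D (locintZ b la) (locintZ _ lb)).
by apply: I_ext => x; ring.
Qed.

Section linearized_kernel.
Variables (v v1 : R -> R).
Local Notation alpha := (I (fun x => z x * v x)).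
Local Notation beta := (I (fun x => z x ^+ 3 * v x)).
Local Notation P := (4 * alpha / N * (b + 1 / N ^+ 3)).
Local Notation q := (16 * a * beta / Q).
Hypothesis hv : has_deriv v v1.
Hypothesis hv1 : has_deriv v1
  (fun x => - ((b + 6 * a * z x ^+ 2) * v x) + P * z x + q * z x ^+ 3).
Hypothesis pv : periodic v 1.

Let cv : continuous v := has_deriv_cont hv.
Let cv1 : continuous v1 := has_deriv_cont hv1.
Let l2 : locint (fun x => z x ^+ 2). Proof. exact/locint_cont/contX. Qed.
Let l4 : locint (fun x => z x ^+ 4). Proof. exact/locint_cont/contX. Qed.
Let la : locint (fun x => z x * v x). Proof. exact/locint_cont/contM. Qed.
Let lb : locint (fun x => z x ^+ 3 * v x).
Proof. by apply/locint_cont/contM => //; exact: contX. Qed.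

(** Half the variation of [energy]: N varies by 2 alpha, b by - P and a by - q / 2. The left-hand
    side is a first integral of the linearized equation, and its value is found by taking the
    mean. *)
Lemma linearized_energy x : z1 x * v1 x + b * (z x * v x) + 2 * a * z x ^+ 3 * v x
  - (P / 2 * z x ^+ 2 + q / 4 * z x ^+ 4) = - 2 * (alpha / N) * (1 / N ^+ 2).
Proof.
have ec := linearized_energy_const hv hv1.
have -> : 2 * a * z x ^+ 3 * v x = 2 * a * (z x ^+ 3 * v x) by ring.
have l1 : locint (fun x => z1 x * v1 x) by apply/locint_cont/contM.
rewrite -[LHS]I_cst -(I_ext (ec^~ x)).
rewrite (I_B (locintD (locintD l1 (locintZ b la)) (locintZ (2 * a) lb)) (locintD (locintZ (P / 2) l2) (locintZ (q / 4) l4))).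
rewrite (I_D (locintD l1 (locintZ b la)) (locintZ (2 * a) lb)) (I_D l1 (locintZ b la)).
rewrite (I_D (locintZ (P / 2) l2) (locintZ (q / 4) l4)) !I_Z// (mixed_kinetic hv cv1 pv).
by field; rewrite Nn Qn.
Qed.

Variables (x0 t : R).
Hypothesis (zx0 : z x0 = 0) (t0 : 0 < t).
Hypothesis hs : forall s, 0 < s < t -> 0 < z1 x0 * z (x0 + s).
Hypothesis anti : forall x, z (x + t) = - z x.

(* If mu = 2 beta - sb Q is >= 0 then delta_q <= 0 and hence mu <= 0, and       *)
(* symmetrically with - v; so mu = 0 and delta_q = 0.                           *)
Lemma kernel_antiperiodic : v x0 = 0 -> (forall x, v (x + t) = - v x) ->
  forall x, v x = 0.
Proof.
move=> vx0 antiv.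
(* The mean of q with respect to theta is Q / N; with N varying by 2 alpha and Q by 4 beta, it
   varies by 2 m / N. Likewise theta varies by 2 sg / N, since sb accounts for the variation of the
   normalization N. *)
pose sb := alpha / N; pose m := 2 * beta - sb * Q; pose k := 8 * a / Q.
have k0 : 0 <= k by rewrite /k divr_ge0 ?(ltW Q0)// mulr_ge0.
have cs : continuous (fun x => z x * v x - sb * z x ^+ 2).
  by apply/contD; [exact: contM|apply/contN/contZ/contX].
have ct : continuous (fun x => 2 * z x ^+ 3 * v x - sb * z x ^+ 4 - m).
  apply/contD; last by apply/contN/contC.
  apply/contD; last by apply/contN/contZ/contX.
  by apply/contM => //; exact/contZ/contX.
pose sg x := prim (fun x => z x * v x - sb * z x ^+ 2) x
  - prim (fun x => z x * v x - sb * z x ^+ 2) x0.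
pose tau := prim (fun x => 2 * z x ^+ 3 * v x - sb * z x ^+ 4 - m).
have hsg : has_deriv sg (fun x => z x * v x - sb * z x ^+ 2).
  by move=> x; apply: deriv_val (deriv_sub (prim_deriv cs x) (deriv_cst _ x)) _; rewrite subr0.
have psg : periodic sg 1.
  move=> x; rewrite /sg prim_periodic//; first by move=> y; rewrite pz pv.
    exact: locint_cont.
  by rewrite (I_B la (locintZ sb l2)) I_Z// /sb divfK// subrr.
have sgx0 : sg x0 = 0 by rewrite /sg subrr.
have htau := prim_deriv ct.
have ptau : periodic tau 1.
  apply: prim_periodic; first by move=> y; rewrite pz pv.
    exact: locint_cont.
  have -> : I (fun x => 2 * z x ^+ 3 * v x - sb * z x ^+ 4 - m) =
    I (fun x => 2 * (z x ^+ 3 * v x) - sb * z x ^+ 4 - m) by apply: I_ext => x; ring.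
  rewrite (I_B (locintB (locintZ 2 lb) (locintZ sb l4)) (locint_cst m)).
  by rewrite (I_B (locintZ 2 lb) (locintZ sb l4)) !I_Z// I_cst /m subrr.
have he x := linearized_energy x.
have hk : q - 8 * a * sb = k * m by rewrite /k /m /sb; field; rewrite Nn Qn.
have pos : 0 <= m -> m <= 0 /\ forall x, x0 < x < x0 + t -> delta_q z z1 sg v x <= 0.
  move=> m0.
  have h := delta_q_le0 E0 hz hz1 energy pz zx0 hs anti k0 hv hv1 antiv vx0 hsg psg sgx0 he hk m0.
  split => //.
  exact: (mu_le0 hz pz zx0 t0 hs anti antiv hsg psg sgx0 htau ptau h).
have neg : m <= 0 -> 0 <= m /\ forall x, x0 < x < x0 + t -> 0 <= delta_q z z1 sg v x.
  move=> m0.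
  have hvN : has_deriv (fun x => - v x) (fun x => - v1 x) by move=> x; exact: deriv_opp.
  have hv1N : has_deriv (fun x => - v1 x)
      (fun x => - ((b + 6 * a * z x ^+ 2) * - v x) + (- P) * z x + (- q) * z x ^+ 3).
    by move=> x; apply: deriv_val (deriv_opp (hv1 x)) _; ring.
  have antivN x : - v (x + t) = - - v x by rewrite antiv.
  have vx0N : - v x0 = 0 by rewrite vx0 oppr0.
  have hsgN : has_deriv (fun x => - sg x) (fun x => z x * - v x - (- sb) * z x ^+ 2).
    by move=> x; apply: deriv_val (deriv_opp (hsg x)) _; ring.
  have psgN : periodic (fun x => - sg x) 1 by move=> x; rewrite psg.
  have sgx0N : - sg x0 = 0 by rewrite sgx0 oppr0.
  have htauN : has_deriv (fun x => - tau x)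
      (fun x => 2 * z x ^+ 3 * - v x - (- sb) * z x ^+ 4 - (- m)).
    by move=> x; apply: deriv_val (deriv_opp (htau x)) _; ring.
  have ptauN : periodic (fun x => - tau x) 1 by move=> x; rewrite ptau.
  have heN x : z1 x * - v1 x + b * (z x * - v x) + 2 * a * z x ^+ 3 * - v x
      - (- P / 2 * z x ^+ 2 + - q / 4 * z x ^+ 4) = - 2 * (- sb) * (1 / N ^+ 2).
    have := he x; rewrite -/sb => h; transitivity (- (- 2 * sb * (1 / N ^+ 2))); last by ring.
    by rewrite -h; field; rewrite Nn Qn.
  have hkN : - q - 8 * a * - sb = k * - m.
    by transitivity (- (q - 8 * a * sb)); [ring|rewrite hk; ring].
  have mN : 0 <= - m by rewrite oppr_ge0.
  have h := delta_q_le0 E0 hz hz1 energy pz zx0 hs anti k0 hvN hv1N antivN vx0N hsgN psgN sgx0N heN hkN mN.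
  have hm := mu_le0 hz pz zx0 t0 hs anti antivN hsgN psgN sgx0N htauN ptauN h.
  split; first by rewrite -oppr_le0.
  move=> x hx; have := h x hx; rewrite /delta_q -oppr_ge0.
  by congr (0 <= _); ring.
have [m0 dqz] : m = 0 /\ forall x, x0 < x < x0 + t -> delta_q z z1 sg v x = 0.
  have m0 : m = 0.
    apply/eqP; rewrite eq_le; have [m0|m0] := leP m 0.
      by have [-> _] := neg m0.
    by have [] := pos (ltW m0); rewrite leNgt m0.
  have [mge mle] : 0 <= m /\ m <= 0 by rewrite m0.
  split => // x hx; have [_ h1] := pos mge; have [_ h2] := neg mle.
  by apply/eqP; rewrite eq_le h1 ?h2.
exact: (delta_q_eq0 E0 hz hz1 energy zx0 t0 hs anti hv antiv vx0 hsg dqz).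
Qed.

End linearized_kernel.

Lemma I_z_z1 : I (fun x => z x * z1 x) = 0.
Proof.
have := I_parts_periodic hz hz cz1 cz1 pz pz.
have -> : I (fun x => z1 x * z x) = I (fun x => z x * z1 x) by apply: I_ext => x; rewrite mulrC.
by lra.
Qed.

Lemma I_z3_z1 : I (fun x => z x ^+ 3 * z1 x) = 0.
Proof.
have h3 : has_deriv (fun x => z x ^+ 3) (fun x => 3 * z x ^+ 2 * z1 x).
  by move=> x; exact: (deriv_pow 2 (hz x)).
have p3 : periodic (fun x => z x ^+ 3) 1 by move=> x; rewrite pz.
have c3 : continuous (fun x => 3 * z x ^+ 2 * z1 x).
  by apply: contM => //; apply: contZ; exact: contX.
have := I_parts_periodic h3 hz c3 cz1 p3 pz.
have -> : I (fun x => 3 * z x ^+ 2 * z1 x * z x) = 3 * I (fun x => z x ^+ 3 * z1 x).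
  rewrite -I_Z; last by apply/locint_cont/contM => //; exact: contX.
  by apply: I_ext => x; ring.
by lra.
Qed.

(** c is chosen so that u = v - c z' vanishes at a zero of z. As z' is orthogonal to z and to z^3,
    the nonlocal coefficients are the same for u as for v. It remains to show u = 0, separately for
    r > 0 and for r = 0. *)
Theorem linearized_kernel v v1 : has_deriv v v1 -> periodic v 1 ->
  has_deriv v1 (fun x => - ((b + 6 * a * z x ^+ 2) * v x)
    + 4 * I (fun x => z x * v x) / N * (b + 1 / N ^+ 3) * z x
    + 16 * a * I (fun x => z x ^+ 3 * v x) / Q * z x ^+ 3) ->
  exists c, forall x, v x = c * z1 x.
Proof.
move=> hv pv hv1.
have [x0 zx0] := duffing_zero_exists a0 E0 hz hz1 energy pz.
have [t t0 [zt hs]] := duffing_next_zero E0 hz hz1 energy pz zx0.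
have anti := duffing_antiperiodic a0 E0 hz hz1 energy pz zx0 t0 zt hs.
have z1x0 := duffing_zero_deriv_neq0 E0 energy zx0.
pose c := v x0 / z1 x0; exists c.
pose u x := v x - c * z1 x; pose u1 x := v1 x - c * - (b * z x + 2 * a * z x ^+ 3).
suff u0 x : u x = 0 by move=> x; have := u0 x; rewrite /u => /eqP; rewrite subr_eq0 => /eqP.
have hu : has_deriv u u1 by move=> y; exact: deriv_sub (hv y) (deriv_scale c (hz1 y)).
have pu : periodic u 1 by move=> y; rewrite /u pv pz1.
have ux0 : u x0 = 0 by rewrite /u /c divfK// subrr.
have la : locint (fun x => z x * v x) by apply/locint_cont/contM => //; exact: has_deriv_cont hv.
have lb : locint (fun x => z x ^+ 3 * v x).
  by apply/locint_cont/contM; [exact: contX|exact: has_deriv_cont hv].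
have lza : locint (fun x => z x * z1 x) by apply/locint_cont/contM.
have lzb : locint (fun x => z x ^+ 3 * z1 x) by apply/locint_cont/contM => //; exact: contX.
have ea : I (fun x => z x * u x) = I (fun x => z x * v x).
  transitivity (I (fun x => z x * v x - c * (z x * z1 x))).
    by apply: I_ext => y; rewrite /u; ring.
  by rewrite (I_B la (locintZ c lza)) I_Z// I_z_z1 mulr0 subr0.
have eb : I (fun x => z x ^+ 3 * u x) = I (fun x => z x ^+ 3 * v x).
  transitivity (I (fun x => z x ^+ 3 * v x - c * (z x ^+ 3 * z1 x))).
    by apply: I_ext => y; rewrite /u; ring.
  by rewrite (I_B lb (locintZ c lzb)) I_Z// I_z3_z1 mulr0 subr0.
have hu1 : has_deriv u1 (fun x => - ((b + 6 * a * z x ^+ 2) * u x)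
    + 4 * I (fun x => z x * u x) / N * (b + 1 / N ^+ 3) * z x
    + 16 * a * I (fun x => z x ^+ 3 * u x) / Q * z x ^+ 3).
  move=> y; rewrite ea eb.
  by apply: deriv_val (deriv_sub (hv1 y) (deriv_scale c (@jacobi_z1 R a b z z1 hz y))) _; rewrite /u; ring.
have [r1|] := eqVneq r 0; last first.
  rewrite neq_lt ltNge r0/= => r_gt0.
  have a_gt0 : 0 < a by rewrite aE divr_gt0// mulr_gt0// exprn_gt0.
  have [ut u2t] := jacobi_reduce a0 E0 hz hz1 energy pz zx0 anti hu hu1 pu ux0.
  have dshift (f f1 : R -> R) y : has_deriv f f1 -> is_derive (y : R) 1 (fun y => f (y + t)) (f1 (y + t)).
    by move=> hf; apply: deriv_val (deriv_comp (deriv_add (deriv_id y) (deriv_cst t y)) (hf _)) _; rewrite addr0 mulr1.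
  (* In u + u (. + t) the inhomogeneities cancel, because z and z^3 change sign under the
     translation by t. *)
  have us0 := @jacobi_no_conjugate R a b (1 / N ^+ 2) z z1 a0 E0 hz hz1 energy pz x0 t zx0 t0 hs anti
    (fun y => u y + u (y + t)) (fun y => u1 y + u1 (y + t)) a_gt0.
  apply: (kernel_antiperiodic hu hu1 pu zx0 t0 hs anti ux0) => y.
  apply/eqP; rewrite -addr_eq0 addrC; apply/eqP; apply: us0.
  - by move=> s; exact: deriv_add (hu s) (dshift _ _ s hu).
  - move=> s; apply: deriv_val (deriv_add (hu1 s) (dshift _ _ s hu1)) _.
    by rewrite anti; ring.
  - by rewrite ux0 ut addr0.
  - by rewrite ut u2t ux0 addr0.
have az : a = 0 by rewrite aE r1 mul0r.
(* For r = 0 the kinetic identity reads D = b N and the formula for b reads b N = 1 / N^2 - D. *)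
have Db : b * N = 1 / (2 * N ^+ 2).
  have := kinetic_identity; rewrite az mulr0 mul0r addr0 => Dk.
  have : b * N = 1 / N ^+ 2 - D by rewrite bE r1; field; rewrite Nn Qn.
  have -> : 1 / (2 * N ^+ 2) = 1 / N ^+ 2 / 2 by field.
  by move: (1 / _) => w; lra.
have bpos : 0 < b + 1 / N ^+ 3.
  have -> : b + 1 / N ^+ 3 = (b * N + 1 / N ^+ 2) / N by field.
  by rewrite divr_gt0// Db addr_gt0// divr_gt0// ?mulr_gt0// exprn_gt0.
have cu := has_deriv_cont hu.
have lu : locint (fun y => z y * u y) by apply/locint_cont/contM.
have l2 : locint (fun y => z y ^+ 2) by apply/locint_cont/contX.
pose p := 4 * I (fun x => z x * u x) / N * (b + 1 / N ^+ 3).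
have hu1' : has_deriv u1 (fun y => - b * u y + p * z y).
  by move=> y; apply: deriv_val (hu1 y) _; rewrite az /p; ring.
(* The solvability condition: z lies in the kernel of the self-adjoint operator u'' + b u, so
   pairing u'' + b u = p z with z gives p N = 0. *)
have p0 : p = 0.
  have e1 := I_parts_periodic hz hu1' cz1 _ pz (periodic_deriv hu pu).
  have e2 := I_parts_periodic hz1 hu cz2 (has_deriv_cont hu1') pz1 pu.
  have c2 : continuous (fun y => - b * u y + p * z y) by apply: contD; exact: contZ.
  have {}e1 := e1 c2.
  have e3 : I (fun y => z y * (- b * u y + p * z y)) = - b * I (fun y => z y * u y) + p * N.
    rewrite -(I_Z _ lu) -(I_Z p l2) -(I_D (locintZ _ lu) (locintZ p l2)).
    by apply: I_ext => y; ring.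
  have e4 : I (fun y => - (b * z y + 2 * a * z y ^+ 3) * u y) = - b * I (fun y => z y * u y).
    by rewrite -(I_Z _ lu); apply: I_ext => y; rewrite az; ring.
  have : p * N = 0.
    have : - b * I (fun y => z y * u y) + p * N = - b * I (fun y => z y * u y).
      by rewrite -e3 e1 e2 e4 opprK.
    by move/eqP; rewrite -subr_eq0 addrAC subrr add0r => /eqP.
  by move/eqP; rewrite mulf_eq0 (negbTE Nn) orbF => /eqP.
have al0 : I (fun x => z x * u x) = 0.
  move/eqP: p0; rewrite /p !mulf_eq0 invr_eq0 (negbTE Nn) (gt_eqF bpos) pnatr_eq0/= !orbF.
  by move/eqP.
(* Now u and d z solve the same linear equation with the same data at [x0]. Finally <z, u> = 0
   yields d = 0. *)
pose d := u1 x0 / z1 x0.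
have ud y : u y - d * z y = 0.
  move: y; apply: (@jacobi_unique R a b z z1 a0 hz pz (fun y => u y - d * z y) (fun y => u1 y - d * z1 y) x0).
  - by move=> y; exact: deriv_sub (hu y) (deriv_scale d (hz y)).
  - move=> y; apply: deriv_val (deriv_sub (hu1' y) (deriv_scale d (hz1 y))) _.
    by rewrite p0 az; ring.
  - by rewrite ux0 zx0 mulr0 subr0.
  - by rewrite /d divfK// subrr.
have d0 : d = 0.
  have : d * N = 0.
    rewrite -(I_Z _ l2); apply: etrans al0; apply: I_ext => y.
    have /eqP := ud y; rewrite subr_eq0 => /eqP ->; ring.
  by move/eqP; rewrite mulf_eq0 (negbTE Nn) orbF => /eqP.
by have := ud x; rewrite d0 mul0r subr0.
Qed.

End kernel.

(** * First-order expansions *)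

Section expansion.
Variables (R : realType) (T : Type) (V : T -> Prop) (n : T -> R).
Hypothesis n0 : forall v, 0 <= n v.
Implicit Types (f g c d l m : T -> R).

(* First-order expansion f = c + l + O(n^2) near n = 0, with c bounded and     *)
(* l = O(n).                                                                   *)
Definition expansion f c l := exists C e : R, [/\ 0 <= C, 0 < e,
  forall v, V v -> `|c v| <= C, forall v, V v -> `|l v| <= C * n v &
  forall v, V v -> n v <= e -> `|f v - c v - l v| <= C * n v ^+ 2].

Lemma expansion_bounded c M : (forall v, V v -> `|c v| <= M) ->
  expansion c c (fun=> 0).
Proof.
move=> hM; exists `|M|, 1; split => // v Vv.
- by apply: le_trans (hM v Vv) _; rewrite ler_norm.
- by rewrite normr0 mulr_ge0.
- by rewrite subrr subr0 normr0 mulr_ge0// sqr_ge0.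
Qed.

Lemma expansion_cst (c : R) : expansion (fun=> c) (fun=> c) (fun=> 0).
Proof. exact: (@expansion_bounded _ `|c|). Qed.

Lemma expansion_linear l M : (forall v, V v -> `|l v| <= M * n v) ->
  expansion l (fun=> 0) l.
Proof.
move=> hM; exists `|M|, 1; split => // v Vv.
- by rewrite normr0.
- by apply: le_trans (hM v Vv) _; rewrite ler_wpM2r// ler_norm.
- by rewrite subr0 subrr normr0 mulr_ge0// sqr_ge0.
Qed.

Lemma expansion_ext f g c d l m : (forall v, V v -> f v = g v) ->
  (forall v, V v -> c v = d v) -> (forall v, V v -> l v = m v) ->
  expansion f c l -> expansion g d m.
Proof.
move=> fg cd lm [C [e [C0 e0 hc h1 h2]]]; exists C, e; split => // v Vv.
- by rewrite -cd//; exact: hc.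
- by rewrite -lm//; exact: h1.
- by rewrite -lm// -fg// -cd//; exact: h2.
Qed.

Lemma expansion_add f g c d l m : expansion f c l -> expansion g d m ->
  expansion (fun v => f v + g v) (fun v => c v + d v) (fun v => l v + m v).
Proof.
move=> [C [e [C0 e0 hc h1 h2]]] [C' [e' [C'0 e'0 hc' h1' h2']]].
exists (C + C'), (Num.min e e'); split => //.
- exact: addr_ge0.
- by rewrite lt_min e0.
- by move=> v Vv; apply: le_trans (ler_normD _ _) _; rewrite lerD ?hc ?hc'.
- by move=> v Vv; rewrite mulrDl; apply: le_trans (ler_normD _ _) _; rewrite lerD ?h1 ?h1'.
- move=> v Vv; rewrite le_min => /andP[ve ve'].
  have -> : f v + g v - (c v + d v) - (l v + m v) =
    (f v - c v - l v) + (g v - d v - m v) by ring.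
  by rewrite mulrDl; apply: le_trans (ler_normD _ _) _; rewrite lerD ?h2 ?h2'.
Qed.

Lemma expansion_mul f g c d l m : expansion f c l -> expansion g d m ->
  expansion (fun v => f v * g v) (fun v => c v * d v) (fun v => c v * m v + d v * l v).
Proof.
move=> [C [e [C0 e0 hc h1 h2]]] [C' [e' [C'0 e'0 hc' h1' h2']]].
have CC : 0 <= C * C' by rewrite mulr_ge0.
(* 6 = 1 + 1 + 2 * 2: two products of a value with a remainder, and the product of the increments f
   - c and g - d, which are at most 2 C n and 2 C' n for n <= 1. *)
exists (6 * (C * C')), (Num.min 1 (Num.min e e')); split => //.
- by rewrite mulr_ge0.
- by rewrite !lt_min e0 ltr01.
- move=> v Vv; rewrite normrM.
  have : `|c v| * `|d v| <= C * C' by rewrite ler_pM ?hc ?hc'.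
  lra.
- move=> v Vv; apply: le_trans (ler_normD _ _) _; rewrite !normrM.
  have a1 : `|c v| * `|m v| <= C * (C' * n v) by rewrite ler_pM ?hc ?h1'.
  have a2 : `|d v| * `|l v| <= C' * (C * n v) by rewrite ler_pM ?hc' ?h1.
  have a3 : 0 <= C * C' * n v by rewrite !mulr_ge0.
  lra.
- move=> v Vv; rewrite !le_min => /and3P[v1 ve ve'].
  have nv := n0 v.
  have nv2 : n v ^+ 2 <= n v by rewrite expr2 ler_piMl.
  have H1 := h1 v Vv; have H1' := h1' v Vv; have H2 := h2 v Vv ve; have H2' := h2' v Vv ve'.
  have b1 : `|f v - c v| <= 2 * (C * n v).
    have -> : f v - c v = (f v - c v - l v) + l v by ring.
    apply: le_trans (ler_normD _ _) _.
    have : C * n v ^+ 2 <= C * n v by rewrite ler_wpM2l.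
    lra.
  have b2 : `|g v - d v| <= 2 * (C' * n v).
    have -> : g v - d v = (g v - d v - m v) + m v by ring.
    apply: le_trans (ler_normD _ _) _.
    have : C' * n v ^+ 2 <= C' * n v by rewrite ler_wpM2l.
    lra.
  have -> : f v * g v - c v * d v - (c v * m v + d v * l v) =
    c v * (g v - d v - m v) + d v * (f v - c v - l v) + (f v - c v) * (g v - d v) by ring.
  apply: le_trans (ler_normD _ _) _.
  apply: le_trans (lerD (ler_normD _ _) (lexx _)) _; rewrite !normrM.
  have a1 : `|c v| * `|g v - d v - m v| <= C * (C' * n v ^+ 2) by rewrite ler_pM ?hc.
  have a2 : `|d v| * `|f v - c v - l v| <= C' * (C * n v ^+ 2) by rewrite ler_pM ?hc'.
  have a3 : `|f v - c v| * `|g v - d v| <= 2 * (C * n v) * (2 * (C' * n v)) by rewrite ler_pM.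
  have -> : 6 * (C * C') * n v ^+ 2 = C * (C' * n v ^+ 2) + C' * (C * n v ^+ 2)
    + 2 * (C * n v) * (2 * (C' * n v)) by ring.
  exact: lerD (lerD a1 a2) a3.
Qed.

Lemma expansion_scale (k : R) f c l : expansion f c l ->
  expansion (fun v => k * f v) (fun v => k * c v) (fun v => k * l v).
Proof.
move=> h; apply: expansion_ext (expansion_mul (expansion_cst k) h) => // v _.
by rewrite mulr0 addr0.
Qed.

Lemma expansion_pos f (c : R) l : expansion f (fun=> c) l -> 0 < c ->
  exists2 e, 0 < e & forall v, V v -> n v <= e -> c / 2 <= f v.
Proof.
move=> [C [e [C0 e0 _ h1 h2]]] c0.
exists (Num.min 1 (Num.min e (c / (4 * C + 1)))).
  by rewrite !lt_min ltr01 e0 divr_gt0// ltr_wpDl// mulr_ge0.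
move=> v Vv; rewrite !le_min => /and3P[v1 ve vc].
have nv := n0 v.
have H1 := h1 v Vv; have H2 := h2 v Vv ve.
have b1 : `|f v - c| <= 2 * (C * n v).
  have -> : f v - c = (f v - c - l v) + l v by ring.
  apply: le_trans (ler_normD _ _) _.
  have : C * n v ^+ 2 <= C * n v by rewrite ler_wpM2l// expr2 ler_piMl.
  lra.
have C4 : 0 < 4 * C + 1 by rewrite ltr_wpDl// mulr_ge0.
have : 4 * (C * n v) <= c.
  move: vc; rewrite ler_pdivlMr// => vc; apply: le_trans vc.
  lra.
move: b1; rewrite ler_norml => /andP[b1 _] b2; lra.
Qed.

(** The remainder has the numerator - c (f - c - l) + l (f - c), which is of second order, over c^2
    f, and near n = 0 the denominator is bounded below since f >= c / 2. *)
Lemma expansion_inv f (c : R) l : 0 < c -> expansion f (fun=> c) l ->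
  expansion (fun v => (f v)^-1) (fun=> c^-1) (fun v => - l v / c ^+ 2).
Proof.
move=> c0 h; have [e1 e10 hp] := expansion_pos h c0; have [C [e [C0 e0 _ h1 h2]]] := h.
have c2 : 0 < c ^+ 2 by rewrite exprn_gt0.
(* The first summand bounds the linear term, the second the remainder. *)
pose K := C / c ^+ 2 + (C * c + 2 * C ^+ 2) / (c ^+ 2 * (c / 2)).
suff [hK h3 h4] : [/\ 0 <= K, forall v, V v -> `|- l v / c ^+ 2| <= K * n v &
    forall v, V v -> n v <= Num.min 1 (Num.min e e1) ->
      `|(f v)^-1 - c^-1 - - l v / c ^+ 2| <= K * n v ^+ 2].
  have ci : 0 <= c^-1 by rewrite invr_ge0 ltW.
  exists (c^-1 + K), (Num.min 1 (Num.min e e1)); split => //.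
  - exact: addr_ge0.
  - by rewrite !lt_min ltr01 e0.
  - by move=> v _; rewrite ger0_norm// lerDl.
  - by move=> v Vv; apply: le_trans (h3 v Vv) _; rewrite ler_wpM2r// lerDr.
  - by move=> v Vv vn; apply: le_trans (h4 v Vv vn) _; rewrite ler_wpM2r ?sqr_ge0// lerDr.
rewrite /K.
have p1 : 0 <= C / c ^+ 2 by rewrite divr_ge0// ltW.
have p2 : 0 <= (C * c + 2 * C ^+ 2) / (c ^+ 2 * (c / 2)).
  rewrite divr_ge0// ?addr_ge0// ?mulr_ge0// ?sqr_ge0// ?(ltW c0)//.
split => //.
- exact: addr_ge0.
- move=> v Vv; rewrite normrM normrN normfV (gtr0_norm c2) mulrDl.
  have : `|l v| / c ^+ 2 <= C * n v / c ^+ 2 by rewrite ler_wpM2r ?h1// invr_ge0 ltW.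
  have := mulr_ge0 p2 (n0 v); rewrite [C * n v / _]mulrAC; lra.
- move=> v Vv; rewrite !le_min => /and3P[v1 ve ve1].
  have nv := n0 v.
  have H1 := h1 v Vv; have H2 := h2 v Vv ve.
  have b1 : `|f v - c| <= 2 * (C * n v).
    have -> : f v - c = (f v - c - l v) + l v by ring.
    apply: le_trans (ler_normD _ _) _.
    have : C * n v ^+ 2 <= C * n v by rewrite ler_wpM2l// expr2 ler_piMl.
    lra.
  have fc := hp v Vv ve1.
  have c20 : 0 < c / 2 by rewrite divr_gt0.
  have f0 : 0 < f v by exact: lt_le_trans fc.
  have -> : (f v)^-1 - c^-1 - - l v / c ^+ 2 =
      (- c * (f v - c - l v) + l v * (f v - c)) / (c ^+ 2 * f v).
    by field; rewrite !gt_eqF.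
  rewrite normrM normfV (gtr0_norm (mulr_gt0 c2 f0)).
  have num : `|- c * (f v - c - l v) + l v * (f v - c)| <= (C * c + 2 * C ^+ 2) * n v ^+ 2.
    apply: le_trans (ler_normD _ _) _; rewrite !normrM normrN (gtr0_norm c0).
    have a1 : c * `|f v - c - l v| <= c * (C * n v ^+ 2) by rewrite ler_wpM2l// ltW.
    have a2 : `|l v| * `|f v - c| <= (C * n v) * (2 * (C * n v)) by rewrite ler_pM.
    have a3 : (C * n v) * (2 * (C * n v)) = 2 * C ^+ 2 * n v ^+ 2 by ring.
    rewrite mulrDl; lra.
  have den : (c ^+ 2 * f v)^-1 <= (c ^+ 2 * (c / 2))^-1.
    by rewrite lef_pV2 ?posrE ?mulr_gt0// ler_wpM2l// ltW.
  apply: le_trans (ler_pM _ _ num den) _ => //.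
    by rewrite invr_ge0 mulr_ge0// ltW.
  rewrite mulrDl; have := mulr_ge0 p1 (sqr_ge0 (n v)); rewrite mulrAC; lra.
Qed.

End expansion.

(** Serves to carry expansions in the H^1 norm over to richer data measured in the H^2 norm. *)
Lemma expansion_comp (R : realType) (T T' : Type) (V : T -> Prop) (V' : T' -> Prop)
    (n : T -> R) (n' : T' -> R) (p : T' -> T) f c l :
  (forall v, 0 <= n v) -> (forall v, V' v -> V (p v)) -> (forall v, V' v -> n (p v) <= n' v) ->
  expansion V n f c l ->
  expansion V' n' (fun v => f (p v)) (fun v => c (p v)) (fun v => l (p v)).
Proof.
move=> n0 hV hn [C [e [C0 e0 hc h1 h2]]]; exists C, e; split => // v Vv.
- exact: hc (hV v Vv).
- by apply: le_trans (h1 _ (hV v Vv)) _; rewrite ler_wpM2l// hn.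
- move=> ve; apply: le_trans (h2 _ (hV v Vv) (le_trans (hn v Vv) ve)) _.
  rewrite ler_wpM2l// lerXn2r ?nnegrE ?hn//.
  exact: le_trans (n0 _) (hn v Vv).
Qed.

(** * Expansions of the norms that enter the functional *)

Section base_expansions.
Variable R : realType.
Local Notation mu := (@lebesgue_measure R).
Local Notation I f := (\int[mu]_(x in `[0%R, 1%R]) f x).
Local Notation exp1 := (expansion (@sobolev R 1) (@sobolev_norm R 1)).

Lemma I_bound (h : R -> R) (B : R) : locint h -> (forall x, `|h x| <= B) -> `|I h| <= B.
Proof.
move=> lh hB; apply: le_trans (I_norm lh) _; rewrite -[leRHS]I_cst.
apply: I_le => //; [exact: locint_norm|exact: locint_cst].
Qed.

Lemma pairing_bound (i p m n : R) : 0 <= p -> 0 <= n -> `|i| <= p * m -> m <= n ->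
  `|2 * i| <= (2 * p + 1) * n.
Proof.
move=> p0 n0 h mn; rewrite normrM ger0_norm//.
have : p * m <= p * n by rewrite ler_wpM2l.
lra.
Qed.

Lemma sqr_bound (p m n : R) : 0 <= p -> 0 <= m -> m <= n ->
  `|m ^+ 2| <= (2 * p + 1) * n ^+ 2.
Proof.
move=> p0 m0 mn; have n0 := le_trans m0 mn; rewrite ger0_norm ?sqr_ge0// -[leLHS]mul1r.
by rewrite ler_pM ?sqr_ge0 ?lerXn2r ?nnegrE// lerDr mulr_ge0.
Qed.

Lemma expansion_intro (T : Type) (V : T -> Prop) (n f l : T -> R) (c C : R) :
  (forall v, 0 <= n v) -> 0 <= C -> (forall v, V v -> `|l v| <= C * n v) ->
  (forall v, V v -> n v <= 1 -> `|f v - c - l v| <= C * n v ^+ 2) ->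
  expansion V n f (fun=> c) l.
Proof.
move=> n0 C0 h1 h2; exists (`|c| + C), 1; split => //; first exact: addr_ge0.
- by move=> v _; rewrite lerDl.
- by move=> v Vv; apply: le_trans (h1 v Vv) _; rewrite ler_wpM2r// lerDr.
- by move=> v Vv vn; apply: le_trans (h2 v Vv vn) _; rewrite ler_wpM2r ?sqr_ge0// lerDr.
Qed.

Lemma remainder_simpl (A B C : R) : A + B + C - A - B = C.
Proof. by ring. Qed.

Variables (z Z : R -> R).
Hypothesis sz : sobolev 1 z.
Hypothesis zZ : z = Z %[ae mu].
Hypothesis cZ : continuous Z.
Hypothesis pZ : periodic Z 1.

Let Lz : L2 z. Proof. by have [] := sobolev1P sz. Qed.
Let Lz' : L2 (wderiv z). Proof. by have [] := sobolev1P sz. Qed.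
Let LZ : L2 Z. Proof. exact: L2_cont. Qed.
Let mz : measurable_fun [set: R] z. Proof. by case: Lz. Qed.
Let mZ : measurable_fun [set: R] Z. Proof. by case: LZ. Qed.

Lemma expansion_norm : exp1 (fun v => L2norm (z + v) ^+ 2) (fun=> I (fun x => Z x ^+ 2))
  (fun v => 2 * I (fun x => Z x * v x)).
Proof.
apply: (@expansion_intro _ _ _ _ _ _ (2 * L2norm Z + 1)); [exact: sobolev_norm_ge0| | |]; first by rewrite addr_ge0// mulr_ge0// L2norm_ge0.
  move=> v sv; have [lv _ _] := sobolev1P sv.
  exact: (pairing_bound (L2norm_ge0 _) (sobolev_norm_ge0 1 v) (L2_CS LZ lv) (L2norm_le1 v)).
move=> v sv _; have [lv _ _] := sobolev1P sv; have [_ mv _] := lv.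
have lZv := L2_mul LZ lv; have l2Z := L2_sqr LZ; have l2v := L2_sqr lv.
have -> : L2norm (z + v) ^+ 2 = I (fun x => (Z x + v x) ^+ 2).
  rewrite L2norm_sqr; apply: I_ae.
  - by apply: measurable_funX; exact: measurable_funD.
  - by apply: measurable_funX; exact: measurable_funD.
  - exact: (ae_lift1 (fun x y => (y + v x) ^+ 2) zZ).
have -> : I (fun x => (Z x + v x) ^+ 2) = I (fun x => Z x ^+ 2 + 2 * (Z x * v x) + v x ^+ 2).
  by apply: I_ext => x; ring.
rewrite (I_D (locintD l2Z (locintZ _ lZv)) l2v) (I_D l2Z (locintZ _ lZv)) I_Z//.
rewrite remainder_simpl -L2norm_sqr.
exact: (sqr_bound (L2norm_ge0 _) (L2norm_ge0 v) (L2norm_le1 v)).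
Qed.

Lemma wderiv_addE (v : R -> R) : sobolev 1 v ->
  [/\ sobolev 1 (z + v), L2 (wderiv (z + v)) &
  wderiv (z + v) = (fun x => wderiv z x + wderiv v x) %[ae mu]].
Proof.
move=> sv; have [h1 h2] := sobolev1_lin 1 sz sv.
have e : (fun x => 1 * z x + v x) = z + v by apply/funext => x; rewrite mul1r.
rewrite e in h1 h2; split => //; first by have [] := sobolev1P h1.
by move: h2; under [X in _ = X %[ae _] -> _]eq_fun do rewrite mul1r.
Qed.

Lemma expansion_deriv : exp1 (fun v => L2norm (wderiv (z + v)) ^+ 2)
  (fun=> I (fun x => wderiv z x ^+ 2)) (fun v => 2 * I (fun x => wderiv z x * wderiv v x)).
Proof.
apply: (@expansion_intro _ _ _ _ _ _ (2 * L2norm (wderiv z) + 1)); [exact: sobolev_norm_ge0| | |].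
- by rewrite addr_ge0// mulr_ge0// L2norm_ge0.
- move=> v sv; have [_ lv _] := sobolev1P sv.
  exact: (pairing_bound (L2norm_ge0 _) (sobolev_norm_ge0 1 v) (L2_CS Lz' lv) (L2norm_wderiv_le1 v)).
move=> v sv _; have [_ lv _] := sobolev1P sv; have [_ mv _] := lv.
have [_ [_ m1 _] e] := wderiv_addE sv; have [_ mz' _] := Lz'.
have lZv := L2_mul Lz' lv; have l2Z := L2_sqr Lz'; have l2v := L2_sqr lv.
have -> : L2norm (wderiv (z + v)) ^+ 2 = I (fun x => (wderiv z x + wderiv v x) ^+ 2).
  rewrite L2norm_sqr; apply: I_ae.
  - exact: measurable_funX.
  - by apply: measurable_funX; exact: measurable_funD.
  - exact: (ae_lift1 (fun x y => y ^+ 2) e).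
have -> : I (fun x => (wderiv z x + wderiv v x) ^+ 2) =
    I (fun x => wderiv z x ^+ 2 + 2 * (wderiv z x * wderiv v x) + wderiv v x ^+ 2).
  by apply: I_ext => x; ring.
rewrite (I_D (locintD l2Z (locintZ _ lZv)) l2v) (I_D l2Z (locintZ _ lZv)) I_Z//.
rewrite remainder_simpl -L2norm_sqr.
exact: (sqr_bound (L2norm_ge0 _) (L2norm_ge0 (wderiv v)) (L2norm_wderiv_le1 v)).
Qed.

(** The L^2 norm does not control the cubic and quartic terms; they are estimated pointwise through
    the continuous representative F of v, with |F| <= 2 n. *)
Lemma expansion_quartic : exp1 (fun v => L2norm (fun x => (z + v) x ^+ 2) ^+ 2)
  (fun=> I (fun x => Z x ^+ 4)) (fun v => 4 * I (fun x => Z x ^+ 3 * v x)).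
Proof.
have [M M0 hM] := periodic_cont_bounded ltr01 pZ cZ.
have M2 : 0 <= M ^+ 2 by rewrite sqr_ge0.
have M3 : 0 <= M ^+ 3 by rewrite exprn_ge0.
(* With |Z| <= M and |F| <= 2 n: the linear term is at most 4 M^3 (2 n), and 6 Z^2 F^2, 4 Z F^3 and
   F^4 contribute 24 M^2, 32 M and 16, higher powers of n being reduced to n^2 by n <= 1. *)
apply: (@expansion_intro _ _ _ _ _ _ (8 * M ^+ 3 + (24 * M ^+ 2 + 32 * M + 16))); [exact: sobolev_norm_ge0| | |]; first by rewrite !addr_ge0// mulr_ge0.
  move=> v sv; have [lv _ _] := sobolev1P sv; have [_ mv _] := lv.
  have [F [cF pF vF _ hF]] := sobolev1_rep sv.
  have n0 := sobolev_norm_ge0 1 v.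
  have -> : I (fun x => Z x ^+ 3 * v x) = I (fun x => Z x ^+ 3 * F x).
    apply: I_ae.
    - by apply: measurable_funM => //; exact: measurable_funX.
    - by apply: measurable_funM; [exact: measurable_funX|exact: continuous_measurable_fun].
    - exact: (ae_lift1 (fun x y => Z x ^+ 3 * y) vF).
  have : `|I (fun x => Z x ^+ 3 * F x)| <= M ^+ 3 * (2 * sobolev_norm 1 v).
    apply: I_bound; first by apply/locint_cont/contM => //; exact: contX.
    by move=> x; rewrite normrM normrX ler_pM// lerXn2r ?nnegrE.
  rewrite normrM [`|4|]ger0_norm// => h.
  have h2 : 0 <= (24 * M ^+ 2 + 32 * M + 16) * sobolev_norm 1 v.
    by rewrite mulr_ge0// !addr_ge0// mulr_ge0.
  by move: h h2 n0; generalize (sobolev_norm 1 v) => n; move: (`|_|) => i; lra.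
move=> v sv; set n := sobolev_norm 1 v => n1.
have [lv _ _] := sobolev1P sv; have [_ mv _] := lv.
have [F [cF pF vF _ hF]] := sobolev1_rep sv.
have n0 : 0 <= n by exact: sobolev_norm_ge0.
have mF := continuous_measurable_fun cF.
have -> : I (fun x => Z x ^+ 3 * v x) = I (fun x => Z x ^+ 3 * F x).
  apply: I_ae.
  - by apply: measurable_funM => //; exact: measurable_funX.
  - by apply: measurable_funM => //; exact: measurable_funX.
  - exact: (ae_lift1 (fun x y => Z x ^+ 3 * y) vF).
have -> : L2norm (fun x => (z + v) x ^+ 2) ^+ 2 = I (fun x => (Z x + F x) ^+ 4).
  rewrite L2norm_sqr; apply: I_ae.
  - by do 2 apply: measurable_funX; exact: measurable_funD.
  - by apply: measurable_funX; exact: measurable_funD.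
  - have := ae_lift2 (fun x y w => (y + w) ^+ 4) zZ vF.
    by congr ae_eq; apply/funext => x; rewrite -exprM.
have c4 : continuous (fun x => Z x ^+ 4) by exact: contX.
have c3 : continuous (fun x => Z x ^+ 3 * F x) by apply: contM => //; exact: contX.
pose rest x := 6 * (Z x ^+ 2 * F x ^+ 2) + 4 * (Z x * F x ^+ 3) + F x ^+ 4.
have cr : continuous rest.
  by apply: contD; [apply: contD; apply: contZ; apply: contM => //; exact: contX|exact: contX].
have -> : I (fun x => (Z x + F x) ^+ 4) = I (fun x => Z x ^+ 4 + 4 * (Z x ^+ 3 * F x) + rest x).
  by apply: I_ext => x; rewrite /rest; ring.
have l4 := locint_cont c4; have l3 := locint_cont c3; have lr := locint_cont cr.
rewrite (I_D (locintD l4 (locintZ _ l3)) lr) (I_D l4 (locintZ _ l3)) I_Z//.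
rewrite remainder_simpl.
apply: le_trans (_ : (24 * M ^+ 2 + 32 * M + 16) * n ^+ 2 <= _); last first.
  by rewrite ler_wpM2r ?sqr_ge0// lerDr mulr_ge0.
apply: I_bound => // x.
have hZ := hM x; have h2F := hF x; rewrite -/n in h2F.
have F2 : `|F x| ^+ 2 <= (2 * n) ^+ 2 by rewrite lerXn2r ?nnegrE ?mulr_ge0.
have F3 : `|F x| ^+ 3 <= (2 * n) ^+ 3 by rewrite lerXn2r ?nnegrE ?mulr_ge0.
have F4 : `|F x| ^+ 4 <= (2 * n) ^+ 4 by rewrite lerXn2r ?nnegrE ?mulr_ge0.
have Z2 : `|Z x| ^+ 2 <= M ^+ 2 by rewrite lerXn2r ?nnegrE.
have n3 : n ^+ 3 <= n ^+ 2 by rewrite exprS ler_piMl ?sqr_ge0.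
have n4 : n ^+ 4 <= n ^+ 2 by rewrite -[4%N]/(2 + 2)%N exprD ler_piMl ?sqr_ge0// exprn_ile1.
rewrite /rest.
apply: le_trans (ler_normD _ _) _; apply: le_trans (lerD (ler_normD _ _) (lexx _)) _.
have a1 : `|6 * (Z x ^+ 2 * F x ^+ 2)| <= 6 * (M ^+ 2 * (2 * n) ^+ 2).
  by rewrite normrM ger0_norm// ler_wpM2l// normrM !normrX ler_pM ?exprn_ge0.
have a2 : `|4 * (Z x * F x ^+ 3)| <= 4 * (M * (2 * n) ^+ 3).
  by rewrite normrM ger0_norm// ler_wpM2l// normrM !normrX ler_pM ?exprn_ge0.
have a3 : `|F x ^+ 4| <= (2 * n) ^+ 4 by rewrite normrX.
have b2 : 4 * (M * (2 * n) ^+ 3) <= 32 * M * n ^+ 2.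
  have -> : 4 * (M * (2 * n) ^+ 3) = 32 * M * n ^+ 3 by ring.
  by rewrite ler_wpM2l// mulr_ge0.
have b3 : (2 * n) ^+ 4 <= 16 * n ^+ 2.
  have -> : (2 * n) ^+ 4 = 16 * n ^+ 4 by ring.
  by rewrite ler_wpM2l.
have b1 : 6 * (M ^+ 2 * (2 * n) ^+ 2) = 24 * M ^+ 2 * n ^+ 2 by ring.
rewrite b1 in a1.
have -> : (24 * M ^+ 2 + 32 * M + 16) * n ^+ 2 =
  24 * M ^+ 2 * n ^+ 2 + 32 * M * n ^+ 2 + 16 * n ^+ 2 by ring.
exact: lerD (lerD a1 (le_trans a2 b2)) (le_trans a3 b3).
Qed.

End base_expansions.

(** * Critical points *)

Section critical.
Variable R : realType.
Local Notation mu := (@lebesgue_measure R).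
Local Notation I f := (\int[mu]_(x in `[0%R, 1%R]) f x).

(** Along the ray p the two estimates for f - c leave |s L| <= C s^2 nu^2 + eps s nu; eps and s are
    chosen so that each term is at most s |L| / 4. The constants use nu + 1, as nu may be 0. *)
Lemma expansion_critical (T : Type) (V : T -> Prop) (n f l : T -> R) (c : R)
    (p : R -> T) (nu L : R) : expansion V n f (fun=> c) l ->
  (forall eps, 0 < eps -> exists2 d, 0 < d &
     forall v, V v -> n v <= d -> `|f v - c| <= eps * n v) ->
  (forall s, V (p s)) -> (forall s, n (p s) = `|s| * nu) ->
  (forall s, l (p s) = s * L) -> 0 <= nu -> L = 0.
Proof.
move=> [C [e [C0 e0 _ _ h]]] hf pV pn pl nu0; apply/eqP/negPn/negP => Ln0.
have L0 : 0 < `|L| by rewrite normr_gt0.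
have nu1 : 0 < nu + 1 by rewrite ltr_wpDl.
have [d d0 hd] := hf (`|L| / (4 * (nu + 1))) (divr_gt0 L0 (mulr_gt0 (ltr0n _ 4) nu1)).
have Cn : 0 < C * nu ^+ 2 + 1 by rewrite ltr_wpDl// mulr_ge0// sqr_ge0.
pose s := Num.min (Num.min e d / (nu + 1)) (`|L| / (4 * (C * nu ^+ 2 + 1))).
have s0 : 0 < s.
  by rewrite !lt_min divr_gt0 ?lt_min ?e0 ?d0// divr_gt0// mulr_gt0.
have sn : s * nu <= Num.min e d.
  apply: (@le_trans _ _ (s * (nu + 1))); first by rewrite ler_wpM2l ?(ltW s0)// lerDl.
  by rewrite -ler_pdivlMr// ge_min lexx.
have sC : s * (4 * (C * nu ^+ 2 + 1)) <= `|L|.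
  by rewrite -ler_pdivlMr ?mulr_gt0// ge_min lexx orbT.
clearbody s.
have nps : n (p s) = s * nu by rewrite pn gtr0_norm.
move: sn; rewrite le_min -nps => /andP[se sd].
have h1 := h _ (pV s) se; have h2 := hd _ (pV s) sd.
have h3 : `|l (p s)| <= `|f (p s) - c - l (p s)| + `|f (p s) - c|.
  have := ler_normB (f (p s) - c - l (p s)) (f (p s) - c).
  by have -> : f (p s) - c - l (p s) - (f (p s) - c) = - l (p s); [ring|rewrite normrN].
have h4 : `|L| / (4 * (nu + 1)) * n (p s) <= s * `|L| / 4.
  have -> : `|L| / (4 * (nu + 1)) * n (p s) = s * `|L| / 4 * (nu / (nu + 1)).
    by rewrite nps; field; rewrite gt_eqF.
  by rewrite ler_piMr ?divr_ge0 ?mulr_ge0 ?(ltW s0)// ler_pdivrMr// mul1r lerDl.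
have h5 : C * n (p s) ^+ 2 <= s * `|L| / 4.
  have -> : C * n (p s) ^+ 2 = s * (s * (C * nu ^+ 2)) by rewrite nps; ring.
  by rewrite -mulrA ler_wpM2l ?(ltW s0)//; lra.
have h6 : `|l (p s)| = s * `|L| by rewrite pl normrM gtr0_norm.
have h7 := le_trans h3 (lerD (le_trans h1 h5) (le_trans h2 h4)).
rewrite h6 in h7; have h8 := mulr_gt0 s0 L0.
by move: h7 h8; clear; lra.
Qed.

Variables (r : R) (z : R -> R).
Hypothesis r0 : 0 <= r.
Hypothesis hz : critical_point r z.

Let star : sobolev_star 1 z. Proof. by case: hz. Qed.
Let sz : sobolev 1 z. Proof. by case: star. Qed.

Lemma L2norm_gt0 (f : R -> R) : L2 f -> ~ (f = cst 0 %[ae mu]) -> 0 < L2norm f.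
Proof.
move=> lf nf; rewrite lt_neqAle L2norm_ge0 andbT; apply/eqP => e.
by apply: nf; apply: L2norm_eq0.
Qed.

Section representative.
Variable Z : R -> R.
Hypotheses (cZ : continuous Z) (pZ : periodic Z 1) (zZ : z = Z %[ae mu]).
Local Notation N := (I (fun x => Z x ^+ 2)).
Local Notation D := (I (fun x => wderiv z x ^+ 2)).
Local Notation Q := (I (fun x => Z x ^+ 4)).

Let Lz : L2 z. Proof. by have [] := sobolev1P sz. Qed.
Let LZ : L2 Z. Proof. exact: L2_cont. Qed.
Let mz : measurable_fun [set: R] z. Proof. by case: Lz. Qed.
Let mZ : measurable_fun [set: R] Z. Proof. by case: LZ. Qed.

Lemma L2norm_sqrE : L2norm z ^+ 2 = N.
Proof. by rewrite (L2norm_ae mz mZ zZ) L2norm_sqr. Qed.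

Lemma L2norm_quarticE : L2norm (fun x => z x ^+ 2) ^+ 2 = Q.
Proof.
rewrite (L2norm_ae (measurable_funX 2 mz) (measurable_funX 2 mZ) (ae_lift1 (fun _ y => y ^+ 2) zZ)).
by rewrite L2norm_sqr; apply: I_ext => x; rewrite -exprM.
Qed.

Lemma L2norm_sqr_gt0 : 0 < N.
Proof. by rewrite -L2norm_sqrE exprn_gt0// L2norm_gt0//; case: star. Qed.

(** The Cauchy-Schwarz inequality for Z^2 and 1 gives N <= Q^(1/2). *)
Lemma L2norm_quartic_gt0 : 0 < Q.
Proof.
have lZ2 : L2 (fun x => Z x ^+ 2) by apply: L2_cont; [move=> x; rewrite pZ|exact: contX].
rewrite -L2norm_quarticE exprn_gt0//.
have := L2_CS lZ2 (L2_cst 1); rewrite L2norm_cst normr1 mulr1.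
have -> : I (fun x => Z x ^+ 2 * 1) = N by apply: I_ext => x; rewrite mulr1.
rewrite (L2norm_ae (measurable_funX 2 mz) (measurable_funX 2 mZ) (ae_lift1 (fun _ y => y ^+ 2) zZ)).
by apply: lt_le_trans; rewrite normr_gt0 gt_eqF// L2norm_sqr_gt0.
Qed.

Lemma coef_bE : coef_b r z = 1 / N ^+ 3 - D / N - r / (2 * N * Q).
Proof.
rewrite /coef_b L2norm_sqrE L2norm_quarticE L2norm_sqr.
by have -> : L2norm z ^+ 6 = N ^+ 3 by rewrite -L2norm_sqrE -exprM.
Qed.

Lemma coef_aE : coef_a r z = r / (2 * Q ^+ 2).
Proof. by rewrite /coef_a -L2norm_quarticE -exprM. Qed.

Definition first_variation (v : R -> R) : R :=
  2 * (N * (2 * I (fun x => wderiv z x * wderiv v x)) + D * (2 * I (fun x => Z x * v x)))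
  + 2 * (- (2 * I (fun x => Z x * v x)) / N ^+ 2)
  + r * (N * (- (4 * I (fun x => Z x ^+ 3 * v x)) / Q ^+ 2) + Q^-1 * (2 * I (fun x => Z x * v x))).

Lemma expansion_functional : expansion (@sobolev R 1) (@sobolev_norm R 1)
  (fun v => functional r (z + v)) (fun=> functional r z) first_variation.
Proof.
have n0 := @sobolev_norm_ge0 R 1.
have eN := expansion_norm sz zZ cZ pZ; have eD := expansion_deriv sz.
have eQ := expansion_quartic sz zZ cZ pZ.
have -> : functional r z = 2 * (N * D) + 2 * N^-1 + r * (N * Q^-1).
  by rewrite /functional L2norm_sqrE L2norm_quarticE L2norm_sqr; ring.
have := expansion_add (expansion_add (expansion_scale n0 2 (expansion_mul n0 eN eD))
  (expansion_scale n0 2 (expansion_inv n0 L2norm_sqr_gt0 eN)))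
  (expansion_scale n0 r (expansion_mul n0 eN (expansion_inv n0 L2norm_quartic_gt0 eQ))).
by apply: expansion_ext => v sv //; rewrite /functional; ring.
Qed.

Lemma first_variation_test phi : test_function phi -> first_variation phi = 0.
Proof.
move=> tphi; have [pphi _ cphi1] := tphi; have hphi := test_has_deriv tphi.
have [lphi lphi1] := test_L2 tphi.
have wphi := has_deriv_weak hphi cphi1 pphi.
have [_ _ _ _ hder] := hz.
pose p (s : R) := fun x => s * phi x.
have wp s : weak_derivative (p s) (fun x => s * derive1 phi x).
  apply: (@has_deriv_weak _ (p s)); first by move=> x; exact: deriv_scale.
    exact: contZ.
  by move=> x; rewrite /p pphi.
have Lp s : L2 (p s) by exact: L2_scale.
have Lp1 s : L2 (fun x => s * derive1 phi x) by exact: L2_scale.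
have sp s : sobolev 1 (p s) by exact: sobolev1I (wp s).
have e1 s : wderiv (p s) = (fun x => s * derive1 phi x) %[ae mu] by exact: wderiv_eq_ae.
have e0 : wderiv phi = derive1 phi %[ae mu] by exact: wderiv_eq_ae.
have [_ [_ mz' _] _] := sobolev1P sz.
have [_ mphi1 _] := lphi1.
have I1 s : I (fun x => wderiv z x * wderiv (p s) x) = s * I (fun x => wderiv z x * wderiv phi x).
  have -> : I (fun x => wderiv z x * wderiv phi x) = I (fun x => wderiv z x * derive1 phi x).
    apply: I_ae; [|exact: measurable_funM|exact: (ae_lift1 (fun x y => wderiv z x * y) e0)].
    by apply: measurable_funM => //; have [_ [_ ? _] _] := sobolev1P (sobolev1I lphi lphi1 wphi).
  have -> : I (fun x => wderiv z x * wderiv (p s) x) = I (fun x => wderiv z x * (s * derive1 phi x)).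
    apply: I_ae; [| |exact: (ae_lift1 (fun x y => wderiv z x * y) (e1 s))].
      by apply: measurable_funM => //; have [_ [_ ? _] _] := sobolev1P (sp s).
    by apply: measurable_funM => //; case: (Lp1 s).
  rewrite -I_Z; last by apply: L2_mul => //; have [] := sobolev1P sz.
  by apply: I_ext => x; ring.
have I2 s : I (fun x => Z x * p s x) = s * I (fun x => Z x * phi x).
  rewrite -I_Z; last exact: L2_mul.
  by apply: I_ext => x; rewrite /p; ring.
have I3 s : I (fun x => Z x ^+ 3 * p s x) = s * I (fun x => Z x ^+ 3 * phi x).
  rewrite -I_Z; last by apply/locint_cont/contM; [exact: contX|exact: has_deriv_cont hphi].
  by apply: I_ext => x; rewrite /p; ring.
apply: (expansion_critical (p := p) (nu := sobolev_norm 1 phi) expansion_functional) => //.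
- move=> eps eps0; have [d d0 hd] := hder eps eps0.
  have [d' d'0 hd'] := expansion_pos (@sobolev_norm_ge0 R 1) (expansion_norm sz zZ cZ pZ) L2norm_sqr_gt0.
  exists (Num.min d d'); first by rewrite lt_min d0.
  move=> v sv; rewrite le_min => /andP[vd vd'].
  have [szv _ _] := wderiv_addE sz sv.
  (* The derivative of the functional only tests directions for which z + v is not the zero class;
     for small v this holds, since then the squared norm of z + v is at least N / 2. *)
  have star' : sobolev_star 1 (z + v).
    split => // h; have := hd' v sv vd'; have [lzv _ _] := sobolev1P szv.
    by rewrite (L2norm_cst0 lzv h) expr0n/= leNgt divr_gt0// L2norm_sqr_gt0.
  by have := hd v sv star' vd; rewrite subr0.
- move=> s; rewrite !sobolev_norm1 /p (L2norm_scale s lphi).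
  have -> : L2norm (wderiv (p s)) = `|s| * L2norm (wderiv phi).
    have [_ lw _] := sobolev1P (sobolev1I lphi lphi1 wphi).
    rewrite -(L2norm_scale s lw); apply: L2norm_ae.
    + by have [_ [_ ? _] _] := sobolev1P (sp s).
    + by case: (L2_scale s lw).
    + have := ae_lift1 (fun _ y => s * y) (ae_eq_sym e0); apply: ae_eq_trans; exact: e1.
  rewrite !exprMn -mulrDr sqrtrM ?sqr_ge0// sqrtr_sqr normr_id//.
- move=> s; rewrite /first_variation I1 I2 I3; move: N Q D => n q d.
  move: (I (fun x => wderiv z x * wderiv phi x)) (I (fun x => Z x * phi x)) => A B.
  by move: (I (fun x => Z x ^+ 3 * phi x)) => C; ring.
- exact: sobolev_norm_ge0.
Qed.

Lemma critical_weak : weak_derivative (wderiv z)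
  (fun x => - (coef_b r z * Z x + 2 * coef_a r z * Z x ^+ 3)).
Proof.
move=> phi tphi; have [pphi _ cphi1] := tphi; have hphi := test_has_deriv tphi.
have [lphi lphi1] := test_L2 tphi.
have wphi := has_deriv_weak hphi cphi1 pphi.
have e0 : wderiv phi = derive1 phi %[ae mu] by exact: wderiv_eq_ae.
have [_ Lz' _] := sobolev1P sz; have [_ mz' _] := Lz'; have [_ mphi1 _] := lphi1.
have := first_variation_test tphi; rewrite /first_variation.
have -> : I (fun x => wderiv z x * wderiv phi x) = I (fun x => wderiv z x * derive1 phi x).
  apply: I_ae; [|exact: measurable_funM|exact: (ae_lift1 (fun x y => wderiv z x * y) e0)].
  by apply: measurable_funM => //; have [_ [_ ? _] _] := sobolev1P (sobolev1I lphi lphi1 wphi).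
have la : locint (fun x => Z x * phi x) by exact: L2_mul.
have lb : locint (fun x => Z x ^+ 3 * phi x).
  by apply/locint_cont/contM; [exact: contX|exact: has_deriv_cont hphi].
have -> : I (fun x => - (coef_b r z * Z x + 2 * coef_a r z * Z x ^+ 3) * phi x) =
  - coef_b r z * I (fun x => Z x * phi x) + (- (2 * coef_a r z)) * I (fun x => Z x ^+ 3 * phi x).
  rewrite -(I_Z _ la) -(I_Z _ lb) -(I_D (locintZ _ la) (locintZ _ lb)).
  by apply: I_ext => x; ring.
have N0 := L2norm_sqr_gt0; have Q0 := L2norm_quartic_gt0.
rewrite coef_bE coef_aE.
set A := I (fun x => wderiv z x * _); set B := I (fun x => Z x * phi x).
set C := I (fun x => Z x ^+ 3 * phi x).
(* The first variation is 4 N times the weak form of the Duffing equation. *)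
move=> h; apply: (@mulfI _ (4 * N)); first by rewrite mulf_neq0// gt_eqF.
by apply/eqP; rewrite -subr_eq0; apply/eqP; apply: etrans h; field; rewrite !gt_eqF.
Qed.

End representative.
End critical.

(** * Regularity of weak solutions *)

Section regularity.
Variable R : realType.
Local Notation mu := (@lebesgue_measure R).
Local Notation I f := (\int[mu]_(x in `[0%R, 1%R]) f x).

Lemma prim_ae (f g : R -> R) : measurable_fun [set: R] f -> measurable_fun [set: R] g ->
  f = g %[ae mu] -> prim f = prim g.
Proof.
move=> mf mg fg; apply/funext => x.
have h a b : \int[mu]_(t in `[a, b]) f t = \int[mu]_(t in `[a, b]) g t.
  rewrite /Rintegral; congr fine.
  apply: ae_eq_integral => //; try by apply/measurable_EFinP; exact: measurable_funTS.
  have e := ae_eq_comp EFin fg.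
  exact: ae_eq_subset (@subsetT _ _) e.
by rewrite /prim !h.
Qed.

(** Two applications of the du Bois-Reymond lemma: f' is almost everywhere a constant plus prim h,
    and f a constant plus the primitive of that. F is this second function, as continuous functions
    that agree almost everywhere are equal. *)
Lemma weak_ode_regular (f F h : R -> R) : sobolev 1 f -> continuous F -> periodic F 1 ->
  f = F %[ae mu] -> continuous h -> periodic h 1 -> weak_derivative (wderiv f) h ->
  exists F1 : R -> R, [/\ has_deriv F F1, has_deriv F1 h, periodic F1 1 &
    wderiv f = F1 %[ae mu]].
Proof.
move=> sf cF pF fF ch ph wh; have [lf lf1 _] := sobolev1P sf.
have [F0 [cF0 pF0 fF0 [c F0E] _]] := sobolev1_rep sf.
have FF0 : F = F0 by apply: ae_cont_eq => //; apply: ae_eq_trans fF0; exact: ae_eq_sym.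
have [pf1 mf1 _] := lf1.
have lh := locint_cont ch.
have [Ih [c1 e1]] := du_bois_reymond pf1 (L2_locint lf1) ph lh wh.
have hF1 : has_deriv (fun x => c1 + prim h x) h.
  by move=> x; apply: deriv_val (deriv_add (deriv_cst c1 x) (prim_deriv ch x)) _; rewrite add0r.
exists (fun x => c1 + prim h x); split => //; last by move=> x; rewrite prim_periodic.
have cF1 := has_deriv_cont hF1.
rewrite FF0 F0E (prim_ae mf1 (continuous_measurable_fun cF1) e1).
by move=> x; apply: deriv_val (deriv_add (deriv_cst c x) (prim_deriv cF1 x)) _; rewrite add0r.
Qed.

Lemma critical_regular (r : R) (z : R -> R) : critical_point r z ->
  exists Z Z1 : R -> R, [/\ z = Z %[ae mu], periodic Z 1, has_deriv Z Z1,
    has_deriv Z1 (fun x => - (coef_b r z * Z x + 2 * coef_a r z * Z x ^+ 3)) &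
    wderiv z = Z1 %[ae mu]].
Proof.
move=> hz; have [[sz nz] _ _ _ _] := hz.
have [Z [cZ pZ zZ _ _]] := sobolev1_rep sz.
have ch : continuous (fun x => - (coef_b r z * Z x + 2 * coef_a r z * Z x ^+ 3)).
  by apply: contN; apply: contD; apply: contZ => //; exact: contX.
have ph : periodic (fun x => - (coef_b r z * Z x + 2 * coef_a r z * Z x ^+ 3)) 1.
  by move=> x; rewrite pZ.
have [Z1 [h1 h2 h3 h4]] := weak_ode_regular sz cZ pZ zZ ch ph (critical_weak hz cZ pZ zZ).
by exists Z, Z1.
Qed.

Lemma classical_sobolev2 (f f1 f2 : R -> R) : has_deriv f f1 -> has_deriv f1 f2 ->
  continuous f2 -> periodic f 1 ->
  [/\ sobolev 2 f, wderiv f = f1 %[ae mu] & wderiv (wderiv f) = f2 %[ae mu]].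
Proof.
move=> hf hf1 cf2 pf; have cf1 := has_deriv_cont hf1; have cf := has_deriv_cont hf.
have pf1 := periodic_deriv hf pf; have pf2 := periodic_deriv hf1 pf1.
have lf := L2_cont pf cf; have lf1 := L2_cont pf1 cf1; have lf2 := L2_cont pf2 cf2.
have w1 := has_deriv_weak hf cf1 pf; have w2 := has_deriv_weak hf1 cf2 pf1.
have e1 := wderiv_eq_ae lf lf1 w1.
have [lw _] := wderivP lf1 w1.
split => //.
  by split => //; exists f1; split => //; exact: (sobolev1I lf1 lf2 w2).
by rewrite (wderiv_congr lw lf1 e1); exact: wderiv_eq_ae.
Qed.

(** Made for the gradient and the Hessian, where only the second derivative w is estimated in L^2
    and all other terms have a continuous representative H with a uniform bound. *)
Lemma L2norm_ae_bound (h w H : R -> R) (k B : R) : measurable_fun [set: R] h -> L2 w ->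
  continuous H -> periodic H 1 -> (forall x, `|H x| <= B) ->
  h = (fun x => k * w x + H x) %[ae mu] -> L2norm h <= `|k| * L2norm w + B.
Proof.
move=> mh lw cH pH hB hE; have lH := L2_cont pH cH; have lkw := L2_scale k lw.
have [_ mkw _] := lkw; have [_ mH _] := lH.
rewrite (L2norm_ae mh (measurable_funD mkw mH) hE).
apply: le_trans (L2norm_triangle lkw lH) _; rewrite (L2norm_scale k lw) lerD2l.
have B0 : 0 <= B by exact: le_trans (hB 0).
rewrite /L2norm -(ger0_norm B0) -sqrtr_sqr ler_wsqrtr// -[leRHS]I_cst.
apply: I_le; [exact: L2_sqr|exact: locint_cst|] => x.
by rewrite -[H x ^+ 2]real_normK ?num_real// lerXn2r ?nnegrE.
Qed.

End regularity.

(** * The Hessian *)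

Section hessian.
Variable R : realType.
Local Notation mu := (@lebesgue_measure R).
Local Notation I f := (\int[mu]_(x in `[0%R, 1%R]) f x).

(** Writes b as a polynomial in quantities whose expansions are known, so that the sum and product
    rules apply. *)
Lemma coef_b_inv (r : R) f : coef_b r f =
  (L2norm f ^+ 2)^-1 * ((L2norm f ^+ 2)^-1 * (L2norm f ^+ 2)^-1)
  + -1 * (L2norm (wderiv f) ^+ 2 * (L2norm f ^+ 2)^-1)
  + - (r / 2) * ((L2norm f ^+ 2)^-1 * (L2norm (fun x => f x ^+ 2) ^+ 2)^-1).
Proof.
rewrite /coef_b; have -> : L2norm f ^+ 6 = (L2norm f ^+ 2) ^+ 3 by rewrite -exprM.
rewrite -[((L2norm f ^+ 2) ^+ 3)^-1]exprVn !invfM.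
by ring.
Qed.

Lemma coef_a_inv (r : R) f : coef_a r f =
  (r / 2) * ((L2norm (fun x => f x ^+ 2) ^+ 2)^-1 * (L2norm (fun x => f x ^+ 2) ^+ 2)^-1).
Proof.
rewrite /coef_a; have -> : L2norm (fun x => f x ^+ 2) ^+ 4 = (L2norm (fun x => f x ^+ 2) ^+ 2) ^+ 2 by rewrite -exprM.
by rewrite invfM -exprVn; ring.
Qed.

Variables (r : R) (z Z Z1 : R -> R).
Hypothesis r0 : 0 <= r.
Hypothesis hz : critical_point r z.
Hypothesis zZ : z = Z %[ae mu].
Hypothesis pZ : periodic Z 1.
Hypothesis hZ : has_deriv Z Z1.
Local Notation a := (coef_a r z).
Local Notation b := (coef_b r z).
Hypothesis hZ1 : has_deriv Z1 (fun x => - (b * Z x + 2 * a * Z x ^+ 3)).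
Hypothesis zZ1 : wderiv z = Z1 %[ae mu].
Local Notation N := (I (fun x => Z x ^+ 2)).
Local Notation D := (I (fun x => wderiv z x ^+ 2)).
Local Notation Q := (I (fun x => Z x ^+ 4)).
Local Notation alpha v := (I (fun x => Z x * v x)).
Local Notation beta v := (I (fun x => Z x ^+ 3 * v x)).
Local Notation gamma v := (I (fun x => wderiv z x * wderiv v x)).

Let cZ : continuous Z := has_deriv_cont hZ.
Let sz : sobolev 1 z. Proof. by case: hz => -[]. Qed.
Let N0 : 0 < N. Proof. exact: (L2norm_sqr_gt0 hz cZ pZ zZ). Qed.
Let Q0 : 0 < Q. Proof. exact: (L2norm_quartic_gt0 hz cZ pZ zZ). Qed.
Let bE : b = 1 / N ^+ 3 - D / N - r / (2 * N * Q).
Proof. exact: (coef_bE hz cZ pZ zZ). Qed.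
Let aE : a = r / (2 * Q ^+ 2).
Proof. exact: (coef_aE hz cZ pZ zZ). Qed.

(** The derivative of b in the direction v; N, D and Q vary by 2 alpha, 2 gamma and 4 beta.
    Similarly, [hess_a] is the derivative of a. *)
Definition hess_b v := - (6 * alpha v / N ^+ 4) - 2 * gamma v / N + 2 * D * alpha v / N ^+ 2
  + r * alpha v / (N ^+ 2 * Q) + 2 * r * beta v / (N * Q ^+ 2).
Definition hess_a v := - (4 * r * beta v / Q ^+ 3).

(* Separating v from its continuous representative F makes the pointwise        *)
(* estimates on the lower order terms hold everywhere.                         *)
Definition hess_low v F x := b * F x + 6 * a * Z x ^+ 2 * F x + hess_b v * Z x
  + 2 * hess_a v * Z x ^+ 3.

(** The variation of the prefactor -4 ||z||^2 of the gradient does not appear, because the bracket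
    it multiplies vanishes at a critical point. *)
Definition hess v x := - 4 * N * (wderiv (wderiv v) x + hess_low v v x).

Local Notation expansion1 := (expansion (@sobolev R 1) (@sobolev_norm R 1)).

Lemma expansion_coef_b : expansion1 (fun v => coef_b r (z + v)) (fun=> b) hess_b.
Proof.
have n0 := @sobolev_norm_ge0 R 1.
have eN := expansion_inv n0 N0 (expansion_norm sz zZ cZ pZ).
have eD := expansion_deriv sz.
have eQ := expansion_inv n0 Q0 (expansion_quartic sz zZ cZ pZ).
have := expansion_add (expansion_add (expansion_mul n0 eN (expansion_mul n0 eN eN))
  (expansion_scale n0 (-1) (expansion_mul n0 eD eN)))
  (expansion_scale n0 (- (r / 2)) (expansion_mul n0 eN eQ)).
apply: expansion_ext => v sv; first by rewrite coef_b_inv.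
- by rewrite bE; field; rewrite !gt_eqF.
- rewrite /hess_b; move: (alpha v) (beta v) (gamma v) => A B G; move: N0 Q0.
  move: N Q D => n q d n0' q0'.
  by field; rewrite !gt_eqF.
Qed.

Lemma expansion_coef_a : expansion1 (fun v => coef_a r (z + v)) (fun=> a) hess_a.
Proof.
have n0 := @sobolev_norm_ge0 R 1.
have eQ := expansion_inv n0 Q0 (expansion_quartic sz zZ cZ pZ).
have := expansion_scale n0 (r / 2) (expansion_mul n0 eQ eQ).
apply: expansion_ext => v sv; first by rewrite coef_a_inv.
- by rewrite aE; field; rewrite !gt_eqF.
- by rewrite /hess_a; field; rewrite !gt_eqF.
Qed.

Let T3 := ((R -> R) * (R -> R) * R)%type.
(* Adding the point x to the data makes first-order expansions uniform in x. *)
Definition reps (t : T3) : Prop := [/\ sobolev 2 t.1.1, continuous t.1.2,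
  periodic t.1.2 1, t.1.1 = t.1.2 %[ae mu] &
  forall x, `|t.1.2 x| <= 2 * sobolev_norm 2 t.1.1].

Lemma reps_exists v : sobolev 2 v -> exists F, forall x, reps (v, F, x).
Proof.
move=> sv; have [sv1 _] := sobolev2P sv; have [F [cF pF vF _ hF]] := sobolev1_rep sv1.
exists F => x; split => // y; apply: le_trans (hF y) _.
by rewrite ler_wpM2l// sobolev_norm12.
Qed.

(** This is the gradient at z + v, up to the factor -4, with z'' replaced through the Duffing
    equation and without the term v'', which has no pointwise bound. By the Duffing equation the
    zeroth-order term cancels. *)
Lemma expansion_gradient : expansion reps (fun t => sobolev_norm 2 t.1.1)
  (fun t => L2norm (z + t.1.1) ^+ 2 * (- (b * Z t.2 + 2 * a * Z t.2 ^+ 3)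
     + coef_b r (z + t.1.1) * (Z t.2 + t.1.2 t.2)
     + 2 * coef_a r (z + t.1.1) * (Z t.2 + t.1.2 t.2) ^+ 3))
  (fun=> 0) (fun t => N * hess_low t.1.1 t.1.2 t.2).
Proof.
have n0 (t : T3) : 0 <= sobolev_norm 2 t.1.1 by exact: sobolev_norm_ge0.
have n1 := @sobolev_norm_ge0 R 1.
have hV (t : T3) : reps t -> sobolev 1 t.1.1 by move=> [/sobolev2P[]].
have hn (t : T3) : reps t -> sobolev_norm 1 t.1.1 <= sobolev_norm 2 t.1.1.
  by move=> _; exact: sobolev_norm12.
have eN := expansion_comp n1 hV hn (expansion_norm sz zZ cZ pZ).
have eb := expansion_comp n1 hV hn expansion_coef_b.
have ea := expansion_comp n1 hV hn expansion_coef_a.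
have [M M0 hM] := periodic_cont_bounded ltr01 pZ cZ.
have eZ : expansion reps (fun t => sobolev_norm 2 t.1.1) (fun t => Z t.2) (fun t => Z t.2) (fun=> 0).
  by apply: expansion_bounded (fun t _ => hM t.2).
have eF : expansion reps (fun t => sobolev_norm 2 t.1.1) (fun t => t.1.2 t.2) (fun=> 0)
    (fun t => t.1.2 t.2).
  by apply: (@expansion_linear _ _ _ _ _ _ 2) => // t [_ _ _ _ h]; exact: h.
have eZF := expansion_add eZ eF.
have e0 := expansion_add (expansion_scale n0 b eZ)
  (expansion_scale n0 (2 * a) (expansion_mul n0 eZ (expansion_mul n0 eZ eZ))).
have := expansion_mul n0 eN (expansion_add (expansion_add (expansion_scale n0 (-1) e0)
  (expansion_mul n0 eb eZF)) (expansion_mul n0 (expansion_scale n0 2 ea)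
    (expansion_mul n0 eZF (expansion_mul n0 eZF eZF)))).
apply: expansion_ext => t _; rewrite /hess_low; ring.
Qed.

Lemma pairing_lin (g v w : R -> R) (c : R) : L2 g -> L2 v -> L2 w ->
  I (fun x => g x * (c * v x + w x)) = c * I (fun x => g x * v x) + I (fun x => g x * w x).
Proof.
move=> lg lv lw; have l1 := L2_mul lg lv; have l2 := L2_mul lg lw.
by rewrite -(I_Z c l1) -(I_D (locintZ c l1) l2); apply: I_ext => x; ring.
Qed.

Let lZ : L2 Z. Proof. exact: L2_cont. Qed.
Let lZ3 : L2 (fun x => Z x ^+ 3).
Proof. by apply: L2_cont; [move=> x; rewrite pZ|exact: contX]. Qed.

Lemma hess_lin_algebra (n a b y B B' A A' c w w' v v' : R) :
  -4 * n * (c * w + w' + (b * (c * v + v') + 6 * a * y ^+ 2 * (c * v + v')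
    + (c * B + B') * y + 2 * (c * A + A') * y ^+ 3)) =
  c * (-4 * n * (w + (b * v + 6 * a * y ^+ 2 * v + B * y + 2 * A * y ^+ 3)))
  + -4 * n * (w' + (b * v' + 6 * a * y ^+ 2 * v' + B' * y + 2 * A' * y ^+ 3)).
Proof. by ring. Qed.

Lemma hess_lin c v w : sobolev 2 v -> sobolev 2 w ->
  hess (fun x => c * v x + w x) = (fun x => c * hess v x + hess w x) %[ae mu].
Proof.
move=> sv sw; have [_ e2] := sobolev2_lin c sv sw.
have [sv1 _] := sobolev2P sv; have [sw1 _] := sobolev2P sw.
have [s1 e1] := sobolev1_lin c sv1 sw1.
have [lv lv' _] := sobolev1P sv1; have [lw lw' _] := sobolev1P sw1.
have [_ [_ m1 _] _] := sobolev1P s1; have [_ lz' _] := sobolev1P sz.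
have [_ mz' _] := lz'; have [_ mv' _] := lv'; have [_ mw' _] := lw'.
have eg : gamma (fun x => c * v x + w x) = c * gamma v + gamma w.
  rewrite -(pairing_lin c lz' lv' lw'); apply: I_ae.
  - exact: measurable_funM.
  - apply: measurable_funM => //; apply: measurable_funD => //.
    by apply: measurable_funM => //; exact: measurable_cst.
  - exact: (ae_lift1 (fun x y => wderiv z x * y) e1).
have eb : hess_b (fun x => c * v x + w x) = c * hess_b v + hess_b w.
  rewrite /hess_b eg (pairing_lin c lZ lv lw) (pairing_lin c lZ3 lv lw).
  move: (alpha v) (beta v) (gamma v) (alpha w) (beta w) (gamma w) => A B G A' B' G'.
  by move: N Q D => n q d; ring.
have ea : hess_a (fun x => c * v x + w x) = c * hess_a v + hess_a w.
  by rewrite /hess_a (pairing_lin c lZ3 lv lw); move: (beta v) (beta w) Q => B B' q; ring.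
apply: (@filterS _ _ (ae_filter_ringOfSetsType mu) _ _ _ e2) => x /= h _.
by rewrite /hess /hess_low h// eb ea; exact: hess_lin_algebra.
Qed.

Lemma hess_L2 v : sobolev 2 v -> L2 (hess v).
Proof.
move=> sv; have [sv1 sv2] := sobolev2P sv; have [lv _ _] := sobolev1P sv1.
have [_ lw _] := sobolev1P sv2.
have cg : continuous (fun x => b + 6 * a * Z x ^+ 2).
  by apply: contD; [exact: contC|apply: contZ; exact: contX].
have pg : periodic (fun x => b + 6 * a * Z x ^+ 2) 1 by move=> x; rewrite pZ.
have [M _ hM] := periodic_cont_bounded ltr01 pg cg.
have l1 := L2_bmul lv pg (continuous_measurable_fun cg) hM.
have := L2_scale (-4 * N) (L2_add lw (L2_add l1
  (L2_add (L2_scale (hess_b v) lZ) (L2_scale (2 * hess_a v) lZ3)))).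
by congr L2; apply/funext => x; rewrite /hess /hess_low; ring.
Qed.

Lemma gradient_L2 f : sobolev 2 f -> L2 (gradient r f).
Proof.
move=> sf; have [sf1 sf2] := sobolev2P sf; have [lf _ _] := sobolev1P sf1.
have [_ lw _] := sobolev1P sf2; have [pf mf _] := lf.
have [F [cF pF fF _ _]] := sobolev1_rep sf1.
have l3 : L2 (fun x => f x ^+ 3).
  apply: (@L2_ae _ (fun x => F x ^+ 3)).
  - by apply: L2_cont; [move=> x; rewrite pF|exact: contX].
  - by move=> x; rewrite pf.
  - exact: measurable_funX.
  - exact: (ae_lift1 (fun _ y => y ^+ 3) (ae_eq_sym fF)).
have := L2_scale (-4 * L2norm f ^+ 2) (L2_add (L2_add lw (L2_scale (coef_b r f) lf))
  (L2_scale (2 * coef_a r f) l3)).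
by congr L2; apply/funext => x; rewrite /gradient; ring.
Qed.

Lemma hess_rep v F : v = F %[ae mu] ->
  hess v = (fun x => -4 * N * wderiv (wderiv v) x + -4 * N * hess_low v F x) %[ae mu].
Proof.
move=> vF; apply: (@filterS _ _ (ae_filter_ringOfSetsType mu) _ _ _ vF) => x /= h _.
by rewrite /hess /hess_low h//; ring.
Qed.

Lemma hess_low_cont v F : continuous F -> continuous (hess_low v F).
Proof.
move=> cF; rewrite /hess_low.
apply: contD; [apply: contD; [apply: contD|]|]; try by apply: contZ => //; exact: contX.
by apply: contM => //; apply: contZ; exact: contX.
Qed.

Lemma hess_low_periodic v F : periodic F 1 -> periodic (hess_low v F) 1.
Proof. by move=> pF x; rewrite /hess_low pZ pF. Qed.

Lemma hess_bounded : exists C, forall v, sobolev 2 v ->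
  L2norm (hess v) <= C * sobolev_norm 2 v.
Proof.
have [C [e [C0 e0 _ h1 _]]] := expansion_gradient.
exists (4 * N + 4 * C) => v sv; have [F hF] := reps_exists sv.
have [_ /= cF pF vF _] := hF 0.
have [_ mh _] := hess_L2 sv.
have [_ sv2] := sobolev2P sv; have [_ lw _] := sobolev1P sv2.
have := L2norm_ae_bound mh lw (H := fun x => -4 * N * hess_low v F x)
  (B := 4 * (C * sobolev_norm 2 v)) _ _ _ (hess_rep vF).
have -> : `|-4 * N| = 4 * N by rewrite normrM (gtr0_norm N0) normrN ger0_norm.
have N4 : 0 <= 4 * N by rewrite mulr_ge0// ltW.
have h2 : 4 * N * L2norm (wderiv (wderiv v)) <= 4 * N * sobolev_norm 2 v.
  by rewrite ler_wpM2l// L2norm_wderiv2_le2.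
have -> : (4 * N + 4 * C) * sobolev_norm 2 v =
  4 * N * sobolev_norm 2 v + 4 * (C * sobolev_norm 2 v) by ring.
move=> h; apply: le_trans (h _ _ _) (lerD h2 (lexx _)).
- by apply: contZ; exact: hess_low_cont.
- by move=> x; rewrite hess_low_periodic.
- move=> x; have := h1 _ (hF x); rewrite /= => h3.
  rewrite -mulrA normrM normrN (@ger0_norm _ 4)//.
  by rewrite ler_wpM2l.
Qed.

Lemma gradient_eq0 : [/\ sobolev 2 z, gradient r z = cst 0 %[ae mu] &
  wderiv (wderiv z) = (fun x => - (b * Z x + 2 * a * Z x ^+ 3)) %[ae mu]].
Proof.
have [_ lz' _] := sobolev1P sz.
have ch : L2 (fun x => - (b * Z x + 2 * a * Z x ^+ 3)).
  by apply/L2_opp/L2_add; exact: L2_scale.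
have wz := critical_weak hz cZ pZ zZ.
have e := wderiv_eq_ae lz' ch wz.
split => //; first exact: sobolev2I sz (sobolev1I lz' ch wz).
apply: (@filterS2 _ _ (ae_filter_ringOfSetsType mu) _ _ _ _ zZ e) => x /= h1 h2 _.
rewrite /gradient h1// h2//; ring.
Qed.

Lemma remainder_algebra (m n a b a' b' y w F h : R) :
  -4 * m * (1 * - (b * y + 2 * a * y ^+ 3) + w + b' * (y + F) + 2 * a' * (y + F) ^+ 3)
    - 0 - (-4 * n * w + -4 * n * h) =
  -4 * (m - n) * w + -4 * (m * (- (b * y + 2 * a * y ^+ 3) + b' * (y + F)
    + 2 * a' * (y + F) ^+ 3) - n * h).
Proof. by ring. Qed.

(** The remainder splits into -4 (||z + v||^2 - N) v'', where the first factor is at most 2 C' n,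
    and a continuous part, controlled uniformly by [expansion_gradient]; this gives the constant 8
    C' + 4 C. *)
Lemma gradient_expansion : exists K e : R, [/\ 0 <= K, 0 < e & forall v, sobolev 2 v ->
  sobolev_norm 2 v <= e ->
  L2norm (gradient r (z + v) - gradient r z - hess v) <= K * sobolev_norm 2 v ^+ 2].
Proof.
have [sz2 gz ez] := gradient_eq0.
have [C [e [C0 e0 _ _ h]]] := expansion_gradient.
have [C' [e' [C'0 e'0 _ l' h']]] := expansion_norm sz zZ cZ pZ.
exists (8 * C' + 4 * C), (Num.min 1 (Num.min e e')); split.
- by rewrite addr_ge0// mulr_ge0.
- by rewrite !lt_min ltr01 e0.
move=> v sv; rewrite !le_min => /and3P[v1 ve ve'].
have [F hF] := reps_exists sv; have [_ /= cF pF vF _] := hF 0.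
have [sv1 sv2] := sobolev2P sv; have [_ lw _] := sobolev1P sv2.
have [szv1 ezv1] := sobolev2_lin 1 sz2 sv.
have zvE : (fun x => 1 * z x + v x) = z + v by apply/funext => x; rewrite mul1r.
rewrite zvE in szv1 ezv1.
have lrem : L2 (gradient r (z + v) - gradient r z - hess v).
  exact: (L2_sub (L2_sub (gradient_L2 szv1) (gradient_L2 sz2)) (hess_L2 sv)).
have [_ mrem _] := lrem.
pose Phi x := L2norm (z + v) ^+ 2 * (- (b * Z x + 2 * a * Z x ^+ 3)
     + coef_b r (z + v) * (Z x + F x) + 2 * coef_a r (z + v) * (Z x + F x) ^+ 3).
have cZF : continuous (fun x => Z x + F x) by exact: contD.
have cPhi : continuous (fun x => -4 * (Phi x - N * hess_low v F x)).
  apply: contZ; apply: contD; last by apply/contN/contZ/hess_low_cont.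
  apply: contZ; apply: contD; [apply: contD|]; try by apply: contZ => //; exact: contX.
  by apply: contN; apply: contD; apply: contZ => //; exact: contX.
have pPhi : periodic (fun x => -4 * (Phi x - N * hess_low v F x)) 1.
  by move=> x; rewrite /Phi pZ pF hess_low_periodic.
have bPhi x : `|-4 * (Phi x - N * hess_low v F x)| <= 4 * (C * sobolev_norm 2 v ^+ 2).
  have := h _ (hF x) ve; rewrite /= subr0 => h3.
  by rewrite normrM normrN (@ger0_norm _ 4)// ler_wpM2l.
have remE : gradient r (z + v) - gradient r z - hess v =
  (fun x => -4 * (L2norm (z + v) ^+ 2 - N) * wderiv (wderiv v) x
    + -4 * (Phi x - N * hess_low v F x)) %[ae mu].
  have hr := hess_rep vF.
  have H1 : {ae mu, forall x, [/\ z x = Z x, v x = F x,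
      wderiv (wderiv z) x = - (b * Z x + 2 * a * Z x ^+ 3) &
      wderiv (wderiv (z + v)) x = 1 * wderiv (wderiv z) x + wderiv (wderiv v) x]}.
    have H0 := @filterS2 _ _ (ae_filter_ringOfSetsType mu) _ _ (fun x => z x = Z x /\ v x = F x)
      (fun x h1 h2 => conj (h1 Logic.I) (h2 Logic.I)) zZ vF.
    by apply: (@filterS3 _ _ (ae_filter_ringOfSetsType mu) _ _ _ _ _ H0 ez ezv1) => x /= [h1 h2] h3 h4; split => //; [exact: h3|exact: h4].
  apply: (@filterS3 _ _ (ae_filter_ringOfSetsType mu) _ _ _ _ _ H1 gz hr) => x /= [a1 a2 a3 a4] a5 a6 _.
  have -> : (gradient r (z + v) - gradient r z - hess v) x =
    gradient r (z + v) x - gradient r z x - hess v x by [].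
  rewrite a5// a6// /gradient a4 a3.
  have -> : (z + v) x = z x + v x by [].
  by rewrite a1 a2 /Phi; exact: remainder_algebra.
have := L2norm_ae_bound mrem lw cPhi pPhi bPhi remE.
move=> hb; apply: le_trans hb _.
have n0 := sobolev_norm_ge0 2 v.
have n12 := sobolev_norm12 v.
have h4 : `|L2norm (z + v) ^+ 2 - N| <= 2 * C' * sobolev_norm 2 v.
  have n10 := sobolev_norm_ge0 1 v.
  have := h' v sv1 (le_trans n12 ve'); have := l' v sv1 => b1 b2.
  have -> : L2norm (z + v) ^+ 2 - N = (L2norm (z + v) ^+ 2 - N - 2 * alpha v) + 2 * alpha v by ring.
  apply: le_trans (ler_normD _ _) _.
  have b3 : C' * sobolev_norm 1 v ^+ 2 <= C' * sobolev_norm 2 v.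
    rewrite ler_wpM2l// expr2; apply: le_trans (n12).
    by exact: (ler_piMl n10 (le_trans (sobolev_norm12 v) v1)).
  have b4 : C' * sobolev_norm 1 v <= C' * sobolev_norm 2 v by rewrite ler_wpM2l.
  have -> : 2 * C' * sobolev_norm 2 v = C' * sobolev_norm 2 v + C' * sobolev_norm 2 v by ring.
  apply: lerD; [exact: le_trans b2 b3|exact: le_trans b1 b4].
have -> : (8 * C' + 4 * C) * sobolev_norm 2 v ^+ 2 =
  4 * (2 * C' * sobolev_norm 2 v) * sobolev_norm 2 v + 4 * (C * sobolev_norm 2 v ^+ 2) by ring.
rewrite lerD2r normrM normrN (@ger0_norm _ 4)//.
rewrite ler_pM ?mulr_ge0 ?L2norm_ge0 ?L2norm_wderiv2_le2//.
by rewrite ler_wpM2l.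
Qed.

Lemma hess_is_hessian : is_hessian r z hess.
Proof.
have [sz2 gz ez] := gradient_eq0; have [K [e [K0 e0 hK]]] := gradient_expansion.
split.
- by split => //; case: hz => -[].
- exact: hess_L2.
- move=> c v w sv sw; have [scv _] := sobolev2_lin c sv sw.
  apply: L2norm_cst0.
    exact: (L2_sub (hess_L2 scv) (L2_add (L2_scale c (hess_L2 sv)) (hess_L2 sw))).
  apply: (@filterS _ _ (ae_filter_ringOfSetsType mu) _ _ _ (hess_lin c sv sw)) => x /= h _.
  by apply/eqP; rewrite subr_eq0; apply/eqP; exact: h.
- exact: hess_bounded.
- move=> eps eps0; exists (Num.min e (eps / (K + 1))).
    by rewrite lt_min e0 divr_gt0// ltr_wpDl.
  move=> v sv _; rewrite le_min => /andP[ve vK].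
  apply: le_trans (hK v sv ve) _; rewrite expr2 mulrA ler_wpM2r ?sobolev_norm_ge0//.
  have n0 := sobolev_norm_ge0 2 v.
  apply: (@le_trans _ _ ((K + 1) * sobolev_norm 2 v)); first by rewrite ler_wpM2r// lerDl.
  by rewrite mulrC -ler_pdivlMr// ltr_wpDl.
Qed.

Let pZ1 : periodic Z1 1 := periodic_deriv hZ pZ.
Let cZ1 : continuous Z1 := has_deriv_cont hZ1.

Let DE : D = I (fun x => Z1 x ^+ 2).
Proof.
have [_ [_ m _] _] := sobolev1P sz.
apply: I_ae; [exact: measurable_funX| |exact: (ae_lift1 (fun _ y => y ^+ 2) zZ1)].
by apply: measurable_funX; exact: continuous_measurable_fun.
Qed.

Let bE1 : b = 1 / N ^+ 3 - I (fun x => Z1 x ^+ 2) / N - r / (2 * N * Q).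
Proof. by rewrite -DE. Qed.

Lemma pairing_ae (g v F : R -> R) : continuous g -> measurable_fun [set: R] v -> continuous F ->
  v = F %[ae mu] -> I (fun x => g x * v x) = I (fun x => g x * F x).
Proof.
move=> cg mv cF vF; apply: I_ae; last exact: (ae_lift1 (fun x y => g x * y) vF).
  by apply: measurable_funM => //; exact: continuous_measurable_fun.
by apply: continuous_measurable_fun; exact: contM.
Qed.

(** Integration by parts and the Duffing equation eliminate <z', v'>, so that only the pairings with
    z and z^3 remain in the kernel equation. *)
Lemma gammaE v F F1 : has_deriv F F1 -> continuous F1 -> periodic F 1 ->
  measurable_fun [set: R] (wderiv v) -> wderiv v = F1 %[ae mu] ->
  gamma v = b * alpha F + 2 * a * beta F.
Proof.
move=> hF cF1 pF mv vF1; have [_ [_ mz _] _] := sobolev1P sz.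
rewrite -(mixed_kinetic hZ hZ1 pZ hF cF1 pF) -(pairing_ae cZ1 mv cF1 vF1).
apply: I_ae; [exact: measurable_funM| |exact: (ae_lift1 (fun x y => y * wderiv v x) zZ1)].
by apply: measurable_funM => //; exact: continuous_measurable_fun.
Qed.

(** z' is orthogonal to z and z^3, so the nonlocal terms of the Hessian vanish on it, and the rest
    is the derivative of the Duffing equation. *)
Lemma hess_kernel_Z1 : hessian_kernel hess Z1.
Proof.
have h2 := jacobi_z1 a b hZ.
have c2 : continuous (fun x => - ((b + 6 * a * Z x ^+ 2) * Z1 x)).
  apply/contN/contM => //; apply: contD; [exact: contC|apply: contZ; exact: contX].
have [s2 e1 e2] := classical_sobolev2 hZ1 h2 c2 pZ1.
split => //; have [s1 _] := sobolev2P s2; have [_ [_ m _] _] := sobolev1P s1.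
have al := I_z_z1 hZ hZ1 pZ; have be := I_z3_z1 hZ hZ1 pZ.
have ga := gammaE hZ1 (has_deriv_cont h2) pZ1 m e1.
have hb : hess_b Z1 = 0 by rewrite /hess_b ga al be !(mulr0, mul0r, oppr0, addr0).
have ha : hess_a Z1 = 0 by rewrite /hess_a be !(mulr0, mul0r, oppr0).
apply: (@filterS _ _ (ae_filter_ringOfSetsType mu) _ _ _ e2) => x /= h _.
by rewrite /hess /hess_low h// hb ha; ring.
Qed.

(** After the elimination of gamma the terms with beta cancel because 4 a / N = 2 r / (N Q^2), and
    the formula for b absorbs D. The result is - P in the notation of [linearized_kernel]. *)
Lemma hess_b_kernel v A B : alpha v = A -> beta v = B -> gamma v = b * A + 2 * a * B ->
  hess_b v = - (4 * A / N * (b + 1 / N ^+ 3)).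
Proof.
rewrite /hess_b => -> -> ->; rewrite bE aE; move: N0 Q0; move: N Q D => n q d n0 q0.
by field; rewrite !gt_eqF.
Qed.

Lemma kernel_algebra (p q F y : R) :
  - (b * F + 6 * a * y ^+ 2 * F + - p * y + - q * y ^+ 3) =
  - ((b + 6 * a * y ^+ 2) * F) + p * y + q * y ^+ 3.
Proof. by ring. Qed.

Lemma hess_kernel_span v : hessian_kernel hess v -> exists c, v = (fun x => c * Z1 x) %[ae mu].
Proof.
move=> [sv hv]; have [sv1 sv2] := sobolev2P sv.
have [lv lv1 _] := sobolev1P sv1; have [_ lv2 wv2] := sobolev1P sv2.
have [F [cF pF vF _ _]] := sobolev1_rep sv1.
have ch : continuous (fun x => - hess_low v F x) by apply/contN/hess_low_cont.
have ph : periodic (fun x => - hess_low v F x) 1 by move=> x; rewrite hess_low_periodic.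
have lh := L2_cont ph ch.
(* The kernel equation solved for v''. Its right-hand side is continuous once v is replaced by F, so
   v has a classical representative. *)
have e2 : wderiv (wderiv v) = (fun x => - hess_low v F x) %[ae mu].
  apply: (@filterS2 _ _ (ae_filter_ringOfSetsType mu) _ _ _ _ vF hv) => x /= h1 h2 _.
  move: (h2 Logic.I); rewrite /hess => /eqP; rewrite mulf_eq0 mulf_eq0 oppr_eq0.
  rewrite (gt_eqF N0) pnatr_eq0/= addr_eq0 => /eqP ->.
  by rewrite /hess_low h1.
have wh := weak_derivative_ae lv1 lv1 lv2 lh (ae_eq_refl _ _ _) e2 wv2.
have [F1 [hF hF1 pF1 vF1]] := weak_ode_regular sv1 cF pF vF ch ph wh.
have [_ mv _] := lv; have [_ mv1 _] := lv1.
have al : alpha v = alpha F by exact: pairing_ae.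
have be : beta v = beta F by apply: pairing_ae => //; exact: contX.
have cF1 := has_deriv_cont hF1.
have hb := hess_b_kernel al be (gammaE hF cF1 pF mv1 vF1).
have ha : 2 * hess_a v = - (16 * a * beta F / Q).
  rewrite /hess_a be aE; move: Q0; move: (beta F) Q => B q q0.
  by field; rewrite !gt_eqF.
have [c hc] : exists c, forall x, F x = c * Z1 x.
  apply: (linearized_kernel r0 N0 Q0 bE1 aE hZ hZ1 pZ hF pF) => x.
  by apply: deriv_val (hF1 x) _; rewrite /hess_low hb ha; exact: kernel_algebra.
exists c; apply: (@filterS _ _ (ae_filter_ringOfSetsType mu) _ _ _ vF) => x /= h _.
by rewrite h.
Qed.

Lemma hess_kernel_dimension : has_dimension (hessian_kernel hess) 1.
Proof.
have sum1 (c : 'I_1 -> R) : \sum_(i < 1) c i *: Z1 = (fun x => c ord0 * Z1 x).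
  by rewrite big_ord1.
exists (fun=> Z1); split.
- by move=> _; exact: hess_kernel_Z1.
- move=> c; rewrite sum1 => h i.
  have N2 : 0 < 1 / N ^+ 2 by rewrite divr_gt0// exprn_gt0.
  have a0 : 0 <= a by rewrite aE divr_ge0// mulr_ge0// sqr_ge0.
  have en := energy N0 Q0 bE1 aE hZ hZ1.
  (* Linear independence means that z' is not the zero class: it is continuous and nonzero at a zero
     of z. *)
  have [x0 zx0] := duffing_zero_exists a0 N2 hZ hZ1 en pZ.
  have nz := duffing_zero_deriv_neq0 N2 en zx0.
  have cc : continuous (fun x => c ord0 * Z1 x) by exact: contZ.
  have := ae_cont_eq cc (@contC R 0) h; move/(congr1 (fun f => f x0)) => /eqP.
  by rewrite mulf_eq0 (negbTE nz) orbF (ord1 i) => /eqP.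
- move=> v /hess_kernel_span[c hc]; exists (fun=> c).
  by rewrite sum1.
Qed.

End hessian.

Theorem theoremB (R : realType) (r : R) (hr : 0 <= r) (z : R -> R)
    (hz : critical_point r z) : is_nondegenerate r z.
Proof.
have [Z [Z1 [zZ pZ hZ hZ1 zZ1]]] := critical_regular hz.
exists (hess r z Z); split; first exact: (hess_is_hessian hz zZ pZ hZ).
exact: (hess_kernel_dimension hr hz zZ pZ hZ hZ1 zZ1).
Qed.
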